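(* Let $0<s<1$, let $\Omega\subset\mathbb{R}^n$ be a bounded and open domain that satisfies the segment property, let $M$ be a Young function, and let $a\colon\mathbb{R}^n\times\mathbb{R}^n\times\mathbb{R}\to\mathbb{R}$ be an admissible kernel for $M$ (as defined in the context). Then the operator $\mathcal{L}_a^s$ is pseudomonotone, that is: if $\{u_i\}_{i\in\mathbb{N}}\subset\mathrm{Dom}(\mathcal{L}_a^s)$, $u\in W^s_0L_M(\Omega)$ and $f\in W^{-s}L_{\bar M}(\Omega)$ satisfy (1) $u_i\to u$ for $\sigma(W^s_0L_M(\Omega),W^{-s}E_{\bar M}(\Omega))$, (2) $\mathcal{L}_a^su_i\to f$ for $\sigma(W^{-s}L_{\bar M}(\Omega),W^s_0E_M(\Omega))$, (3) $\limsup_{i\to\infty}\langle\mathcal{L}_a^su_i,u_i\rangle\le\langle f,u\rangle$, then $u\in\mathrm{Dom}(\mathcal{L}_a^s)$, $\mathcal{L}_a^su=f$, and $\langle\mathcal{L}_a^su_i,u_i\rangle\to\langle f,u\rangle$ as $i\to\infty$.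
   Context: Young functions. A Young function is an even, convex, continuous $M\colon\mathbb{R}\to\mathbb{R}$ with $M(t)>0$ for $t>0$, $M(t)/t\to0$ as $t\to0$, $M(t)/t\to\infty$ as $t\to\infty$, of the form $M(t)=\int_0^{|t|}m(\tau)\,d\tau$ with $m\colon[0,\infty)\to[0,\infty)$ increasing, right continuous, $m(t)=0$ iff $t=0$, and $m(t)\to\infty$ as $t\to\infty$. Its complementary function is $\bar M(t)=\sup\{\tau|t|-M(\tau):\tau\ge0\}$, and $\bar M^{-1}$ is the inverse of $\bar M$ on $[0,\infty)$. No $\Delta_2$-condition is assumed on $M$ or $\bar M$. Orlicz spaces. For a measure space $(U,\mu)$, $L_M(U,d\mu)$ is the set of measurable $u$ with $\int_U M(u/k)\,d\mu<\infty$ for some $k>0$, with Luxemburg norm $\inf\{k>0:\int_UM(u/k)\,d\mu\le1\}$; $E_M(U,d\mu)$ is the set of measurable $u$ with $\int_U M(u/k)\,d\mu<\infty$ for every $k>0$. Let $d\nu_n=\frac{dx\,dy}{|x-y|^n}$ on $\mathbb{R}^{2n}$. Write $L_M=L_M(\mathbb{R}^n,dx)$, $E_M=E_M(\mathbb{R}^n,dx)$, $L_M(\nu_n)=L_M(\mathbb{R}^{2n},d\nu_n)$, $E_M(\nu_n)=E_M(\mathbb{R}^{2n},d\nu_n)$, with norms $\|\cdot\|_M$, $\|\cdot\|_{M,\nu_n}$; similarly for $\bar M$. Fractional spaces. $D^su(x,y)=\frac{u(x)-u(y)}{|x-y|^s}$. $W^sL_M=\{u\in L_M:D^su\in L_M(\nu_n)\}$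 and $W^sE_M=\{u\in E_M:D^su\in E_M(\nu_n)\}$, with norm $\|u\|_{s,M}=\|u\|_M+\|D^su\|_{M,\nu_n}$, identified with subspaces of $L_M\times L_M(\nu_n)$ via $u\mapsto(u,D^su)$. $W^s_0L_M(\Omega)$ is the closure of $\mathcal{D}(\Omega)=C_c^\infty(\Omega)$ (extended by zero) in $W^sL_M$ for the topology $\sigma(L_M\times L_M(\nu_n),E_{\bar M}\times E_{\bar M}(\nu_n))$; $W^s_0E_M(\Omega)$ is the norm closure of $\mathcal{D}(\Omega)$ in $W^sE_M$. For $F\in L_{\bar M}(\nu_n)$ the fractional divergence is $\mathrm{div}^sF(x)=\mathrm{p.v.}\int_{\mathbb{R}^n}\frac{F(y,x)-F(x,y)}{|x-y|^{n+s}}\,dy$, understood as the functional $\langle\mathrm{div}^sF,u\rangle=-\iint_{\mathbb{R}^{2n}}F\,D^su\,d\nu_n$. $W^{-s}L_{\bar M}(\Omega)$ (resp. $W^{-s}E_{\bar M}(\Omega)$) is the space of distributions on $\Omega$ of the form $f+\mathrm{div}^sF$ with $f\in L_{\bar M}$, $F\in L_{\bar M}(\nu_n)$ (resp. $f\in E_{\bar M}$, $F\in E_{\bar M}(\nu_n)$), paired with $W^s_0L_M(\Omega)$ by $\langle f+\mathrm{div}^sF,u\rangle=\int fu\,dx-\iint F\,D^su\,d\nu_n$. Convergence $u_i\to u$ for $\sigma(W^s_0L_M(\Omega),W^{-s}E_{\bar M}(\Omega))$ means $\langle\phi,u_i\rangle\to\langle\phi,u\rangle$ for all $\phi\in W^{-s}E_{\bar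 M}(\Omega)$; convergence $f_i\to f$ for $\sigma(W^{-s}L_{\bar M}(\Omega),W^s_0E_M(\Omega))$ means $\langle f_i,v\rangle\to\langle f,v\rangle$ for all $v\in W^s_0E_M(\Omega)$. Admissible kernel for $M$. $a(x,y,\xi)$ is measurable in $(x,y)$ for every $\xi$ and continuous in $\xi$ for a.e. $(x,y)$; and for a.e. $(x,y)\in\mathbb{R}^{2n}$ and all $\xi,\xi'\in\mathbb{R}$: $a(x,y,-\xi)=-a(x,y,\xi)$; $a(x,y,\xi)\xi>0$ if $\xi\ne0$; $|a(x,y,\xi)|\le d(x,y)+b\,\bar M^{-1}(M(c\xi))$ for some fixed $d\in E_{\bar M}(\nu_n)$ and constants $b,c>0$; $(a(x,y,\xi)-a(x,y,\xi'))(\xi-\xi')\ge0$. Operator. $\mathrm{Dom}(\mathcal{L}_a^s)=\{u\in W^s_0L_M(\Omega):a(x,y,D^su(x,y))\in L_{\bar M}(\nu_n)\}$ and $\mathcal{L}_a^su=-\mathrm{div}^s(a(x,y,D^su(x,y)))$, so that $\langle\mathcal{L}_a^su,v\rangle=\iint_{\mathbb{R}^{2n}}a(x,y,D^su)D^sv\,d\nu_n$ for $v\in W^s_0L_M(\Omega)$. *)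

(* Defs.v *)
From HB Require Import structures.
From mathcomp Require Import all_boot all_order all_algebra.
From mathcomp Require Import all_classical all_reals all_analysis.
From mathcomp Require Import measurable_realfun.

Set Implicit Arguments.
Unset Strict Implicit.
Unset Printing Implicit Defensive.

Import Order.TTheory GRing.Theory Num.Theory.
Import numFieldNormedType.Exports.

Local Open Scope classical_set_scope.
Local Open Scope ring_scope.

Definition rV_display : measure_display -> measure_display.
Proof. exact. Qed.

Section measurable_rV.
Context {d} {T : measurableType d} (n : nat).

Let coord (i : 'I_n) (x : 'rV[T]_n) : T := x ord0 i.

Let rV_set0 : g_sigma_preimage coord set0.
Proof. exact: sigma_algebra0. Qed.

Let rV_setC A : g_sigma_preimage coord A -> g_sigma_preimage coord (~` A).
Proof. exact: sigma_algebraC. Qed.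

Let rV_bigcup (F : _^nat) : (forall i, g_sigma_preimage coord (F i)) ->
  g_sigma_preimage coord (\bigcup_i (F i)).
Proof. exact: sigma_algebra_bigcup. Qed.

HB.instance Definition _ := @isMeasurable.Build (rV_display d)
  'rV[T]_n (g_sigma_preimage coord) rV_set0 rV_setC rV_bigcup.

End measurable_rV.

Lemma measurable_coord d (T : measurableType d) n (i : 'I_n) :
  measurable_fun [set: 'rV[T]_n] (fun x => x ord0 i).
Proof.
move=> _ Y mY; rewrite setTI; apply: sub_sigma_algebra => /=.
rewrite -bigcup_seq/=; exists i => /=; first by rewrite mem_index_enum.
by exists Y => //; rewrite setTI.
Qed.

Lemma measurable_fun_rV d1 d2 (T1 : measurableType d1) (T2 : measurableType d2)
    n (f : T1 -> 'rV[T2]_n) :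
  (forall i, measurable_fun [set: T1] (fun t => f t ord0 i)) ->
  measurable_fun [set: T1] f.
Proof.
move=> mf.
suff : g_sigma_preimage (fun i => (fun x : 'rV[T2]_n => x ord0 i) \o f)
    `<=` measurable.
  rewrite (g_sigma_preimage_comp (T := 'rV[T2]_n)) => prefS _ A mA.
  by apply: prefS; exists A.
apply: smallest_sub; first exact: sigma_algebra_measurable.
case: n => [|n] in f mf *; first by rewrite big_ord0.
rewrite -bigcup_mkord_ord; apply: bigcup_sub => i Ii.
by move=> A [B mB <-]; exact: mf.
Qed.

(* The Lebesgue measure on R^n, by induction on n: R^(n+1) is R * R^n read
   through [cons_rV]. *)
Section lebesgue_rV.
Context {R : realType}.

Definition cons_rV n (p : R * 'rV[R]_n) : 'rV[R]_n.+1 :=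
  row_mx (const_mx p.1 : 'rV[R]_1) p.2.

Definition uncons_rV n (x : 'rV[R]_n.+1) : R * 'rV[R]_n :=
  (x ord0 ord0, \row_j x ord0 (lift ord0 j)).

Lemma cons_rV0 n (p : R * 'rV[R]_n) : cons_rV p ord0 ord0 = p.1.
Proof.
by rewrite /cons_rV mxE; case: splitP => // i _; rewrite mxE.
Qed.

Lemma cons_rVS n (p : R * 'rV[R]_n) j : cons_rV p ord0 (lift ord0 j) = p.2 ord0 j.
Proof.
rewrite /cons_rV mxE; case: splitP => [i|i /= [ji]]; first by rewrite ord1.
by congr (p.2 _ _); exact: val_inj.
Qed.

Lemma cons_rVK n : cancel (@cons_rV n) (@uncons_rV n).
Proof.
move=> p; rewrite /uncons_rV cons_rV0 [RHS]surjective_pairing; congr pair.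
by apply/rowP => j; rewrite mxE cons_rVS.
Qed.

Lemma measurable_cons_rV n : measurable_fun setT (@cons_rV n).
Proof.
apply: measurable_fun_rV => i; have [j ->|->] := unliftP ord0 i.
  rewrite (_ : (fun _ => _) = (fun x : 'rV_n => x ord0 j) \o snd).
    by apply: measurableT_comp => //; exact: measurable_coord.
  by apply/funext => p /=; rewrite cons_rVS.
rewrite (_ : (fun _ => _) = fst) //.
by apply/funext => p /=; rewrite cons_rV0.
Qed.

Lemma measurable_uncons_rV n : measurable_fun setT (@uncons_rV n).
Proof.
apply: measurable_fun_pair; first exact: measurable_coord.
apply: measurable_fun_rV => i.
by under eq_fun do rewrite mxE; exact: measurable_coord.
Qed.

Section step.
Variables (n : nat) (mu : {sigma_finite_measure set 'rV[R]_n -> \bar R}).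

Definition lebesgue_rVS : set 'rV[R]_n.+1 -> \bar R :=
  pushforward (lebesgue_measure \x mu)%E (@cons_rV n).

Let pushforward_cons : {measure set 'rV[R]_n.+1 -> \bar R} :=
  measure_function_pushforward__canonical__measure_function_Measure
    (lebesgue_measure \x mu)%E (@measurable_cons_rV n).

HB.instance Definition _ := isMeasure.Build _ _ _ lebesgue_rVS
  (measure0 pushforward_cons) (measure_ge0 pushforward_cons)
  (@measure_semi_sigma_additive _ _ _ pushforward_cons).

Let lebesgue_rVS_sigma_finite : sigma_finite setT lebesgue_rVS.
Proof.
have /sigma_finiteP[F [FT ndF Foo]] := sigma_finiteT (@lebesgue_measure R).
have /sigma_finiteP[G [GT ndG Goo]] := sigma_finiteT mu.
exists (fun k => @uncons_rV n @^-1` (F k `*` G k)).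
  rewrite -preimage_bigcup; apply/esym; rewrite -subTset => x _.
  have : [set: R] (uncons_rV x).1 by [].
  have : setT (uncons_rV x).2 by [].
  rewrite FT GT => -[k _ Gk] [l _ Fl]; exists (maxn k l) => //; split.
    by move: Fl; exact/subsetPset/ndF/leq_maxr.
  by move: Gk; exact/subsetPset/ndG/leq_maxl.
move=> k; have [mF Fk] := Foo k; have [mG Gk] := Goo k; split.
  by rewrite -[X in measurable X]setTI; apply: measurable_uncons_rV => //;
    exact: measurableX.
rewrite /lebesgue_rVS /pushforward -comp_preimage.
rewrite (_ : _ \o _ = id); last by apply/funext => p; exact: cons_rVK.
by rewrite preimage_id product_measure1E// lte_mul_pinfty// ge0_fin_numE.
Qed.

HB.instance Definition _ := Measure_isSigmaFinite.Build _ _ _ lebesgue_rVS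
  lebesgue_rVS_sigma_finite.

End step.

Fixpoint lebesgue_rV (n : nat) : {sigma_finite_measure set 'rV[R]_n -> \bar R} :=
  match n with
  | 0 => \d_ (0 : 'rV[R]_0)
  | m.+1 => lebesgue_rVS (lebesgue_rV m)
  end.

Lemma measurable_box n (A : 'I_n -> set R) : (forall i, measurable (A i)) ->
  measurable [set x : 'rV[R]_n | forall i, A i (x ord0 i)].
Proof.
move=> mA; rewrite (_ : mkset _ =
    \bigcap_(i in setT) (fun x : 'rV[R]_n => x ord0 i) @^-1` A i).
  apply: fin_bigcap_measurable => // i _; rewrite -[X in measurable X]setTI.
  exact: measurable_coord.
by apply/seteqP; split => x /= Ax i; [move=> _|]; exact: Ax.
Qed.

Lemma lebesgue_rV_box n (A : 'I_n -> set R) : (forall i, measurable (A i)) ->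
  lebesgue_rV n [set x : 'rV[R]_n | forall i, A i (x ord0 i)] =
  (\prod_(i < n) lebesgue_measure (A i))%E.
Proof.
elim: n A => [|n IH] A mA.
  by rewrite big_ord0 /= diracE mem_set// => -[].
rewrite big_ord_recl -(IH (fun i => A (lift ord0 i)))//= -product_measure1E//.
  rewrite /lebesgue_rVS /pushforward; congr (_ _); apply/seteqP.
  split => [p /= Ap|p /= [Ap0 Ap] i].
    split; first by have := Ap ord0; rewrite cons_rV0.
    by move=> i; have := Ap (lift ord0 i); rewrite cons_rVS.
  by have [j ->|->] := unliftP ord0 i; rewrite ?cons_rV0 ?cons_rVS.
  exact: mA.
exact: (measurable_box (A := fun i => A (lift ord0 i)) (fun i => mA _)).
Qed.

End lebesgue_rV.

Section euclidean.
Context {R : realType} (n : nat).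
Implicit Types x y : 'rV[R]_n.

(* The norm of the library on ['rV[R]_n] is the sup norm. *)
Definition enorm x : R := Num.sqrt (\sum_i x ord0 i ^+ 2).

Lemma measurable_enormB :
  measurable_fun setT (fun p : 'rV[R]_n * 'rV[R]_n => enorm (p.1 - p.2)).
Proof.
apply: (measurableT_comp (continuous_measurable_fun (@sqrt_continuous R))).
apply: measurable_sum => i; apply: measurable_funX.
under eq_fun do rewrite !mxE.
apply: measurable_funB.
  exact: (measurableT_comp (measurable_coord i) measurable_fst).
exact: (measurableT_comp (measurable_coord i) measurable_snd).
Qed.

(* [dx dy / |x - y| ^ n]; the (negligible) diagonal gets weight [0^-1 = 0]. *)
Definition frac_weight (p : 'rV[R]_n * 'rV[R]_n) : \bar R :=
  (enorm (p.1 - p.2) ^- n)%:E.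

Definition frac_measure : set ('rV[R]_n * 'rV[R]_n) -> \bar R :=
  fun A => (\int[lebesgue_rV n \x lebesgue_rV n]_(p in A) frac_weight p)%E.

Lemma frac_weight_ge0 p : (0 <= frac_weight p)%E.
Proof. by rewrite lee_fin invr_ge0 exprn_ge0// sqrtr_ge0. Qed.

Lemma measurable_frac_weight : measurable_fun setT frac_weight.
Proof.
apply/measurable_EFinP.
rewrite (_ : (fun _ => _) = (@powR R)^~ (- n%:R) \o
    (fun p : 'rV[R]_n * 'rV[R]_n => enorm (p.1 - p.2))).
  by apply: measurableT_comp; [exact: measurable_powR|exact: measurable_enormB].
by apply/funext => p /=; rewrite powRN powR_mulrn// sqrtr_ge0.
Qed.

Let frac_measure0 : frac_measure set0 = 0%E.
Proof. exact: integral_set0. Qed.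

Let frac_measure_ge0 A : (0 <= frac_measure A)%E.
Proof. by apply: integral_ge0 => p _; exact: frac_weight_ge0. Qed.

Let frac_measure_semi_sigma_additive : semi_sigma_additive frac_measure.
Proof.
apply: semi_sigma_additive_nng_induced; first exact: measurable_frac_weight.
exact: frac_weight_ge0.
Qed.

HB.instance Definition _ := isMeasure.Build _ _ _ frac_measure
  frac_measure0 frac_measure_ge0 frac_measure_semi_sigma_additive.

End euclidean.
Arguments frac_measure {R} n.

Section young.
Context {R : realType}.
Implicit Types M m : R -> R.

Definition young_density m : Prop :=
  [/\ forall t, 0 <= t -> 0 <= m t,
      forall t t', 0 <= t -> t <= t' -> m t <= m t',
      forall t, 0 <= t -> m x @[x --> t^'+] --> m t,
      forall t, 0 <= t -> (m t = 0 <-> t = 0) &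
      m t @[t --> +oo] --> +oo].

Definition young_function M : Prop :=
  [/\ forall t, M (- t) = M t, convex_function setT M & continuous M] /\
  [/\ forall t, 0 < t -> 0 < M t,
      M t / t @[t --> 0^'] --> 0,
      M t / t @[t --> +oo] --> +oo &
      exists2 m, young_density m &
        forall t, M t = \int[lebesgue_measure]_(x in `[0, `|t|]) m x].

Definition conj_young M : R -> R :=
  fun t => sup [set x * `|t| - M x | x in [set x | 0 <= x]].

Definition conj_young_inv M : R -> R :=
  'pinv_(fun=> 0) [set t | 0 <= t] (conj_young M).

End young.

Section orlicz.
Context d (T : measurableType d) (R : realType).
Variable mu : {measure set T -> \bar R}.
Implicit Types (M : R -> R) (u v : T -> R).

(* Measurability for the completion of [mu], i.e. Lebesgue measurability when
   [mu] is the Lebesgue measure on the Borel sets. *)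
Definition ae_measurable u : Prop :=
  exists2 v, measurable_fun setT v & {ae mu, forall x, u x = v x}.

Definition modular M u : \bar R := (\int[mu]_x (M (u x))%:E)%E.

Definition orliczL M : set (T -> R) := [set u | ae_measurable u /\
  exists2 k : R, 0 < k & (modular M (fun x => u x / k)%R < +oo)%E].

Definition orliczE M : set (T -> R) := [set u | ae_measurable u /\
  forall k : R, 0 < k -> (modular M (fun x => u x / k)%R < +oo)%E].

Definition luxemburg M u : \bar R :=
  ereal_inf [set k%:E | k in [set k : R |
    0 < k /\ (modular M (fun x => u x / k)%R <= 1)%E]].

End orlicz.

Section domain.
Context {R : realType} (n : nat).
Implicit Types (Omega : set 'rV[R]_n) (u : 'rV[R]_n -> R).

Definition segment_property Omega : Prop :=
  forall x, (closure Omega `\` Omega°) x ->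
  exists (U : set 'rV[R]_n) (y : 'rV[R]_n), [/\ open U, U x, y != 0 &
    forall z t, closure Omega z -> U z -> 0 < t < 1 -> Omega (z + t *: y)].

Definition iter_partial (l : seq 'I_n) u : 'rV[R]_n -> R :=
  foldr (fun i v => 'D_(delta_mx ord0 i) v) u l.

(* Differentiability of all iterated partial derivatives also gives their
   continuity. *)
Definition smooth u : Prop :=
  forall (l : seq 'I_n) x, differentiable (iter_partial l u) x.

Definition test_function Omega : set ('rV[R]_n -> R) := [set u |
  smooth u /\ let supp := closure [set x | u x != 0] in
    compact supp /\ supp `<=` Omega].

End domain.

Section sigma_topology.
Context {R : realType} {X I : Type} (pair : I -> X -> R).

(* The coarsest topology on [X] making all the [pair i] continuous. *)
Definition sigma_topology :=
  initial_topology (fun u : X => (fun i => pair i u) : {ptws I -> R}).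

End sigma_topology.

Section fractional.
Context {R : realType} {n : nat} (s : R).
Local Notation Rn := 'rV[R]_n.
Local Notation leb := (lebesgue_rV n).
Local Notation nu := (frac_measure n).
Implicit Types (M : R -> R) (Omega : set Rn) (u v : Rn -> R).

Definition fracD u : Rn * Rn -> R :=
  fun p => (u p.1 - u p.2) / (enorm (p.1 - p.2) `^ s).

Definition Ws_embed u : (Rn -> R) * (Rn * Rn -> R) := (u, fracD u).

Definition orliczLL M : set ((Rn -> R) * (Rn * Rn -> R)) :=
  orliczL leb M `*` orliczL nu M.

Definition orliczEE M : set ((Rn -> R) * (Rn * Rn -> R)) :=
  orliczE leb M `*` orliczE nu M.

Definition WsL M : set (Rn -> R) := [set u | orliczLL M (Ws_embed u)].

Definition WsE M : set (Rn -> R) := [set u | orliczEE M (Ws_embed u)].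

Definition Ws_norm M u : \bar R :=
  (luxemburg leb M u + luxemburg nu M (fracD u))%E.

Definition prod_pairing (g : (Rn -> R) * (Rn * Rn -> R))
    (U : (Rn -> R) * (Rn * Rn -> R)) : R :=
  \int[leb]_x (U.1 x * g.1 x) + \int[nu]_p (U.2 p * g.2 p).

Definition prod_sigma_topology M :=
  sigma_topology (fun g : orliczEE (conj_young M) => prod_pairing (set_val g)).

Definition Ws0L M Omega : set (Rn -> R) := [set u | WsL M u /\
  closure (Ws_embed @` test_function Omega : set (prod_sigma_topology M))
    (Ws_embed u)].

Definition Ws0E M Omega : set (Rn -> R) := [set u | WsE M u /\
  forall e : R, 0 < e ->
    exists2 phi, test_function Omega phi & (Ws_norm M (u \- phi)%R < e%:E)%E].

(* The distribution [f + div^s F] on [Omega] is represented by the pair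
   [(f, F)]: equality of distributions is [distr_eq], and [pairing] computes the
   duality with [Ws0L] from the representing pair. *)
Definition distr : Type := ((Rn -> R) * (Rn * Rn -> R))%type.

Definition WmL M : set distr := orliczLL (conj_young M).

Definition WmE M : set distr := orliczEE (conj_young M).

Definition pairing (f : distr) u : R :=
  \int[leb]_x (f.1 x * u x) - \int[nu]_p (f.2 p * fracD u p).

Definition distr_eq Omega (f g : distr) : Prop :=
  forall phi, test_function Omega phi -> pairing f phi = pairing g phi.

Definition admissible_kernel M (a : Rn -> Rn -> R -> R) : Prop :=
  [/\ forall xi, ae_measurable (leb \x leb)%E (fun p => a p.1 p.2 xi),
      {ae (leb \x leb)%E, forall p, continuous (a p.1 p.2)},
      {ae (leb \x leb)%E, forall p, forall xi, a p.1 p.2 (- xi) = - a p.1 p.2 xi} &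
      {ae (leb \x leb)%E, forall p, forall xi, xi != 0 -> 0 < a p.1 p.2 xi * xi}] /\
  (exists d b c, [/\ orliczE nu (conj_young M) d, 0 < b, 0 < c &
      {ae (leb \x leb)%E, forall p, forall xi,
        `|a p.1 p.2 xi| <= d p + b * conj_young_inv M (M (c * xi))}]) /\
  {ae (leb \x leb)%E, forall p, forall xi xi',
    0 <= (a p.1 p.2 xi - a p.1 p.2 xi') * (xi - xi')}.

Definition Lflux (a : Rn -> Rn -> R -> R) u : Rn * Rn -> R :=
  fun p => a p.1 p.2 (fracD u p).

Definition Lop_dom M Omega a : set (Rn -> R) :=
  [set u | Ws0L M Omega u /\ orliczL nu (conj_young M) (Lflux a u)].

(* [- div^s (a (x, y, D^s u))] *)
Definition Lop a u : distr := (cst 0, fun p => - Lflux a u p).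

End fractional.

(* Main.v *)
(* The fluxes A_i = a(D^s u_i) are bounded in L_N (N the conjugate of M): a gliding hump
   argument bounds the modulars of D^s u_i, and monotonicity tested against bounded functions
   w, together with the bound on the energies, bounds those of A_i.  Along any ultrafilter a
   Radon-Nikodym argument yields a weak limit h of A_i against E_M.  By hypothesis (2),
   \int h D^s phi = <f, phi> for all test functions phi.

   To conclude that \int h D^s u = <f, u> =: l one needs that a pair (g, G) in L_N x L_N which
   annihilates D(Omega) annihilates W^s_0 L_M(Omega).  An element u of that space vanishes off
   Omega; cut it by Lipschitz tents along a finite cover adapted to the segment property, so
   that small translates of each piece v have support well inside Omega.  Averaging
   P(v(. - k)), where P is the functional given by (g, G), over k against a mollifier gives
   zero by Fubini, and k |-> P(v(. - k)) is continuous along subsequences, so P(v) = 0.  No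
   density in norm is needed, and it may fail without a Delta_2 condition.

   Minty's trick then gives h = a(D^s u), and the same monotonicity inequality gives
   liminf \int A_i D^s u_i >= l, hence the convergence of the energies. *)
Require Import Defs.
From HB Require Import structures.
From mathcomp Require Import all_boot all_order all_algebra.
From mathcomp Require Import all_classical all_reals all_analysis.
From mathcomp Require Import measurable_realfun ring lra.

Set Implicit Arguments.
Unset Strict Implicit.
Unset Printing Implicit Defensive.

Import Order.TTheory GRing.Theory Num.Theory.
Import numFieldNormedType.Exports.

Local Open Scope classical_set_scope.
Local Open Scope ring_scope.

(** * Young functions and conjugate pairs *)

(** Without a Delta_2 condition [D^s u] lies only in L_M, while hypothesis (1) can be tested only
    against E_N and weak limits of fluxes only against E_M. Every argument therefore runs through
    truncations: bounded functions living where an integrable weight [theta] is bounded below belong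
    to E_M and E_N at once, and their fluxes belong to E_N. Minty's argument truncates [D^s u] at
    two levels, a fixed one carrying the perturbation and one tending to infinity. Bounds are kept
    as modulars rather than norms, because the energy inequality is nonlinear in the test function
    and yields modulars by duality. An ultrafilter gives one limit against all of E_M at once; since
    the limit energy is the same for every ultrafilter, the full sequence of energies converges. A
    second obstacle is that membership in the spaces and the conditions on the kernel hold only
    almost everywhere, whereas Fubini, translations and composition with the kernel act on honest
    functions: [u], the [u_i] and the kernel are replaced by regular representatives first. *)

Section even_convex.
Context {R : realType}.
Implicit Types M N : R -> R.

(** Shared by [M] and its conjugate, so that later statements can be applied with the two exchanged;
    nonnegativity and continuity follow from it. *)
Definition even_convex M : Prop := [/\ M 0 = 0, forall t : R, M (- t) = M t &
  forall a b l : R, 0 <= l <= 1 -> M (l * a + (1 - l) * b) <= l * M a + (1 - l) * M b].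

Lemma even_convex_ge0 M : even_convex M -> forall t : R, 0 <= M t.
Proof.
move=> [M0 ME cM] t; have := cM t (- t) 2^-1 (_ : 0 <= 2^-1 <= (1 : R)).
rewrite ME (_ : _ + _ = 0); last by field.
by rewrite M0 => /(_ ltac:(lra)); lra.
Qed.

Lemma even_convex_abs M : even_convex M -> forall t : R, M `|t| = M t.
Proof. by move=> [_ ME _] t; case: (ler0P t). Qed.

Lemma even_convex_shrink M : even_convex M ->
  forall l t : R, 0 <= l <= 1 -> M (l * t) <= l * M t.
Proof. by move=> [M0 _ cM] l t /(cM t 0 l); rewrite mulr0 addr0 M0 mulr0 addr0. Qed.

Lemma even_convex_mono M : even_convex M ->
  forall a b : R, `|a| <= `|b| -> M a <= M b.
Proof.
move=> eM a b ab; rewrite -(even_convex_abs eM a) -(even_convex_abs eM b).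
have [b0|b0] := eqVneq b 0.
  by move: ab; rewrite b0 normr0 normr_le0 => /eqP ->; rewrite normr0.
have bp : 0 < `|b| by rewrite normr_gt0.
have l01 : 0 <= `|a| / `|b| <= 1.
  by rewrite divr_ge0//= ler_pdivrMr// mul1r.
have := even_convex_shrink eM `|b| l01; rewrite divfK ?gt_eqF// => /le_trans; apply.
by rewrite ler_piMl ?(even_convex_ge0 eM)//; case/andP: l01.
Qed.

Lemma even_convex_midpoint M : even_convex M ->
  forall a b : R, M (a + b) <= 2^-1 * M (2 * a) + 2^-1 * M (2 * b).
Proof.
move=> [_ _ cM] a b.
have e1 : 2^-1 * (2 * a) + (1 - 2^-1) * (2 * b) = a + b by lra.
have e2 : 1 - 2^-1 = 2^-1 :> R by lra.
by have := cM (2 * a) (2 * b) 2^-1; rewrite e1 e2; apply; lra.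
Qed.

Lemma even_convex_measurable M : even_convex M -> measurable_fun setT M.
Proof.
move=> eM; have -> : M = (fun x => M (Num.max x 0)) \o (fun x => `|x|).
  apply/funext => x /=; rewrite max_l//.
  by rewrite even_convex_abs.
apply: measurableT_comp => //; apply: nondecreasing_measurable => // x y xy.
have max0 (z : R) : 0 <= Num.max z 0 by rewrite le_max lexx orbT.
apply: even_convex_mono => //; rewrite !ger0_norm//.
by rewrite ge_max !le_max xy lexx orbT.
Qed.

(** Convexity is applied twice: [t + h] lies between [t] and a unit step in the direction of [h],
    which bounds the increase; [t] lies between [t + h] and the opposite unit step, with weights
    [1 / (1 + l)] and [l / (1 + l)] for [l = |h|], which bounds the decrease. *)
Lemma even_convex_dist M : even_convex M ->
  forall t h : R, `|h| <= 1 -> `|M (t + h) - M t| <= `|h| * M (`|t| + 1).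
Proof.
move=> eM t h h1; have [M0 ME cM] := eM.
have sgh : Num.sg h * `|h| = h by rewrite -numEsg.
have Mt1 u : u = Num.sg h \/ u = - Num.sg h -> M (t + u) <= M (`|t| + 1).
  move=> uh; apply: even_convex_mono => //.
  rewrite [leRHS]ger0_norm ?addr_ge0// (le_trans (ler_normD _ _))// lerD2l.
  by case: uh => ->; rewrite ?normrN normr_sg; case: eqP.
have h0 := normr_ge0 h; move: h1 h0 sgh Mt1.
move: `|h| (Num.sg h) => l sg h1 h0 <- Mt1 {h}.
have M0t := even_convex_ge0 eM t; have M1 := even_convex_ge0 eM (`|t| + 1).
rewrite ler_norml; apply/andP; split; last first.
  have : M (t + sg * l) <= l * M (t + sg) + (1 - l) * M t.
    have -> : t + sg * l = l * (t + sg) + (1 - l) * t by ring.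
    by apply: cM; rewrite h0.
  have : l * M (t + sg) <= l * M (`|t| + 1) by rewrite ler_wpM2l// Mt1//; left.
  have : 0 <= l * M t by rewrite mulr_ge0.
  lra.
have l1 : 1 + l != 0 by rewrite gt_eqF// ltr_pwDl.
have : (1 + l) * M t <= M (t + sg * l) + l * M (t - sg).
  have p1 : 0 < 1 + l by rewrite ltr_pwDl.
  have l01 : 0 <= (1 + l)^-1 <= 1 by rewrite invr_ge0 ltW//= invf_le1// lerDl.
  have e1 : (1 + l)^-1 * (t + sg * l) + (1 - (1 + l)^-1) * (t - sg) = t.
    by field.
  have e2 : (1 + l) * ((1 + l)^-1 * M (t + sg * l) + (1 - (1 + l)^-1) * M (t - sg)) =
      M (t + sg * l) + l * M (t - sg) by field.
  by rewrite -e2 ler_pM2l// -{1}e1; exact: cM.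
have : l * M (t - sg) <= l * M (`|t| + 1) by rewrite ler_wpM2l// Mt1//; right.
have : 0 <= l * M t by rewrite mulr_ge0.
lra.
Qed.

Lemma even_convex_continuous M : even_convex M -> continuous M.
Proof.
move=> eM t; apply/cvgrPdist_le => e e0.
have K0 : 0 < M (`|t| + 1) + 1 by rewrite ltr_wpDl// even_convex_ge0.
near=> x.
have : `|t - x| <= Num.min 1 (e / (M (`|t| + 1) + 1)).
  near: x; apply: (@cvgr_dist_le _ _ _ _ _ id t) => //.
  by rewrite lt_min ltr01 divr_gt0.
rewrite le_min => /andP[x1 xe]; rewrite distrC in x1.
have := even_convex_dist eM t x1; rewrite subrKC distrC => /le_trans; apply.
apply: (@le_trans _ _ (`|x - t| * (M (`|t| + 1) + 1))); first by rewrite ler_wpM2l// lerDl.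
by rewrite -ler_pdivlMr// distrC.
Unshelve. all: by end_near. Qed.

(** Both directions of conjugation are recorded, which makes the relation symmetric. The suprema are
    approximated by rational slopes because a countable supremum admits a measurable near-maximiser,
    on which [modular_dual] rests. *)
Definition conjugate_pair M N : Prop := [/\ even_convex M, even_convex N,
  forall s t : R, s * t <= M s + N t,
  forall s e : R, 0 < e -> exists q : rat, M s - e < ratr q * s - N (ratr q) &
  forall t e : R, 0 < e -> exists q : rat, N t - e < ratr q * t - M (ratr q)].

Lemma conjugate_pairC M N : conjugate_pair M N -> conjugate_pair N M.
Proof. by move=> [? ? y ? ?]; split => // s t; rewrite mulrC addrC. Qed.

Lemma young_abs M N : conjugate_pair M N ->
  forall s t : R, `|s * t| <= M s + N t.
Proof.
move=> [eM eN y _ _] s t; rewrite normrM -(even_convex_abs eM) -(even_convex_abs eN).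
exact: y.
Qed.

Lemma young_scale M N : conjugate_pair M N ->
  forall s t a b : R, 0 < a -> 0 < b -> `|s * t| <= a * b * (M (s / a) + N (t / b)).
Proof.
move=> MN s t a b a0 b0; have := young_abs MN (s / a) (t / b).
have ab0 : 0 < (a * b)^-1 by rewrite invr_gt0 mulr_gt0.
by rewrite mulrACA -invfM normrM (gtr0_norm ab0) ler_pdivrMr ?mulr_gt0// [leRHS]mulrC.
Qed.

End even_convex.

(** * The conjugate of a Young function and its partial inverse *)

Section conj_young.
Context {R : realType}.
Variable M : R -> R.
Hypothesis yM : young_function M.

Lemma young_even_convex : even_convex M.
Proof.
move: yM => [[ME cM _] [_ _ _ [m _ Mm]]]; split => //.
  by rewrite Mm normr0 set_itv1 Rintegral_set1.
move=> a b l l01.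
have := @cM (Itv01 (andP l01).1 (andP l01).2) a b.
by rewrite !inE => /(_ I I).
Qed.
Let eM := young_even_convex.

Lemma young_superlinear (A : R) : exists2 B, 0 < B & forall t : R, B <= t -> A * t <= M t.
Proof.
move: yM => [_ [_ _ + _]] => /cvgryPge /(_ A) [B [_ BA]].
exists (Num.max 1 (B + 1)); first by rewrite lt_max ltr01.
move=> t; rewrite ge_max => /andP[t1 Bt].
have t0 : 0 < t by rewrite (lt_le_trans ltr01).
by rewrite -ler_pdivlMr// BA// (lt_le_trans _ Bt)// ltrDl.
Qed.

Let S (t : R) := [set x * `|t| - M x | x in [set x : R | 0 <= x]].

Let has_supS t : has_sup (S t).
Proof.
split; first by exists (0 * `|t| - M 0); exists 0 => /=.
have [B B0 BM] := young_superlinear `|t|.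
exists (B * `|t|) => _ [x x0 <-]; have [xB|Bx] := leP x B.
  by rewrite lerBlDr ler_wpDr ?even_convex_ge0// ler_wpM2r.
rewrite (@le_trans _ _ 0) ?mulr_ge0 ?(ltW B0)//.
by rewrite subr_le0 mulrC BM// ltW.
Qed.

Lemma conj_young_ub (t x : R) : 0 <= x -> x * `|t| - M x <= conj_young M t.
Proof. by move=> x0; apply: ub_le_sup => //; [case: (has_supS t)|exists x]. Qed.

Lemma conj_young_le (t K : R) :
  (forall x, 0 <= x -> x * `|t| - M x <= K) -> conj_young M t <= K.
Proof.
move=> H; apply: ge_sup; first by case: (has_supS t).
by move=> _ [x x0 <-]; exact: H.
Qed.

Lemma conj_young_even_convex : even_convex (conj_young M).
Proof.
have M0 : M 0 = 0 by case: eM.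
split => [|t|a b l /andP[l0 l1]].
- apply/eqP; rewrite eq_le; apply/andP; split.
    apply: conj_young_le => x x0.
    by rewrite normr0 mulr0 sub0r oppr_le0 even_convex_ge0.
  by have := conj_young_ub 0 (lexx 0); rewrite mul0r sub0r M0 oppr0.
- by rewrite /conj_young normrN.
- apply: conj_young_le => x x0.
  have := conj_young_ub a x0; have := conj_young_ub b x0.
  have : `|l * a + (1 - l) * b| <= l * `|a| + (1 - l) * `|b|.
    have l1' : 0 <= 1 - l by rewrite subr_ge0.
    by rewrite (le_trans (ler_normD _ _))// !normrM (ger0_norm l0) (ger0_norm l1').
  move: (conj_young M a) (conj_young M b) `|l * a + _| `|a| `|b| => Na Nb u v w uvw h1 h2.
  have : x * u <= x * (l * v + (1 - l) * w) by rewrite ler_wpM2l.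
  have : l * (x * v - M x) <= l * Na by rewrite ler_wpM2l.
  have : (1 - l) * (x * w - M x) <= (1 - l) * Nb by rewrite ler_wpM2l// subr_ge0.
  lra.
Qed.

(** The slope is the supremum of the difference quotients from the left, which convexity keeps below
    those from the right. It supplies the equality case of Young's inequality, hence the recovery of
    [M] from its conjugate. *)
Lemma young_subgradient (s : R) : 0 <= s -> exists2 p, 0 <= p &
  forall r : R, 0 <= r -> M s + p * (r - s) <= M r.
Proof.
rewrite le_eqVlt => /predU1P[<-|s0].
  exists 0 => // r r0; have [-> _ _] := eM.
  by rewrite mul0r addr0 even_convex_ge0.
have [M0 _ cM] := eM.
have slope t r : t < s -> s < r -> (M s - M t) / (s - t) <= (M r - M s) / (r - s).
  move=> ts sr; rewrite ler_pdivrMr ?subr_gt0// mulrAC ler_pdivlMr ?subr_gt0//.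
  have l01 : 0 <= (r - s) / (r - t) <= 1.
    by rewrite divr_ge0 ?ler_pdivrMr; lra.
  have := cM t r _ l01; rewrite (_ : _ * t + _ = s); last by field; lra.
  move=> H; have rt : 0 < r - t by lra.
  have : (r - t) * M s <= (r - t) * ((r - s) / (r - t) * M t + (1 - (r - s) / (r - t)) * M r).
    by rewrite ler_pM2l.
  rewrite (_ : (r - t) * (_ + _) = (r - s) * M t + (s - t) * M r); first lra.
  by field; lra.
pose P := [set (M s - M t) / (s - t) | t in [set t | 0 <= t < s]].
have P0 : P ((M s - M 0) / (s - 0)) by exists 0 => //=; rewrite lexx s0.
have ubP r : s < r -> ubound P ((M r - M s) / (r - s)).
  by move=> sr _ [t /andP[t0 ts] <-]; exact: slope.
have supP : has_sup P.
  by split; [exists ((M s - M 0) / (s - 0))|exists ((M (s + 1) - M s) / (s + 1 - s));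
    apply: ubP; rewrite ltrDl].
exists (sup P).
  apply: (@le_trans _ _ ((M s - M 0) / (s - 0))).
    by rewrite M0 !subr0 divr_ge0 ?(even_convex_ge0 eM)// ltW.
  by apply: ub_le_sup => //; case: supP.
move=> r r0; have [rs|sr|->] := ltgtP r s; last by rewrite subrr mulr0 addr0.
  have : (M s - M r) / (s - r) <= sup P.
    apply: ub_le_sup; first by case: supP.
    by exists r => //=; rewrite r0.
  by rewrite ler_pdivrMr ?subr_gt0//; lra.
have : sup P <= (M r - M s) / (r - s).
  by apply: ge_sup; [case: supP|exact: ubP].
by rewrite ler_pdivlMr ?subr_gt0//; lra.
Qed.

Lemma conj_young_pair : conjugate_pair M (conj_young M).
Proof.
have eN := conj_young_even_convex; split => //.
- move=> s t; rewrite -(even_convex_abs eM) -(even_convex_abs eN).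
  rewrite (le_trans (ler_norm _))// normrM -lerBlDl.
  by have := @conj_young_ub `|t| `|s| (normr_ge0 _); rewrite normr_id.
- move=> s e e0; wlog s0 : s / 0 <= s => [H|].
    have [/H//|s0] := leP 0 s.
    have /H[q] : 0 <= - s by rewrite oppr_ge0 ltW.
    have [_ ME _] := eM; have [_ NE _] := eN.
    by rewrite ME => Hq; exists (- q); rewrite rmorphN/= NE mulNr -mulrN.
  (* The subgradient gives [conj_young M p <= p * s - M s], so the slope [p] is optimal. A rational
     just below [p] is nearly so: the conjugate does not increase, and the linear term drops by at
     most [e / (s + 1) * s < e]. *)
  have [p p0 pM] := young_subgradient s0.
  have Np : conj_young M p <= p * s - M s.
    apply: conj_young_le => x x0; rewrite (ger0_norm p0).
    by have := pM _ x0; lra.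
  have [p00|pn0] := eqVneq p 0.
    exists 0; rewrite rmorph0 mul0r.
    have := pM 0 (lexx 0); have := even_convex_ge0 eN p.
    by have [-> _ _] := eN; have [-> _ _] := eM; rewrite p00; lra.
  have pp : 0 < p by rewrite lt0r pn0.
  have : Num.max 0 (p - e / (s + 1)) < p.
    by rewrite gt_max pp ltrBlDr ltrDl divr_gt0// ltr_wpDl.
  move=> /rat_in_itvoo[q]; rewrite in_itv/= gt_max => /andP[/andP[q0 qe] qp].
  exists q; have : conj_young M (ratr q) <= conj_young M p.
    by apply: even_convex_mono => //; rewrite !gtr0_norm// ltW.
  have : (p - ratr q) * s < e.
    apply: (@le_lt_trans _ _ (e / (s + 1) * s)).
      by rewrite ler_wpM2r//; lra.
    by rewrite mulrAC ltr_pdivrMr ?ltr_wpDl// ltr_pM2l// ltrDl.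
  lra.
- move=> t e e0; wlog t0 : t / 0 <= t => [H|].
    have [/H//|t0] := leP 0 t.
    have /H[q] : 0 <= - t by rewrite oppr_ge0 ltW.
    have [_ ME _] := eM; have [_ NE _] := eN.
    by rewrite NE => Hq; exists (- q); rewrite rmorphN/= ME mulNr -mulrN.
  have [_ [x x0 <-] xN] := sup_adherent e0 (has_supS t).
  have cf : continuous (fun y : R => y * t - M y).
    move: yM => [[_ _ cM] _] y; apply: cvgB; last exact: cM.
    by apply: cvgM => //; exact: cvg_cst.
  have oA : open [set y : R | conj_young M t - e < y * t - M y].
    by apply: (@open_comp _ _ (fun y : R => y * t - M y)
      [set z | conj_young M t - e < z] (fun y _ => cf y)); exact: open_gt.
  have A0 : [set y : R | conj_young M t - e < y * t - M y] !=set0.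
    by exists x => /=; rewrite -{2}(ger0_norm t0).
  have [q [/= qN [r _ rq]]] := @dense_rat R _ A0 oA.
  by exists r; rewrite rq.
Qed.

Lemma conj_young_invE (r : R) : (forall t, 0 <= t -> conj_young M t != r) ->
  conj_young_inv M r = 0.
Proof.
move=> H; rewrite /conj_young_inv /pinv_ splitV.
rewrite oinv_surj; case: pselect => // -[t t0 tr].
by have := H t t0; rewrite tr eqxx.
Qed.

(** Off the range of the conjugate the partial inverse takes its default value 0, where the
    conjugate vanishes, so the inequality holds there as well. *)
Lemma conj_young_invP (r : R) : 0 <= conj_young_inv M r /\
  (0 <= r -> conj_young M (conj_young_inv M r) <= r).
Proof.
have [[t [t0 tr]]|H] := pselect (exists t, 0 <= t /\ conj_young M t = r); last first.
  rewrite conj_young_invE => [|t t0]; last first.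
    by apply/eqP => tr; apply: H; exists t.
  by split => //; have [-> _ _] := conj_young_even_convex.
have rI : (conj_young M @` [set t | 0 <= t]) r by exists t.
have rE : conj_young M (conj_young_inv M r) = r by apply: pinvK; rewrite inE.
split; last by rewrite rE.
rewrite /conj_young_inv /pinv_ splitV.
rewrite oinv_surj; case: pselect => //= ?.
by case: cid2.
Qed.

(** Young's inequality with first argument 1. It turns the growth bound of the kernel into a finite
    constant on bounded arguments. *)
Lemma conj_young_inv_le (r : R) : 0 <= r -> conj_young_inv M r <= r + M 1.
Proof.
move=> r0; have [i0 /(_ r0) ir] := conj_young_invP r.
have [_ _ y _ _] := conj_young_pair.
have := y 1 (conj_young_inv M r); rewrite mul1r => /le_trans; apply.
by rewrite addrC lerD2r.
Qed.

End conj_young.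

(** * Modulars and test classes *)

Section integrable_real.
Context d (T : measurableType d) (R : realType) (mu : {measure set T -> \bar R}).
Implicit Types f g : T -> R.

Lemma integrable_EFinD f g : mu.-integrable setT (EFin \o f) ->
  mu.-integrable setT (EFin \o g) -> mu.-integrable setT (EFin \o (fun x => f x + g x)).
Proof. by move=> fi gi; apply: eq_integrable (integrableD measurableT fi gi) => //. Qed.

Lemma integrable_EFinB f g : mu.-integrable setT (EFin \o f) ->
  mu.-integrable setT (EFin \o g) -> mu.-integrable setT (EFin \o (fun x => f x - g x)).
Proof. by move=> fi gi; apply: eq_integrable (integrableB measurableT fi gi) => //. Qed.

Lemma integrable_EFinZ (k : R) f : mu.-integrable setT (EFin \o f) ->
  mu.-integrable setT (EFin \o (fun x => k * f x)).
Proof. by move=> fi; apply: eq_integrable (integrableZl measurableT k fi) => //. Qed.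

Lemma le_integrable_EFin f g : measurable_fun setT f -> (forall x, `|f x| <= g x) ->
  mu.-integrable setT (EFin \o g) -> mu.-integrable setT (EFin \o f).
Proof.
move=> mf fg; apply: le_integrable => //; first exact/measurable_EFinP.
by move=> x _ /=; rewrite lee_fin (le_trans (fg x))// ler_norm.
Qed.

Lemma measurable_integrable f : mu.-integrable setT (EFin \o f) -> measurable_fun setT f.
Proof. by move=> /measurable_int/measurable_EFinP. Qed.

Lemma RintegralN f : mu.-integrable setT (EFin \o f) ->
  \int[mu]_x (- f x) = - \int[mu]_x f x.
Proof.
move=> fi; rewrite -[RHS]mulN1r -RintegralZl//.
by apply: eq_Rintegral => x _; rewrite mulN1r.
Qed.

Lemma Rintegral_EFin f : mu.-integrable setT (EFin \o f) ->
  (\int[mu]_x f x)%:E = (\int[mu]_x (f x)%:E)%E.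
Proof. by move=> fi; rewrite /Rintegral fineK//; exact: integrable_fin_num. Qed.

Lemma integrable_ge0 f : measurable_fun setT f -> (forall x, 0 <= f x) ->
  (\int[mu]_x (f x)%:E < +oo)%E -> mu.-integrable setT (EFin \o f).
Proof.
move=> mf f0 foo; apply/integrableP; split; first exact/measurable_EFinP.
by under eq_integral do rewrite gee0_abs ?lee_fin//.
Qed.

End integrable_real.

Section modular.
Context d (T : measurableType d) (R : realType) (mu : {measure set T -> \bar R}).
Implicit Types (M N : R -> R) (u v w : T -> R).

Lemma even_convex_comp M u : even_convex M -> measurable_fun setT u ->
  measurable_fun setT (fun x => M (u x)).
Proof. by move=> /even_convex_measurable mM mu'; exact: (measurableT_comp mM). Qed.

Lemma modular_ge0 M u : even_convex M -> (0 <= modular mu M u)%E.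
Proof. by move=> eM; apply: integral_ge0 => x _; rewrite lee_fin even_convex_ge0. Qed.

Lemma modular_integrable M u : even_convex M -> measurable_fun setT u ->
  (modular mu M u < +oo)%E -> mu.-integrable setT (EFin \o (fun x => M (u x))).
Proof.
move=> eM mu' uoo; apply: integrable_ge0 => //; first exact: even_convex_comp.
by move=> x; exact: even_convex_ge0.
Qed.

Lemma modularE M u : even_convex M -> (modular mu M u < +oo)%E ->
  modular mu M u = (\int[mu]_x M (u x))%:E.
Proof. by move=> eM uoo; rewrite /Rintegral fineK// ge0_fin_numE// modular_ge0. Qed.

Lemma le_modular M u v : even_convex M -> measurable_fun setT u ->
  measurable_fun setT v -> (forall x, `|u x| <= `|v x|) ->
  (modular mu M u <= modular mu M v)%E.
Proof.
move=> eM mu' mv uv; apply: ge0_le_integral => //.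
- by move=> x _; rewrite lee_fin even_convex_ge0.
- exact/measurable_EFinP/even_convex_comp.
- exact/measurable_EFinP/even_convex_comp.
- by move=> x _; rewrite lee_fin even_convex_mono.
Qed.

Lemma modularD M u v : even_convex M -> measurable_fun setT u ->
  measurable_fun setT v ->
  (modular mu M (fun x => u x + v x)%R <=
    2^-1%:E * modular mu M (fun x => 2 * u x)%R + 2^-1%:E * modular mu M (fun x => 2 * v x)%R)%E.
Proof.
move=> eM mu' mv.
have m2u : measurable_fun setT (fun x => 2 * u x) by exact: measurable_funM.
have m2v : measurable_fun setT (fun x => 2 * v x) by exact: measurable_funM.
have mMu := even_convex_comp eM m2u; have mMv := even_convex_comp eM m2v.
have h2 : (0 <= 2^-1 :> R) by rewrite invr_ge0.
rewrite /modular -!ge0_integralZl_EFin//; try by [exact/measurable_EFinP|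
  move=> x _; rewrite lee_fin even_convex_ge0].
rewrite -ge0_integralD//; try by [apply/measurable_EFinP; exact: measurable_funM|
  move=> x _; rewrite lee_fin mulr_ge0// even_convex_ge0].
apply: ge0_le_integral => //.
- by move=> x _; rewrite lee_fin even_convex_ge0.
- by apply/measurable_EFinP/even_convex_comp => //; exact: measurable_funD.
- by apply/measurable_EFinP; apply: measurable_funD; exact: measurable_funM.
- by move=> x _; rewrite -!EFinM -EFinD lee_fin even_convex_midpoint.
Qed.

Lemma modularD_lty M u v : even_convex M -> measurable_fun setT u ->
  measurable_fun setT v -> (modular mu M (fun x => (2 * u x)%R) < +oo)%E ->
  (modular mu M (fun x => (2 * v x)%R) < +oo)%E ->
  (modular mu M (fun x => (u x + v x)%R) < +oo)%E.
Proof.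
move=> eM mu' mv uoo voo; apply: (le_lt_trans (modularD eM mu' mv)).
by rewrite lte_add_pinfty// lte_mul_pinfty// lee_fin.
Qed.

(** Young's inequality integrated at the scales [a] and [b]. The bound stays linear in the modular
    bounds [al] and [be], which is the form that the duality argument for the fluxes requires. *)
Lemma orlicz_holder M N u v a b al be : conjugate_pair M N ->
  measurable_fun setT u -> measurable_fun setT v -> 0 < a -> 0 < b ->
  (modular mu M (fun x => u x / a)%R <= al%:E)%E ->
  (modular mu N (fun x => v x / b)%R <= be%:E)%E ->
  mu.-integrable setT (EFin \o (fun x => u x * v x)) /\
  \int[mu]_x `|u x * v x| <= a * b * (al + be).
Proof.
move=> MN mu' mv a0 b0 ual vbe; have [eM eN _ _ _] := MN.
have mua : measurable_fun setT (fun x => u x / a) by exact: measurable_funM.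
have mvb : measurable_fun setT (fun x => v x / b) by exact: measurable_funM.
have uoo := le_lt_trans ual (ltry _); have voo := le_lt_trans vbe (ltry _).
have ui := modular_integrable eM mua uoo; have vi := modular_integrable eN mvb voo.
have gi := integrable_EFinZ (a * b) (integrable_EFinD ui vi).
have uvi : mu.-integrable setT (EFin \o (fun x => u x * v x)).
  apply: (le_integrable_EFin _ _ gi); first exact: measurable_funM.
  by move=> x; exact: young_scale.
split => //; apply: (@le_trans _ _ (\int[mu]_x (a * b * (M (u x / a) + N (v x / b))))).
  apply: le_Rintegral => //; first exact: integrable_norm.
  by move=> x _; exact: young_scale.
rewrite RintegralZl//; last exact: integrable_EFinD.
rewrite RintegralD// ler_pM2l ?mulr_gt0// lerD// -lee_fin -modularE//.
Qed.

Lemma orlicz_integrable M N u v a b : conjugate_pair M N ->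
  measurable_fun setT u -> measurable_fun setT v -> 0 < a -> 0 < b ->
  (modular mu M (fun x => u x / a)%R < +oo)%E ->
  (modular mu N (fun x => v x / b)%R < +oo)%E ->
  mu.-integrable setT (EFin \o (fun x => u x * v x)).
Proof.
move=> MN mu' mv a0 b0 uoo voo; have [eM eN _ _ _] := MN.
apply: (proj1 (orlicz_holder MN mu' mv a0 b0 _ _)).
  by rewrite modularE.
by rewrite modularE.
Qed.

End modular.

Section selection.
Context {R : realType}.
Variables (M N : R -> R).
Hypothesis MN : conjugate_pair M N.

Definition rat_enum (j : nat) : R := ratr (odflt 0 (unpickle j : option rat)).

(* The best of the first [J] rationals in the supremum [M t = sup_q (q t - N q)]. *)
Fixpoint sel (J : nat) (t : R) : R :=
  if J is j.+1 then
    if sel j t * t - N (sel j t) < rat_enum j * t - N (rat_enum j)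
    then rat_enum j else sel j t
  else 0.

Definition selval J t := sel J t * t - N (sel J t).

Lemma selvalS J t : selval J.+1 t = Num.max (selval J t) (rat_enum J * t - N (rat_enum J)).
Proof. by rewrite /selval /=; case: ifPn => [/ltW/max_r //|]; rewrite -leNgt => /max_l. Qed.

Lemma selval_nd t : nondecreasing_seq (selval ^~ t).
Proof. by apply/nondecreasing_seqP => J; rewrite selvalS le_max lexx. Qed.

Lemma selval_ge0 J t : 0 <= selval J t.
Proof.
apply: (le_trans _ (selval_nd t (leq0n J))).
by rewrite /selval/= mul0r sub0r; case: MN => _ [-> _ _] _ _ _; rewrite oppr0.
Qed.

Lemma selval_le J t : selval J t <= M t.
Proof. by rewrite lerBlDr mulrC; case: MN. Qed.

Lemma selval_cvg t : selval J t @[J --> \oo] --> M t.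
Proof.
apply/cvgrPdist_le => e e0; have [_ _ _ dM _] := MN.
have [q qe] := dM t _ e0; exists (pickle q).+1 => //= J /= qJ.
rewrite ger0_norm ?subr_ge0 ?selval_le// lerBlDr -lerBlDl.
apply: (le_trans (ltW qe)); apply: (le_trans _ (selval_nd t qJ)).
by rewrite selvalS le_max /rat_enum pickleK/= lexx orbT.
Qed.

Lemma sel_bounded J : exists2 B, 0 <= B & forall t, `|sel J t| <= B.
Proof.
elim: J => [|J [B B0 BJ]]; first by exists 0 => // t; rewrite normr0.
exists (Num.max B `|rat_enum J|); first by rewrite le_max B0.
by move=> t /=; case: ifP; rewrite le_max ?lexx ?orbT// BJ.
Qed.

Lemma measurable_sel J : measurable_fun setT (sel J).
Proof.
elim: J => [|J mJ] //=; apply: measurable_fun_ifT => //.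
apply: measurable_fun_ltr.
  apply: measurable_funB; first exact: measurable_funM.
  by apply: even_convex_comp => //; case: MN.
by apply: measurable_funB => //; exact: measurable_funM.
Qed.

End selection.

Section measurable_sets.
Context d (T : measurableType d) (R : realType).
Implicit Types f g : T -> R.

Lemma measurable_set_ler f g : measurable_fun setT f -> measurable_fun setT g ->
  measurable [set x | f x <= g x].
Proof.
move=> mf mg; rewrite -[X in measurable X]setTI.
exact: (measurable_fun_ler mf mg measurableT (Y := [set true])).
Qed.

Lemma measurable_set_ltr f g : measurable_fun setT f -> measurable_fun setT g ->
  measurable [set x | f x < g x].
Proof.
move=> mf mg; rewrite -[X in measurable X]setTI.
exact: (measurable_fun_ltr mf mg measurableT (Y := [set true])).
Qed.

End measurable_sets.

Section fatou_bound.
Context d (T : measurableType d) (R : realType) (mu : {measure set T -> \bar R}).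

Lemma fatou_bound (f_ : nat -> T -> R) (f : T -> R) (C : \bar R) :
  (forall n, measurable_fun setT (f_ n)) -> (forall n x, 0 <= f_ n x) ->
  (forall x, f_ n x @[n --> \oo] --> f x) ->
  (forall n, \int[mu]_x (f_ n x)%:E <= C)%E -> (\int[mu]_x (f x)%:E <= C)%E.
Proof.
move=> mf f0 ff fC.
rewrite (eq_integral (fun x => limn_einf (fun n => (f_ n x)%:E))); last first.
  move=> x _; have : (f_ n x)%:E @[n --> \oo] --> (f x)%:E.
    by apply: cvg_EFin; [exact: nearW|exact: ff].
  by move=> /cvg_limn_einf_sup[->].
apply: (@le_trans _ _ (limn_einf (fun n => \int[mu]_x (f_ n x)%:E)%E)).
  apply: (fatou mu measurableT) => [n|n x _]; last by rewrite lee_fin.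
  exact/measurable_EFinP.
rewrite limn_einf_lim; apply: lime_le; first exact: is_cvg_einfs.
apply: nearW => n; apply: (le_trans _ (fC n)).
by apply: ereal_inf_lbound; exists n => /=.
Qed.

Lemma Rintegral_dominated_cvg (f_ : nat -> T -> R) (f Z : T -> R) :
  (forall n, measurable_fun setT (f_ n)) -> (forall x, f_ n x @[n --> \oo] --> f x) ->
  mu.-integrable setT (EFin \o Z) -> (forall n x, `|f_ n x| <= Z x) ->
  mu.-integrable setT (EFin \o f) /\
  (\int[mu]_x f_ n x) @[n --> \oo] --> \int[mu]_x f x.
Proof.
move=> mf_ ff iZ fZ.
have mf : measurable_fun setT f.
  by apply: (measurable_fun_cvg (h := f_)) => // x _; exact: ff.
have fi : mu.-integrable setT (EFin \o f).
  apply: (le_integrable_EFin mf _ iZ) => x.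
  have cn : `|f_ n x| @[n --> \oo] --> `|f x| by apply: cvg_norm; exact: ff.
  rewrite -(cvg_lim _ cn)//; apply: limr_le; first by apply/cvg_ex; exists `|f x|.
  exact: nearW.
split => //.
have /fine_cvgP[_] : (\int[mu]_x (f_ n x)%:E)%E @[n --> \oo] --> (\int[mu]_x f x)%:E.
  rewrite Rintegral_EFin//.
  apply: (@dominated_cvg _ _ _ mu _ measurableT _ _ (EFin \o Z)) => //.
  - by move=> j; exact/measurable_EFinP.
  - by move=> x _; apply: cvg_EFin; [exact: nearW|exact: ff].
  - by move=> j x _; rewrite /= lee_fin fZ.
by [].
Qed.

End fatou_bound.

Section orlicz_class.
Context d (T : measurableType d) (R : realType) (mu : {measure set T -> \bar R}).
Implicit Types (M N : R -> R) (u v w : T -> R).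

Lemma orliczE_scale M u : even_convex M -> orliczE mu M u ->
  forall r : R, (modular mu M (fun x => r * u x)%R < +oo)%E.
Proof.
move=> eM [_ uE] r; have [->|r0] := eqVneq r 0.
  rewrite /modular (eq_integral (fun=> 0%E)) ?integral0// => x _.
  by rewrite mul0r; have [-> _ _] := eM.
have := uE `|r|^-1; rewrite invr_gt0 normr_gt0 => /(_ r0).
rewrite /modular (eq_integral (fun x => (M (r * u x)%R)%:E))// => x _.
rewrite invrK -(even_convex_abs eM (u x * _)) -(even_convex_abs eM (r * u x)).
by rewrite !normrM normr_id mulrC.
Qed.

Lemma scale_orliczE M u : measurable_fun setT u ->
  (forall r : R, (modular mu M (fun x => r * u x)%R < +oo)%E) -> orliczE mu M u.
Proof.
move=> mu' H; split; first by exists u => //; exact: aeW.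
move=> k k0; have := H k^-1; rewrite /modular; congr (_ < _)%E.
by apply: eq_integral => x _; rewrite mulrC.
Qed.

Lemma orliczL_bound M u : even_convex M -> orliczL mu M u ->
  exists k : R, 0 < k /\ exists C : R, (modular mu M (fun x => u x / k)%R <= C%:E)%E.
Proof.
move=> eM [_ [k k0 uk]]; exists k; split => //.
exists (\int[mu]_x M (u x / k)); by rewrite modularE.
Qed.

End orlicz_class.

(** * Truncations and duality for modulars *)

Section test_class.
Context d (T : measurableType d) (R : realType) (mu : {measure set T -> \bar R}).
Variable theta : T -> R.
Implicit Types (M N : R -> R) (u v w : T -> R).

(** Since [theta] is integrable, the set where it is at least [1 / (j + 1)] has finite measure, so
    these functions lie in E_M for every even convex [M]. A single index bounds both the size and
    the level of [theta]. *)
Definition small_support w : Prop := measurable_fun setT w /\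
  exists j : nat, forall x, `|w x| <= j%:R /\ (theta x < j.+1%:R^-1 -> w x = 0).

Definition core (u : T -> R) (j : nat) : set T :=
  [set x | `|u x| <= j%:R /\ j.+1%:R^-1 <= theta x].

Definition trunc (u : T -> R) (j : nat) (x : T) : R := u x * \1_(core u j) x.

Hypothesis mtheta : measurable_fun setT theta.
Hypothesis theta01 : forall x, 0 < theta x <= 1.
Hypothesis itheta : mu.-integrable setT (EFin \o theta).

Lemma measurable_core u j : measurable_fun setT u -> measurable (core u j).
Proof.
move=> mu'; apply: measurableI; apply: measurable_set_ler => //.
exact: measurableT_comp.
Qed.

Lemma core_nd u : nondecreasing_seq (core u).
Proof.
move=> i j ij; apply/subsetPset => x [ui ti]; split.
  by rewrite (le_trans ui)// ler_nat.
by rewrite (le_trans _ ti)// lef_pV2 ?posrE// ler_nat.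
Qed.

Lemma near_core u x : \forall j \near \oo, core u j x.
Proof.
have /andP[t0 _] := theta01 x.
near=> j; split; first by near: j; exact: nbhs_infty_ger.
rewrite invf_ple ?posrE// (@le_trans _ _ j%:R) ?ler_nat//.
by near: j; exact: nbhs_infty_ger.
Unshelve. all: by end_near. Qed.

Lemma indic_core_cvg u x : \1_(core u j) x @[j --> \oo] --> (1 : R).
Proof.
apply/cvgrPdist_le => e e0; near=> j; rewrite indicE mem_set ?subrr ?normr0 ?ltW//.
by near: j; exact: near_core.
Unshelve. all: by end_near. Qed.

Lemma measurable_trunc u j : measurable_fun setT u -> measurable_fun setT (trunc u j).
Proof.
move=> mu'; apply: measurable_funM => //.
by apply: measurable_indic; exact: measurable_core.
Qed.

Lemma trunc_le u j x : `|trunc u j x| <= `|u x|.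
Proof.
by rewrite /trunc indicE normrM; case: (_ \in _); rewrite ?normr1 ?mulr1// normr0 mulr0.
Qed.

Lemma trunc_cvg u x : trunc u j x @[j --> \oo] --> u x.
Proof.
rewrite -[X in _ --> X]mulr1; apply: cvgM; first exact: cvg_cst.
exact: indic_core_cvg.
Qed.

Lemma small_support_trunc u j : measurable_fun setT u -> small_support (trunc u j).
Proof.
move=> mu'; split; first exact: measurable_trunc.
exists j => x; rewrite /trunc indicE; case: (boolP (_ \in _)) => [|_].
  rewrite inE => -[uj tj]; rewrite mulr1; split => // tx.
  by move: tj; rewrite leNgt tx.
by rewrite mulr0 normr0.
Qed.

Lemma small_support_le w v (B : R) : small_support w -> measurable_fun setT v ->
  (forall x, `|v x| <= B * `|w x|) -> small_support v.
Proof.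
move=> [mw [j wj]] mv vw; split => //.
have B0 : 0 <= Num.max B 0 by rewrite le_max lexx orbT.
pose k := Num.bound (Num.max B 0 * j%:R).
have kP : Num.max B 0 * j%:R < k%:R.
  by rewrite /k; have := archi_boundP (mulr_ge0 B0 (ler0n R j)).
exists (maxn j k) => x; have [wx1 wx2] := wj x; split.
  rewrite (le_trans (vw x))// (@le_trans _ _ (Num.max B 0 * j%:R))//.
    rewrite (@le_trans _ _ (Num.max B 0 * `|w x|))//; last exact: ler_wpM2l.
    by rewrite ler_wpM2r// le_max lexx.
  by rewrite (le_trans (ltW kP))// ler_nat leq_maxr.
move=> tx; apply/eqP; rewrite -normr_le0 (le_trans (vw x))// wx2 ?normr0 ?mulr0//.
by rewrite (lt_le_trans tx)// lef_pV2 ?posrE// ler_nat ltnS leq_maxl.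
Qed.

Lemma small_supportD u v : small_support u -> small_support v ->
  small_support (fun x => u x + v x).
Proof.
move=> [mu' [j uj]] [mv [k vk]]; split; first exact: measurable_funD.
exists (j + k)%N => x; have [u1 u2] := uj x; have [v1 v2] := vk x; split.
  by rewrite natrD (le_trans (ler_normD _ _))// lerD.
move=> tx; rewrite u2 ?v2 ?addr0// (lt_le_trans tx)// lef_pV2 ?posrE// ler_nat ltnS;
  by rewrite ?leq_addl ?leq_addr.
Qed.

Lemma small_supportZ (r : R) u : small_support u -> small_support (fun x => r * u x).
Proof.
move=> uS; apply: (small_support_le (B := `|r|) uS).
  by apply: measurable_funM => //; case: uS.
by move=> x; rewrite normrM.
Qed.

Lemma small_support_integrable w : small_support w -> mu.-integrable setT (EFin \o w).
Proof.
move=> [mw [j wj]].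
(* On the support [theta >= 1 / (j + 1)], so the bound [j] is at most [j * (j + 1) * theta]. *)
apply: (le_integrable_EFin mw _ (integrable_EFinZ (j%:R * j.+1%:R) itheta)) => x.
have [w1 w2] := wj x; have /andP[t0 _] := theta01 x.
have [tx|tx] := ltP (theta x) j.+1%:R^-1; first by rewrite w2// normr0 !mulr_ge0// ltW.
rewrite (le_trans w1)// -mulrA ler_peMr//.
by rewrite -ler_pdivrMl// mulr1.
Qed.

Lemma small_support_comp M w : even_convex M -> small_support w ->
  small_support (fun x => M (w x)).
Proof.
move=> eM [mw [j wj]]; split; first exact: even_convex_comp.
have [M0 _ _] := eM; pose k := Num.bound (M j%:R).
exists (maxn j k) => x; have [w1 w2] := wj x; split.
  rewrite ger0_norm ?even_convex_ge0// (@le_trans _ _ (M j%:R))//.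
    by apply: even_convex_mono => //; rewrite [leRHS]ger0_norm.
  have /ltW := archi_boundP (even_convex_ge0 eM j%:R).
  by move=> /le_trans; apply; rewrite ler_nat leq_maxr.
by move=> tx; rewrite w2// (lt_le_trans tx)// lef_pV2 ?posrE// ler_nat ltnS leq_maxl.
Qed.

Lemma small_support_modular M w : even_convex M -> small_support w ->
  (modular mu M w < +oo)%E.
Proof.
move=> eM wS; apply: integrable_lty => //.
exact: (small_support_integrable (small_support_comp eM wS)).
Qed.

Lemma small_support_orliczE M w : even_convex M -> small_support w -> orliczE mu M w.
Proof.
move=> eM wS; apply: scale_orliczE; first by case: wS.
by move=> r; apply: small_support_modular => //; exact: small_supportZ.
Qed.

(** The converse of Young's inequality. Testing with the near-maximiser [sel] of [q * U - N q], cut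
    to a core, makes [U * w - N w] equal to [selval] there, which increases to [M U]; Fatou's lemma
    passes the bound to the limit. All modular bounds deduced from integral bounds come from
    here. *)
Lemma modular_dual M N (U : T -> R) (C : R) : conjugate_pair M N ->
  measurable_fun setT U ->
  (forall w, small_support w ->
    \int[mu]_x (U x * w x) <= C + \int[mu]_x N (w x)) ->
  (modular mu M U <= C%:E)%E.
Proof.
move=> MN mU H; have [eM eN _ _ _] := MN.
have ms j := measurableT_comp (measurable_sel MN j) mU.
pose g j x := selval N j (U x) * \1_(core U j) x.
apply: (@fatou_bound _ _ _ _ g).
- move=> j; apply: measurable_funM; last by apply: measurable_indic; exact: measurable_core.
  apply: measurable_funB; first exact: (measurable_funM (ms j) mU).
  exact: (even_convex_comp eN (ms j)).
- by move=> j x; rewrite mulr_ge0// (selval_ge0 MN).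
- move=> x; rewrite -[M _]mulr1; apply: cvgM; last exact: indic_core_cvg.
  exact: selval_cvg.
move=> j; pose w x := sel N j (U x) * \1_(core U j) x.
have [B B0 Bj] := sel_bounded N j.
have mw : measurable_fun setT w.
  by apply: (measurable_funM (ms j)); apply: measurable_indic; exact: measurable_core.
have wS : small_support w.
  split => //; exists (maxn j (Num.bound B)) => x; rewrite /w indicE.
  case: (boolP (_ \in _)) => [|_]; last by rewrite mulr0 normr0.
  rewrite inE mulr1 => -[_ tj]; split.
    rewrite (le_trans (Bj _))// (le_trans (ltW (archi_boundP B0)))//.
    by rewrite ler_nat leq_maxr.
  move=> tx; move: tj; rewrite leNgt => /negP[]; apply: (lt_le_trans tx).
  by rewrite lef_pV2 ?posrE// ler_nat ltnS leq_maxl.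
have UwS : small_support (fun x => U x * w x).
  apply: (small_support_le (B := j%:R) wS); first exact: measurable_funM.
  move=> x; rewrite /w indicE; case: (boolP (_ \in _)) => [|_]; last first.
    by rewrite !mulr0 normr0 mulr0.
  by rewrite inE mulr1 normrM => -[uj _]; rewrite ler_wpM2r.
have Uwi := small_support_integrable UwS.
have Nwi := small_support_integrable (small_support_comp eN wS).
have -> : (\int[mu]_x (g j x)%:E = (\int[mu]_x (U x * w x - N (w x))%R)%:E)%E.
  rewrite Rintegral_EFin; last exact: integrable_EFinB.
  apply: eq_integral => x _; congr EFin; rewrite /g /w /selval indicE.
  case: (_ \in _); rewrite ?mulr1 ?mulr0 1?mulrC//.
  by have [-> _ _] := eN; rewrite subrr.
by rewrite lee_fin RintegralB// lerBlDr H.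
Qed.

(** By dominated convergence the modular of [w_ n / b] tends to 0, and [b] is chosen so that the
    bound [k * b * (C + 1)] of [orlicz_holder] is [e]. The estimate is uniform over all [A] in a
    modular ball, which lets it pass to weak limits. *)
Lemma holder_tail M N (k C e : R) (w_ : nat -> T -> R) (W : T -> R) : conjugate_pair M N ->
  0 < k -> 0 <= C -> 0 < e ->
  (forall n, measurable_fun setT (w_ n)) -> measurable_fun setT W -> orliczE mu M W ->
  (forall n x, `|w_ n x| <= `|W x|) -> (forall x, w_ n x @[n --> \oo] --> 0) ->
  \forall n \near \oo, forall A : T -> R, measurable_fun setT A ->
    (modular mu N (fun x => A x / k)%R <= C%:E)%E ->
    \int[mu]_x `|A x * w_ n x| <= e.
Proof.
move=> MN k0 C0 e0 mw mW WE wW w0; have [eM eN _ _ _] := MN.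
pose b := e / (k * (C + 1)).
have b0 : 0 < b by rewrite divr_gt0// mulr_gt0// ltr_wpDl.
have mMw n : measurable_fun setT (fun x => M (w_ n x / b)).
  by apply: even_convex_comp => //; exact: measurable_funM.
have cv0 : (\int[mu]_x (M (w_ n x / b))%:E)%E @[n --> \oo] --> 0%:E.
  rewrite -[X in _ --> X](integral0 mu setT).
  apply: (@dominated_cvg _ _ _ mu _ measurableT _ _ (fun x => (M (W x / b))%:E)) => //.
  - by move=> n; exact/measurable_EFinP.
  - move=> x _; apply: cvg_EFin; first exact: nearW.
    have [<- _ _] := eM; apply: continuous_cvg; first exact: even_convex_continuous.
    by rewrite -[X in _ --> X](mul0r b^-1); apply: cvgM; [exact: w0|exact: cvg_cst].
  - apply: modular_integrable => //; first exact: measurable_funM.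
    by case: WE => _; exact.
  - move=> n x _; rewrite /= lee_fin ger0_norm ?even_convex_ge0//.
    by apply: even_convex_mono => //; rewrite !normrM ler_wpM2r.
have /fine_cvgP[_ /cvgr0Pnorm_le /(_ _ ltr01) cv] := cv0.
near=> n => A mA AC.
have wfin : (modular mu M (fun x => w_ n x / b)%R < +oo)%E.
  case: WE => _ /(_ _ b0); apply: le_lt_trans.
  apply: le_modular => //; [exact: measurable_funM|exact: measurable_funM|].
  by move=> x; rewrite !normrM ler_wpM2r.
have w1 : (modular mu M (fun x => w_ n x / b)%R <= 1%:E)%E.
  rewrite modularE// lee_fin (le_trans (ler_norm _))//.
  by near: n; exact: cv.
have [_] := orlicz_holder (conjugate_pairC MN) mA (mw n) k0 b0 AC w1.
move=> /le_trans; apply; rewrite /b le_eqVlt; apply/orP; left; apply/eqP.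
by field; rewrite !gt_eqF// ltr_wpDl.
Unshelve. all: by end_near. Qed.

End test_class.

(** * Weakly bounded sequences have bounded modulars *)

Section ball_series.
Context d (T : measurableType d) (R : realType) (mu : {measure set T -> \bar R}).
Variables (M N : R -> R).
Hypothesis MN : conjugate_pair M N.
Let eM : even_convex M. Proof. by case: MN. Qed.
Let eN : even_convex N. Proof. by case: MN. Qed.

(** The normalised block is [v j / 2] plus a remainder, and twice this remainder is dominated by the
    normalised next block because [2 * c j.+1 <= c j]. Midpoint convexity then gives
    [1 / 2 + 1 / 2]. *)
Lemma block_modular (c : nat -> R) (v : nat -> T -> R) :
  (forall j, measurable_fun setT (v j)) ->
  (forall j, modular mu N (v j) <= 1%:E)%E ->
  (forall j, 0 < c j) -> (forall j, c j.+1 <= c j / 4) ->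
  forall m j, (modular mu N (fun x => (\sum_(l < m) c (j + l)%N * v (j + l)%N x) / (2 * c j))%R
    <= 1%:E)%E.
Proof.
move=> mv vN c0 cS; have mS m j : measurable_fun setT (fun x => \sum_(l < m) c (j + l)%N * v (j + l)%N x).
  by apply: measurable_sum => l; exact: measurable_funM.
elim=> [|m IH] j.
  under eq_fun do rewrite big_ord0 mul0r.
  rewrite /modular (eq_integral (fun=> 0%E)) ?integral0 ?lee_fin// => x _.
  by have [-> _ _] := eN.
have e1 x : (\sum_(l < m.+1) c (j + l)%N * v (j + l)%N x) / (2 * c j) =
    v j x / 2 + (\sum_(l < m) c (j.+1 + l)%N * v (j.+1 + l)%N x) / (2 * c j).
  rewrite big_ord_recl/= addn0 mulrDl; congr (_ + _).
    by field; rewrite gt_eqF.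
  by congr (_ / _); apply: eq_bigr => l _; rewrite /bump/= add1n addSnnS.
under eq_fun do rewrite e1.
have m1 : measurable_fun setT (fun x => v j x / 2) by exact: measurable_funM.
have m2 : measurable_fun setT
    (fun x => (\sum_(l < m) c (j.+1 + l)%N * v (j.+1 + l)%N x) / (2 * c j)).
  exact: measurable_funM.
apply: (le_trans (modularD mu eN m1 m2)).
have -> : 1%:E = (2^-1%:E * 1%:E + 2^-1%:E * 1%:E)%E :> \bar R.
  by rewrite -!EFinM -EFinD; congr EFin; field.
have h0 : (0 <= 2^-1%:E :> \bar R)%E by rewrite lee_fin.
apply: leeD; apply: lee_wpmul2l => //.
  by under eq_fun do rewrite mulrC divfK//.
apply: (le_trans _ (IH j.+1)); apply: le_modular => //.
- by apply: measurable_funM => //; exact: measurable_funM.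
- exact: measurable_funM.
- move=> x; rewrite mulrCA !normrM ler_wpM2l//.
  rewrite !gtr0_norm ?invr_gt0 ?mulr_gt0//.
  rewrite invfM mulrA divff// mul1r lef_pV2 ?posrE ?mulr_gt0//.
  have := cS j; rewrite ler_pdivlMr//; apply: le_trans.
  by rewrite mulrC ler_wpM2l ?(ltW (c0 _))// ; lra.
Qed.

Lemma half_series_le n : \sum_(l < n) (2^-1 ^+ l.+1 : R) <= 1.
Proof.
suff -> : \sum_(l < n) (2^-1 ^+ l.+1 : R) = 1 - 2^-1 ^+ n.
  by rewrite lerBlDr lerDl exprn_ge0// invr_ge0.
elim: n => [|n IH]; first by rewrite big_ord0 expr0 subrr.
by rewrite big_ord_recr/= IH exprS; field.
Qed.

(** The series of [2^-(l+1) * N (v l)] has integral at most 1, and [D] is the conull set where it is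
    finite. There [|v l| <= N (v l) + M 1] gives absolute convergence, and the indicator of [D]
    makes the sum converge everywhere. The tails inherit the bound on finite blocks by Fatou's
    lemma. *)
Lemma ball_series (c : nat -> R) (v : nat -> T -> R) :
  (forall j, measurable_fun setT (v j)) ->
  (forall j, modular mu N (v j) <= 1%:E)%E ->
  (forall j, 0 < c j) -> (forall j, c j.+1 <= c j / 4) -> c 0%N <= 1 ->
  exists D : set T, exists G : T -> R, [/\ measurable D, mu (~` D) = 0,
    measurable_fun setT G,
    forall x, (\sum_(l < n) c l * (v l x * \1_D x)) @[n --> \oo] --> G x &
    forall j, (modular mu N (fun x => (G x - \sum_(l < j) c l * (v l x * \1_D x)) / (2 * c j))%R
      <= 1%:E)%E].
Proof.
move=> mv vN c0 cS c1.
have Nv0 l x : 0 <= 2^-1 ^+ l.+1 * N (v l x).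
  by rewrite mulr_ge0 ?exprn_ge0 ?invr_ge0 ?(even_convex_ge0 eN).
have mNv l : measurable_fun setT (fun x => 2^-1 ^+ l.+1 * N (v l x)).
  by apply: measurable_funM => //; exact: even_convex_comp.
pose f x := (\sum_(l <oo) (2^-1 ^+ l.+1 * N (v l x))%:E)%E.
have f0 x : (0 <= f x)%E by apply: nneseries_ge0 => l _ _; rewrite lee_fin.
have mf : measurable_fun setT f.
  by apply: ge0_emeasurable_sum => l; [move=> x _ _; rewrite lee_fin|move=> _; exact/measurable_EFinP].
have if1 : (\int[mu]_x f x <= 1)%E.
  rewrite integral_nneseries//; last 2 first.
    by move=> l; exact/measurable_EFinP.
    by move=> l x _; rewrite lee_fin.
  apply: lime_le.
    by apply: is_cvg_nneseries => l _ _; apply: integral_ge0 => x _; rewrite lee_fin.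
  apply: nearW => n; apply: (@le_trans _ _ (\sum_(0 <= l < n) (2^-1 ^+ l.+1)%:E)%E).
    apply: lee_sum => l _; under eq_integral do rewrite EFinM.
    rewrite ge0_integralZl_EFin//; last 2 first.
      by move=> x _; rewrite lee_fin even_convex_ge0.
      by apply/measurable_EFinP; exact: even_convex_comp.
    rewrite -[leRHS]mule1 lee_wpmul2l// ?lee_fin ?exprn_ge0 ?invr_ge0//.
    exact: vN.
  by rewrite big_mkord sumEFin lee_fin half_series_le.
pose D := [set x | (f x < +oo)%E].
have mD : measurable D.
  by rewrite -[D]setTI; exact: emeasurable_fun_infty_o.
have D0 : mu (~` D) = 0.
  have fint : mu.-integrable setT f.
    apply/integrableP; split => //; under eq_integral do rewrite gee0_abs//.
    by rewrite (le_lt_trans if1)// ltry.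
  have := integrable_ae measurableT fint.
  move=> [Z [mZ Z0 DZ]]; apply/eqP; rewrite -measure_le0 -Z0 le_measure ?inE//.
    exact: measurableC.
  apply: subset_trans DZ => x /= nDx H; apply: nDx; rewrite /D/=.
  by have := H I; rewrite ge0_fin_numE.
pose v' l x := v l x * \1_D x.
have mv' l : measurable_fun setT (v' l) by apply: measurable_funM.
have v'v l x : `|v' l x| <= `|v l x|.
  by rewrite /v' indicE normrM; case: (_ \in _); rewrite ?normr1 ?mulr1// normr0 mulr0.
have v'N l : (modular mu N (v' l) <= 1%:E)%E by apply: (le_trans _ (vN l)); exact: le_modular.
have cle j : c j <= 2 * 2^-1 ^+ j.+1.
  elim: j => [|j IH]; first by rewrite expr1 divff.
  rewrite (le_trans (cS j))// [in leRHS]exprS mulrCA mulrC.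
  apply: ler_pM => //; [exact/ltW/c0|by rewrite lef_pV2 ?posrE//; lra].
have cvgS x : cvgn (series (fun l => c l * v' l x)).
  suff : cvgn (series (fun l => `|c l * v' l x|)) by exact: normed_cvg.
  apply: nondecreasing_is_cvgn.
    apply/nondecreasing_seqP => n; rewrite /series/= big_nat_recr//= lerDl//.
  have [Dx|nDx] := pselect (D x); last first.
    exists 0 => _ [n _ <-]; rewrite /series/= big1// => l _.
    by rewrite /v' indicE memNset// !mulr0 normr0.
  exists (2 * (fine (f x) + M 1)) => _ [n _ <-]; rewrite /series/= big_mkord.
  apply: (@le_trans _ _ (\sum_(l < n) (2 * (2^-1 ^+ l.+1 * N (v l x)) + 2 * M 1 * 2^-1 ^+ l.+1))).
    apply: ler_sum => l _; rewrite normrM gtr0_norm//.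
    apply: (@le_trans _ _ (2 * 2^-1 ^+ l.+1 * (N (v l x) + M 1))); last first.
      by rewrite le_eqVlt; apply/orP; left; apply/eqP; ring.
    apply: ler_pM => //; first exact/ltW/c0.
    apply: (le_trans (v'v _ _)).
    by have := young_abs MN 1 (v l x); rewrite mul1r addrC.
  rewrite big_split/= -!mulr_sumr mulrDr lerD//.
    rewrite ler_wpM2l// -lee_fin fineK ?ge0_fin_numE// -sumEFin.
    rewrite -(big_mkord xpredT (fun l => (2^-1 ^+ l.+1 * N (v l x))%:E)).
    by apply: nneseries_lim_ge => l _ _; rewrite lee_fin.
  rewrite -[leRHS]mulr1 ler_wpM2l ?half_series_le// mulr_ge0// even_convex_ge0//.
pose G x := limn (series (fun l => c l * v' l x)).
have GP x : (\sum_(l < n) c l * v' l x) @[n --> \oo] --> G x.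
  have : series (fun l => c l * v' l x) @ \oo --> G x by exact: cvgS.
  by rewrite /series/=; under eq_fun do rewrite big_mkord.
have mS n : measurable_fun setT (fun x => \sum_(l < n) c l * v' l x).
  by apply: measurable_sum => l; exact: measurable_funM.
have mG : measurable_fun setT G.
  by apply: (measurable_fun_cvg (h := fun n x => \sum_(l < n) c l * v' l x)) => // x _; exact: GP.
exists D, G; split => // j.
apply: (@fatou_bound _ _ _ _
  (fun m x => N ((\sum_(l < m) c (j + l)%N * v' (j + l)%N x) / (2 * c j)))).
- move=> m; apply: even_convex_comp => //; apply: measurable_funM => //.
  by apply: measurable_sum => l; exact: measurable_funM.
- by move=> m x; exact: even_convex_ge0.
- move=> x; apply: continuous_cvg; first exact: even_convex_continuous.
  apply: cvgM; last exact: cvg_cst.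
  have : (\sum_(l < j + m) c l * v' l x) @[m --> \oo] --> G x.
    have := GP x; rewrite -(cvg_shiftn j); apply: cvg_trans; apply: near_eq_cvg.
    by apply: nearW => m; rewrite addnC.
  move=> /cvgB /(_ (cvg_cst (\sum_(l < j) c l * v' l x))); apply: cvg_trans.
  apply: near_eq_cvg; apply: nearW => m /=.
  transitivity (\sum_(l < j + m) c l * v' l x - \sum_(l < j) c l * v' l x); first by [].
  by rewrite big_split_ord/= addrAC subrr add0r.
- by move=> m; exact: (block_modular mv' v'N c0 cS).
Qed.

End ball_series.

Section Rintegral_ae.
Context d (T : measurableType d) (R : realType) (mu : {measure set T -> \bar R}).

Lemma eq_Rintegral_ae (D : set T) (f g : T -> R) : measurable D -> mu (~` D) = 0 ->
  measurable_fun setT f -> measurable_fun setT g -> (forall x, D x -> f x = g x) ->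
  \int[mu]_x f x = \int[mu]_x g x.
Proof.
move=> mD D0 mf mg fg; congr fine; apply: ae_eq_integral => //.
- exact/measurable_EFinP.
- exact/measurable_EFinP.
- exists (~` D); split => //; first exact: measurableC.
  by move=> x /= nfg Dx; apply: nfg => _; rewrite fg.
Qed.

Lemma orliczLE_integrable M N (u v : T -> R) : conjugate_pair M N ->
  measurable_fun setT u -> measurable_fun setT v -> orliczL mu M u -> orliczL mu N v ->
  mu.-integrable setT (EFin \o (fun x => u x * v x)).
Proof.
move=> MN mu' mv [_ [a a0 ua]] [_ [b b0 vb]].
exact: (orlicz_integrable MN mu' mv a0 b0).
Qed.

Lemma orliczE_L M (u : T -> R) : orliczE mu M u -> orliczL mu M u.
Proof. by move=> [? uE]; split => //; exists 1 => //; exact: uE. Qed.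

End Rintegral_ae.

Section weak_bounded.
Context d (T : measurableType d) (R : realType) (mu : {measure set T -> \bar R}).
Variable theta : T -> R.
Hypothesis mtheta : measurable_fun setT theta.
Hypothesis theta01 : forall x, 0 < theta x <= 1.
Hypothesis itheta : mu.-integrable setT (EFin \o theta).
Local Notation small := (small_support theta).

Variables (M N : R -> R).
Hypothesis MN : conjugate_pair M N.
Let eM : even_convex M. Proof. by case: MN. Qed.
Let eN : even_convex N. Proof. by case: MN. Qed.

Variable U : nat -> T -> R.
Hypothesis mU : forall i, measurable_fun setT (U i).
Hypothesis LU : forall i, orliczL mu M (U i).
Hypothesis wU : forall g : T -> R, measurable_fun setT g -> orliczE mu N g ->
  exists B, forall i, `|\int[mu]_x (U i x * g x)| <= B.

Let dual_bound : exists K : nat -> R, (forall i, 0 <= K i) /\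
  forall i (g : T -> R), measurable_fun setT g -> (modular mu N g <= 1%:E)%E ->
  mu.-integrable setT (EFin \o (fun x => U i x * g x)) /\
  `|\int[mu]_x (U i x * g x)| <= K i.
Proof.
have /choice[K KP] : forall i, exists K, 0 <= K /\
  forall g : T -> R, measurable_fun setT g -> (modular mu N g <= 1%:E)%E ->
  mu.-integrable setT (EFin \o (fun x => U i x * g x)) /\
  `|\int[mu]_x (U i x * g x)| <= K.
  move=> i; have [k [k0 [C UC]]] := orliczL_bound eM (LU i).
  exists (k * 1 * (`|C| + 1)); split; first by rewrite mulr1 mulr_ge0 ?ltW// ltr_wpDl.
  move=> g mg gN; have UC' := le_trans UC (_ : (C%:E <= `|C|%:E)%E).
  have gN' : (modular mu N (fun x => g x / 1)%R <= 1%:E)%E.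
    by move: gN; rewrite /modular; under [X in (_ -> X <= _)%E]eq_integral do rewrite divr1.
  have [|Ui UgC] := orlicz_holder MN (mU i) mg k0 ltr01 (UC' _) gN'.
    by rewrite lee_fin ler_norm.
  split => //; apply: (le_trans (le_normr_Rintegral _ _)) => //.
by exists K; split => [i|i g mg gN]; have [K0 H] := KP i => //; exact: H.
Qed.

(* Otherwise choose functions [g_j] of modular at most [1] on which [U] is very large and
   sum them with rapidly decreasing coefficients: the sum is in [E_N] and contradicts [wU]. *)
Lemma gliding_hump : exists2 C : R, 0 < C & forall i (g : T -> R), small g -> (modular mu N g <= 1%:E)%E ->
  `|\int[mu]_x (U i x * g x)| <= C.
Proof.
apply: contrapT => nC; have [K [K0 KP]] := dual_bound.
pose ball (g : T -> R) := small g /\ (modular mu N g <= 1%:E)%E.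
have /choice[pick pickP] : forall C : R, exists ig : nat * (T -> R), ball ig.2 /\
    C < `|\int[mu]_x (U ig.1 x * ig.2 x)|.
  move=> C; apply: contrapT => H; apply: nC; exists (Num.max C 1).
    by rewrite lt_max ltr01 orbT.
  move=> i g gS gN; rewrite leNgt; apply/negP => Cg; apply: H; exists (i, g).
  by split => //; move: Cg; rewrite gt_max => /andP[].
have /choice[p pP] : forall g : T -> R, exists B, measurable_fun setT g -> orliczE mu N g ->
    forall i, `|\int[mu]_x (U i x * g x)| <= B.
  move=> g; have [[mg Eg]|ng] := pselect (measurable_fun setT g /\ orliczE mu N g).
    by have [B BP] := wU mg Eg; exists B.
  by exists 0 => mg Eg; exfalso; exact: ng.
(* State: partial sum and next coefficient; [c] shrinks fast enough that the
   tail is harmless for the functional used at the previous stages. *)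
pose ch j (s : (T -> R) * R) := pick ((j.+2%:R + p s.1) / s.2).
pose next j (s : (T -> R) * R) : (T -> R) * R :=
  ((fun x => s.1 x + s.2 * (ch j s).2 x), Num.min (s.2 / 4) (2 * (K (ch j s).1 + 1))^-1).
pose fix st j := if j is i.+1 then next i (st i) else ((fun=> 0), 1).
pose c j := (st j).2; pose g j := (st j).1.
pose v j := (ch j (st j)).2; pose ix j := (ch j (st j)).1.
have vb j : ball (v j) by have [] := pickP ((j.+2%:R + p (st j).1) / (st j).2).
have gS j x : g j.+1 x = g j x + c j * v j x by [].
have c0 j : 0 < c j.
  elim: j => [|j IH]; first exact: ltr01.
  by rewrite /c/= lt_min divr_gt0//= invr_gt0 mulr_gt0// ltr_wpDl.
have cS j : c j.+1 <= c j / 4 by rewrite /c/= ge_min lexx.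
have cK j : c j.+1 * (2 * K (ix j)) <= 1.
  have : c j.+1 <= (2 * (K (ix j) + 1))^-1 by rewrite /c/= ge_min lexx orbT.
  rewrite -[(_^-1)]mul1r ler_pdivlMr ?mulr_gt0// ?ltr_wpDl//; apply: le_trans.
  by rewrite ler_wpM2l ?(ltW (c0 _))// ler_wpM2l// lerDl.
have vbig j : j.+2%:R + p (g j) < c j * `|\int[mu]_x (U (ix j) x * v j x)|.
  have [_] := pickP ((j.+2%:R + p (st j).1) / (st j).2).
  by rewrite ltr_pdivrMr//; [rewrite mulrC|exact: c0].
have cle j : c j <= 2^-1 ^+ j.
  elim: j => [|j IH]; first by rewrite expr0.
  rewrite (le_trans (cS j))// exprS mulrC ler_pM ?(ltW (c0 _))//.
  by rewrite lef_pV2 ?posrE//; lra.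
have mv j : measurable_fun setT (v j) by case: (vb j) => -[].
have sg j : small (g j).
  elim: j => [|j IH]; last by apply: small_supportD => //; apply: small_supportZ; case: (vb j).
  by split; [exact: measurable_cst|exists 0%N => x; rewrite normr0].
have c01 : c 0%N <= 1 by [].
have vN j : (modular mu N (v j) <= 1%:E)%E by case: (vb j).
have [D [G [mD D0 mG _ Gtail]]] := ball_series MN mv vN c0 cS c01.
pose g' j x := \sum_(l < j) c l * (v l x * \1_D x).
have gE j x : g' j x = g j x * \1_D x.
  elim: j => [|j IH]; first by rewrite /g' big_ord0 mul0r.
  by rewrite /g' big_ord_recr/= -/(g' j x) IH gS mulrDl mulrA.
have mg j : measurable_fun setT (g j) by case: (sg j).
have mg' j : measurable_fun setT (g' j).
  by rewrite (_ : g' j = fun x => g j x * \1_D x); [exact: measurable_funM|exact/funext].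
have sg' j : small (g' j).
  apply: (small_support_le (B := 1) (sg j)) => // x.
  by rewrite gE indicE normrM mul1r; case: (_ \in _); rewrite ?normr1 ?mulr1// normr0 mulr0.
have Eg j : orliczE mu N (g j) by apply: (small_support_orliczE theta01 itheta).
have Eg' j : orliczE mu N (g' j) by apply: (small_support_orliczE theta01 itheta).
have mtail j : measurable_fun setT (fun x => G x - g' j x) by exact: measurable_funB.
(* For a factor [r], choose [j] with [4 * |r| * c j <= 1]. After the doubling in [modularD_lty] the
   partial sum is still in E_N and the tail has modular at most 1. *)
have EG : orliczE mu N G.
  apply: scale_orliczE => // r.
  have [j jr] : exists j, `|r| * 2 * (2 * c j) <= 1.
    have r1 : 0 < `|r| * 2 * 2 + 1 by rewrite ltr_wpDl// !mulr_ge0.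
    have : geometric 1 (2^-1 : R) n @[n --> \oo] --> 0.
      by apply: cvg_geometric; rewrite ger0_norm//; lra.
    move=> /cvgr0Pnorm_le /(_ (`|r| * 2 * 2 + 1)^-1); rewrite invr_gt0 => /(_ r1)[j _ /(_ j (leqnn j))].
    rewrite /= mul1r ger0_norm ?exprn_ge0 ?invr_ge0// => jr; exists j.
    rewrite mulrA (@le_trans _ _ ((`|r| * 2 * 2 + 1) * c j))//.
      by rewrite ler_wpM2r ?(ltW (c0 _))// lerDl.
    by rewrite -ler_pdivlMl// mulr1 (le_trans (cle j)).
  have e1 x : r * G x = r * g' j x + r * (G x - g' j x) by ring.
  under eq_fun do rewrite e1.
  apply: modularD_lty => //; [exact: measurable_funM|exact: measurable_funM| |].
    by under eq_fun do rewrite mulrA; apply: orliczE_scale.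
  apply: (le_lt_trans _ (ltry 1)).
  have Gt : (modular mu N (fun x => (G x - g' j x) / (2 * c j))%R <= 1%:E)%E := Gtail j.
  apply: (le_trans _ Gt); apply: le_modular => //.
  - exact: (measurable_funM (measurable_cst _) (measurable_funM (measurable_cst _) (mtail j))).
  - exact: (measurable_funM (mtail j) (measurable_cst _)).
  move=> x; rewrite mulrA [leRHS]normrM mulrC normrM ler_wpM2l//.
  rewrite normrM mulrC [X in _ * X]gtr0_norm// [leRHS]gtr0_norm ?invr_gt0 ?mulr_gt0//.
  by rewrite -[leRHS]mul1r ler_pdivlMr ?mulr_gt0.
have iU i (h : T -> R) : measurable_fun setT h -> orliczE mu N h ->
    mu.-integrable setT (EFin \o (fun x => U i x * h x)).
  by move=> mh Eh; apply: (orliczLE_integrable MN) => //; exact: orliczE_L.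
have Ev j : orliczE mu N (v j).
  by apply: (small_support_orliczE theta01 itheta) => //; case: (vb j).
(* At stage [j] the new term exceeds [j + 2 + p (g j)], the earlier ones contribute at most
   [p (g j)] and the tail at most 1. The integral against [G] would thus exceed [j + 1], while it is
   at most [p G < j]. *)
pose j := Num.bound `|p G|.
have pGj : p G < j%:R by rewrite (le_lt_trans (ler_norm _))// archi_boundP.
have Ttail : `|\int[mu]_x (U (ix j) x * (G x - g' j.+1 x))| <= 1.
  have [Ui UK] := KP (ix j) _ (measurable_funM (mtail j.+1) (measurable_cst _)) (Gtail j.+1).
  have -> : \int[mu]_x (U (ix j) x * (G x - g' j.+1 x)) =
      2 * c j.+1 * \int[mu]_x (U (ix j) x * ((G x - g' j.+1 x) / (2 * c j.+1))).
    rewrite -RintegralZl//; apply: eq_Rintegral => x _.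
    by rewrite [RHS]mulrCA [2 * c j.+1 * _]mulrCA divff ?mulr1// mulf_neq0 ?gt_eqF.
  rewrite normrM ger0_norm ?mulr_ge0 ?(ltW (c0 _))//.
  apply: (le_trans _ (cK j)); rewrite [leRHS]mulrCA -mulrA ler_wpM2l//.
  by rewrite ler_wpM2l ?(ltW (c0 _)).
have TG : \int[mu]_x (U (ix j) x * G x) = \int[mu]_x (U (ix j) x * g j x) +
    c j * \int[mu]_x (U (ix j) x * v j x) + \int[mu]_x (U (ix j) x * (G x - g' j.+1 x)).
  have igj := iU (ix j) _ (mg j) (Eg j); have ivj := iU (ix j) _ (mv j) (Ev j).
  have e2 : \int[mu]_x (U (ix j) x * g' j.+1 x) =
      \int[mu]_x (U (ix j) x * g j x) + c j * \int[mu]_x (U (ix j) x * v j x).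
    rewrite -RintegralZl// -RintegralD//; last exact: integrable_EFinZ.
    apply: (eq_Rintegral_ae mD D0); [exact: measurable_funM| |].
      apply: measurable_funD; first exact: measurable_funM.
      by do 2 apply: measurable_funM => //.
    by move=> x Dx; rewrite gE indicE mem_set// mulr1 gS mulrDr; congr (_ + _); rewrite mulrCA.
  have ig' := iU (ix j) _ (mg' j.+1) (Eg' j.+1); have iG := iU (ix j) _ mG EG.
  rewrite -e2 -RintegralD//; first by apply: eq_Rintegral => x _; ring.
  have := integrable_EFinB iG ig'; congr (_.-integrable _ _).
  by apply/funext => x /=; rewrite mulrBr.
have B1 := pP G mG EG (ix j); have B2 := pP (g j) (mg j) (Eg j) (ix j).
have : c j * `|\int[mu]_x (U (ix j) x * v j x)| <= p G + p (g j) + 1.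
  have -> : c j * `|\int[mu]_x (U (ix j) x * v j x)| = `|c j * \int[mu]_x (U (ix j) x * v j x)|.
    by rewrite normrM [in RHS]gtr0_norm.
  move: TG B1 B2 Ttail.
  move: (\int[mu]_x _) (\int[mu]_x _) (c j * _) (\int[mu]_x _) => A B1 B2 B3 -> .
  by rewrite !ler_norml; lra.
have := vbig j; rewrite -addn2 natrD; lra.
Qed.

(** The constant of [gliding_hump] works. A small [w] with [S = int N w > 1] is divided by [S],
    which brings it into the unit modular ball by convexity; so [int U i * w <= C * S]. In both
    cases [int U i / C * w <= 1 + int N w], and [modular_dual] concludes. *)
Lemma weakly_bounded_modular : exists2 K : R, 0 < K &
  forall i, (modular mu M (fun x => U i x / K)%R <= 1%:E)%E.
Proof.
have [C C0 CP] := gliding_hump; exists C => // i.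
apply: (modular_dual mtheta theta01 itheta MN); first exact: measurable_funM.
move=> w wS; have [mw _] := wS.
have Ew := small_support_orliczE theta01 itheta eN wS.
have iUw : mu.-integrable setT (EFin \o (fun x => U i x * w x)).
  by apply: (orliczLE_integrable MN) => //; exact: orliczE_L.
have Nw := small_support_modular theta01 itheta eN wS.
have -> : \int[mu]_x (U i x / C * w x) = C^-1 * \int[mu]_x (U i x * w x).
  by rewrite -RintegralZl//; apply: eq_Rintegral => x _; rewrite mulrAC mulrC.
rewrite mulrC ler_pdivrMr//.
have S0 : 0 <= \int[mu]_x N (w x) by apply: Rintegral_ge0 => x _; exact: even_convex_ge0.
have [S1|S1] := leP (\int[mu]_x N (w x)) 1.
  apply: (le_trans (ler_norm _)); apply: (@le_trans _ _ C).
    by apply: CP => //; rewrite modularE// lee_fin.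
  by rewrite -[leLHS]mul1r ler_wpM2r// ?(ltW C0)// lerDl.
pose S := \int[mu]_x N (w x); have Sp : 0 < S by rewrite (lt_trans ltr01).
have wSS : small (fun x => S^-1 * w x) by exact: small_supportZ.
have : `|\int[mu]_x (U i x * (S^-1 * w x))| <= C.
  apply: CP => //; rewrite modularE//; last exact: (small_support_modular theta01 itheta).
  have iNw := modular_integrable eN mw Nw.
  rewrite lee_fin; apply: (@le_trans _ _ (\int[mu]_x (S^-1 * N (w x)))).
    apply: le_Rintegral => //; last first.
    - by move=> x _; apply: even_convex_shrink => //; rewrite invr_ge0 S0 invf_le1// ltW.
    - exact: integrable_EFinZ.
    - exact: (small_support_integrable theta01 itheta (small_support_comp eN wSS)).
  by rewrite RintegralZl// mulVf// gt_eqF.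
have -> : \int[mu]_x (U i x * (S^-1 * w x)) = S^-1 * \int[mu]_x (U i x * w x).
  by rewrite -RintegralZl//; apply: eq_Rintegral => x _; rewrite mulrCA.
rewrite normrM gtr0_norm ?invr_gt0// ler_pdivrMl// => H.
rewrite (le_trans (ler_norm _))// (le_trans H)// ler_wpM2r ?(ltW C0)//.
by rewrite -/S lerDr.
Qed.

End weak_bounded.

(** * Weak limits along ultrafilters *)

Section ultrafilter_limit.
Context {R : realType}.

(** One and the same ultrafilter thus makes the integrals against all test functions converge, with
    no choice of subsequences. *)
Lemma ultra_bounded_cvg (F : set_system nat) (x : nat -> R) (B : R) :
  UltraFilter F -> (forall i, `|x i| <= B) -> cvg (x i @[i --> F]).
Proof.
move=> UF xB; have := @segment_compact R (- B) B (x @ F) _ _.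
move=> /(_ (fmap_proper_filter x ultra_proper)) [].
  by apply: nearW => i /=; rewrite in_itv/= -ler_norml.
move=> l [_ cl]; apply/cvg_ex; exists l => V Vl.
have [//|FV] := in_ultra_setVsetC (x @^-1` V) UF.
by have [y [/= nVy Vy]] := cl (~` V) V FV Vl.
Qed.

End ultrafilter_limit.

Section greedy.
Context d (T : measurableType d) (R : realType).

(* Binary expansion: uniform approximation by combinations of indicators. *)
Lemma indicator_induction (P : (T -> R) -> Prop) :
  P (fun=> 0) ->
  (forall f (c : R) B, P f -> measurable_fun setT f -> measurable B ->
     P (fun x => f x + c * \1_B x)) ->
  forall f : T -> R, measurable_fun setT f -> (forall x, 0 <= f x <= 1) ->
  forall n, exists g : T -> R, [/\ measurable_fun setT g, P g &
    forall x, 0 <= f x - g x <= 2^-1 ^+ n].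
Proof.
move=> P0 PD f mf f01; elim=> [|n [g [mg Pg gf]]].
  by exists (fun=> 0); split => // x; rewrite subr0 expr0.
pose B := [set x | 2^-1 ^+ n.+1 <= f x - g x].
have mB : measurable B.
  by apply: measurable_set_ler => //; exact: measurable_funB.
exists (fun x => g x + 2^-1 ^+ n.+1 * \1_B x); split.
- by apply: measurable_funD => //; exact: measurable_funM.
- exact: PD.
- move=> x; have /andP[g1 g2] := gf x.
  have e2 : 2^-1 ^+ n = 2 * 2^-1 ^+ n.+1 :> R by rewrite exprS; field.
  rewrite indicE; case: (boolP (x \in B)); rewrite ?inE /B/= => H.
    rewrite mulr1; rewrite e2 in g2; move: (_ ^+ _) H g2 => z; lra.
  rewrite mulr0 addr0 g1/=; rewrite notin_setE/= in H.
  by move/negP: H; rewrite -ltNge => /ltW.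
Qed.

End greedy.

Section measurable_inverse.
Context d (T : measurableType d) (R : realType).

Lemma measurable_funV_pos (f : T -> R) : measurable_fun setT f ->
  (forall x, 0 < f x) -> measurable_fun setT (fun x => (f x)^-1).
Proof.
move=> mf f0; rewrite (_ : (fun _ => _) = (@powR R)^~ (- 1) \o f).
  by apply: measurableT_comp => //; exact: measurable_powR.
by apply/funext => x /=; rewrite powR_inv1// ltW.
Qed.

End measurable_inverse.

Section weak_limit.
Context d (T : measurableType d) (R : realType).
Variable mu : {sigma_finite_measure set T -> \bar R}.
Variable theta : T -> R.
Hypothesis mtheta : measurable_fun setT theta.
Hypothesis theta01 : forall x, 0 < theta x <= 1.
Hypothesis itheta : mu.-integrable setT (EFin \o theta).
Local Notation small := (small_support theta).
Variables (M N : R -> R).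
Hypothesis MN : conjugate_pair M N.
Variables (A : nat -> T -> R) (k C : R).
Hypothesis k0 : 0 < k.
Hypothesis C0 : 0 <= C.
Hypothesis mA : forall i, measurable_fun setT (A i).
Hypothesis AC : forall i, (modular mu N (fun x => A i x / k)%R <= C%:E)%E.
Variable F : set_system nat.
Hypothesis UF : UltraFilter F.
Let FF : ProperFilter F := ultra_proper.
Existing Instance FF.

Let eM : even_convex M. Proof. by case: MN. Qed.
Let eN : even_convex N. Proof. by case: MN. Qed.

Let intA i (w : T -> R) : measurable_fun setT w -> orliczE mu M w ->
  mu.-integrable setT (EFin \o (fun x => A i x * w x)).
Proof.
move=> mw Ew; apply: (orliczLE_integrable (conjugate_pairC MN)) => //.
  split; first by exists (A i) => //; exact: aeW.
  by exists k => //; apply: (le_lt_trans (AC i)); exact: ltry.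
exact: orliczE_L.
Qed.

Let L (w : T -> R) : R := lim (\int[mu]_x (A i x * w x) @[i --> F]).

Let L_cvg (w : T -> R) : measurable_fun setT w -> orliczE mu M w ->
  \int[mu]_x (A i x * w x) @[i --> F] --> L w.
Proof.
move=> mw Ew.
have Ew1 : (modular mu M (fun x => w x / 1)%R < +oo)%E by case: Ew => _; apply.
apply: (@ultra_bounded_cvg _ _ _ (k * 1 * (C + \int[mu]_x M (w x / 1)))) => // i.
have w1 : (modular mu M (fun x => w x / 1)%R <= (\int[mu]_x M (w x / 1))%:E)%E.
  by rewrite modularE.
have [iAw Aw] := orlicz_holder (conjugate_pairC MN) (mA i) mw k0 ltr01 (AC i) w1.
exact: (le_trans (le_normr_Rintegral _ _)).
Qed.

Let L_unique (w : T -> R) (l : R) : (\int[mu]_x (A i x * w x) @[i --> F] --> l) -> L w = l.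
Proof. by move=> h; apply: cvg_lim. Qed.

Let LD (u v : T -> R) (c : R) : measurable_fun setT u -> orliczE mu M u ->
  measurable_fun setT v -> orliczE mu M v -> L (fun x => u x + c * v x) = L u + c * L v.
Proof.
move=> mu' Eu mv Ev; apply: L_unique.
have H : (\int[mu]_x (A i x * u x) + c * \int[mu]_x (A i x * v x)) @[i --> F] -->
    L u + c * L v.
  by apply: cvgD; [exact: L_cvg|apply: cvgM; [exact: cvg_cst|exact: L_cvg]].
apply: cvg_trans H; apply: near_eq_cvg; apply: nearW => i.
have iu := intA i mu' Eu; have iv := intA i mv Ev.
rewrite -RintegralZl// -RintegralD//; last exact: integrable_EFinZ.
by apply: eq_Rintegral => x _; rewrite mulrDr mulrCA.
Qed.

Let theta_dom (w : T -> R) (b : R) : measurable_fun setT w -> (forall x, `|w x| <= b * theta x) ->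
  orliczE mu M w.
Proof.
move=> mw wb; apply: scale_orliczE => // r.
have mMw : measurable_fun setT (fun x => M (r * w x)).
  by apply: even_convex_comp => //; exact: measurable_funM.
have := integrable_EFinZ (M (r * b)) itheta.
move=> /(le_integrable_EFin mMw) H; apply: integrable_lty => //; apply: H => x.
have /andP[t0 t1] := theta01 x.
rewrite ger0_norm ?even_convex_ge0// [leRHS]mulrC.
apply: (le_trans _ (even_convex_shrink eM _ _)); last by rewrite ltW.
apply: even_convex_mono => //; rewrite !normrM mulrCA ler_wpM2l//.
by rewrite (gtr0_norm t0) [leRHS]mulrC (le_trans (wb x))// ler_pM2r// ler_norm.
Qed.

Let theta_E : orliczE mu M theta.
Proof.
apply: (@theta_dom _ 1) => // x; rewrite mul1r ger0_norm//.
by have /andP[/ltW] := theta01 x.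
Qed.

Let mtI B : measurable B -> measurable_fun setT (fun x => theta x * \1_B x).
Proof. by move=> mB; exact: measurable_funM. Qed.

Let tI_E B : measurable B -> orliczE mu M (fun x => theta x * \1_B x).
Proof.
move=> mB; apply: (@theta_dom _ 1); first exact: mtI.
move=> x; rewrite mul1r normrM indicE; have /andP[/ltW t0 _] := theta01 x.
by rewrite ger0_norm//; case: (_ \in _); rewrite ?normr1 ?mulr1// normr0 mulr0.
Qed.

(** The factor [theta] keeps the charge finite on the whole space; the Radon-Nikodym density is
    divided by [theta] afterwards. *)
Definition limit_charge (B : set T) : \bar R := (L (fun x => theta x * \1_B x))%:E.

Let limit_charge0 : limit_charge set0 = 0%E.
Proof.
congr EFin; apply: L_unique; rewrite (_ : (fun _ => _) = cst 0); first exact: cvg_cst.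
apply/funext => i; rewrite (_ : (fun _ => _) = cst 0) ?Rintegral_cst ?mul0r//.
by apply/funext => x; rewrite indic0 !mulr0.
Qed.

(** Order continuity, inherited from the uniformity in [holder_tail]: from some [n] on the bound
    holds for every [A i], hence for their limit. It yields the countable additivity of the charge
    and every later passage from special functions to general ones. *)
Let L_order (w_ : nat -> T -> R) (W : T -> R) (e : R) : 0 < e ->
  (forall n, measurable_fun setT (w_ n)) -> measurable_fun setT W -> orliczE mu M W ->
  (forall n x, `|w_ n x| <= `|W x|) -> (forall x, w_ n x @[n --> \oo] --> 0) ->
  \forall n \near \oo, `|L (w_ n)| <= e.
Proof.
move=> e0 mw mW EW wW w0.
have Ew n : orliczE mu M (w_ n).
  apply: scale_orliczE => // r; apply: (le_lt_trans _ (orliczE_scale eM EW r)).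
  apply: le_modular => //; [exact: measurable_funM|exact: measurable_funM|].
  by move=> x; rewrite !normrM ler_wpM2l.
have := holder_tail MN k0 C0 e0 mw mW EW wW w0; apply: filterS => n H.
have Lc : `|\int[mu]_x (A i x * w_ n x)| @[i --> F] --> `|L (w_ n)|.
  by apply: cvg_norm; exact: L_cvg.
rewrite -(cvg_lim _ Lc)//.
apply: limr_le; first by apply/cvg_ex; exists `|L (w_ n)|.
apply: nearW => i; apply: (le_trans (le_normr_Rintegral _ _)) => //; first exact: intA.
by apply: H.
Qed.

Let limit_charge_sigma : semi_sigma_additive limit_charge.
Proof.
move=> B mB tB mUB; pose U := \bigcup_n B n.
pose w n x := theta x * \1_U x - \sum_(l < n) theta x * \1_(B l) x.
have sE n x : \sum_(l < n) theta x * \1_(B l) x = theta x * \1_(\big[setU/set0]_(l < n) B l) x.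
  elim: n => [|n IH]; first by rewrite !big_ord0 indic0 mulr0.
  rewrite !big_ord_recr/= IH -mulrDr; congr (_ * _); rewrite !indicE in_setU.
  case: (boolP (x \in B n)) => [|_]; last by rewrite orbF addr0.
  rewrite inE orbT => xn; rewrite memNset ?add0r// -bigcup_mkord => -[l /= ln xl].
  by have ln' := tB l n I I (ex_intro _ x (conj xl xn)); move: ln; rewrite ln' ltnn.
have mbU n : measurable (\big[setU/set0]_(l < n) B l) by apply: bigsetU_measurable.
have subU n : \big[setU/set0]_(l < n) B l `<=` U by apply: bigsetU_bigcup.
have wE n x : w n x = theta x * (\1_U x - \1_(\big[setU/set0]_(l < n) B l) x).
  by rewrite /w sE mulrBr.
have mw n : measurable_fun setT (w n).
  rewrite (_ : w n = fun x => theta x * (\1_U x - \1_(\big[setU/set0]_(l < n) B l) x)); last exact/funext.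
  by apply: measurable_funM => //; apply: measurable_funB.
have w0 e : 0 < e -> \forall n \near \oo, `|L (w n)| <= e.
  move=> e0; apply: (@L_order _ theta) => // [n x|x].
    rewrite wE normrM ler_piMr// !indicE.
    case: (boolP (x \in U)) => xU; case: (boolP (x \in \big[setU/set0]_(l < n) B l)) => xn;
      rewrite ?subrr ?subr0 ?normr0 ?normr1//.
    by exfalso; move: xn xU; rewrite inE => /subU xU; rewrite mem_set.
  have [[m _ xm]|nxU] := pselect (U x); last first.
    rewrite (_ : (fun n => _) = cst 0); first exact: cvg_cst.
    apply/funext => n; rewrite wE !indicE memNset// memNset ?subrr ?mulr0//.
    by move/subU.
  apply/cvgrPdist_le => e' e'0; exists m.+1 => //= n mn.
  rewrite wE !indicE mem_set; last by exists m.
  rewrite mem_set ?subrr ?mulr0 ?subrr ?normr0 ?(ltW e'0)//.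
  by rewrite -bigcup_mkord; exists m.
have -> : (fun n => (\sum_(0 <= l < n) limit_charge (B l))%E) =
    (fun n => (L (fun x => theta x * \1_U x) - L (w n))%:E).
  apply/funext => n; rewrite big_mkord sumEFin; congr EFin.
  have -> : L (w n) = L (fun x => theta x * \1_U x) + (-1) *
      L (fun x => theta x * \1_(\big[setU/set0]_(l < n) B l) x).
    rewrite -LD//; [|exact: mtI|exact: tI_E|exact: mtI|exact: tI_E].
    by congr L; apply/funext => x; rewrite wE mulrBr mulN1r.
  rewrite mulN1r opprB addrC subrK.
  elim: n => [|n IH]; first by rewrite !big_ord0; have [<-] := limit_charge0.
  rewrite big_ord_recr/= IH -[X in _ + X]mul1r -LD//; [|exact: mtI|exact: tI_E|exact: mtI|exact: tI_E].
  by congr L; apply/funext => x; rewrite mul1r -!sE big_ord_recr.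
apply: cvg_EFin; first exact: nearW.
rewrite /= -[X in _ --> X]subr0; apply: cvgB; first exact: cvg_cst.
by apply/cvgr0Pnorm_le => e e0; exact: w0.
Qed.

HB.instance Definition _ := isCharge.Build _ _ _ limit_charge
  limit_charge0 (fun _ _ => erefl) limit_charge_sigma.

Lemma weak_limit_exists : exists h : T -> R, [/\ measurable_fun setT h,
  (modular mu N (fun x => h x / k)%R <= C%:E)%E &
  forall w : T -> R, measurable_fun setT w -> orliczE mu M w ->
    \int[mu]_x (A i x * w x) @[i --> F] --> \int[mu]_x (h x * w x)].
Proof.
have dom : limit_charge `<< mu.
  move=> B nB E mE EB; congr EFin; apply: L_unique.
  rewrite (_ : (fun _ => _) = cst 0); first exact: cvg_cst.
  apply/funext => i; rewrite -[RHS](mul0r (fine (mu setT))) -Rintegral_cst//.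
  apply: (@eq_Rintegral_ae _ _ _ _ (~` E)) => //.
  - exact: measurableC.
  - by rewrite setCK; exact: nB.
  - by apply: measurable_funM => //; exact: mtI.
  - by move=> x nEx; rewrite indicE memNset// !mulr0.
pose r := Radon_Nikodym limit_charge mu.
have rfin x : r x \is a fin_num by exact: Radon_Nikodym_fin_num.
have ir : mu.-integrable setT r by exact: Radon_Nikodym_integrable.
pose h x := fine (r x) / theta x.
have tn0 x : theta x != 0 by have /andP[/gt_eqF->] := theta01 x.
have hE x : (h x * theta x)%:E = r x by rewrite /h divfK// fineK.
have iht : mu.-integrable setT (EFin \o (fun x => h x * theta x)).
  by apply: eq_integrable ir => // x _; rewrite /= hE.
have mh : measurable_fun setT h.
  rewrite (_ : h = fun x => (h x * theta x) * (theta x)^-1); last first.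
    by apply/funext => x; rewrite mulfK.
  apply: measurable_funM; first exact: measurable_integrable iht.
  by apply: measurable_funV_pos => // x; have /andP[] := theta01 x.
have ihtB B : measurable B -> mu.-integrable setT (EFin \o (fun x => h x * (theta x * \1_B x))).
  move=> mB; apply: (le_integrable_EFin _ _ (integrable_norm iht)).
    by apply: measurable_funM => //; exact: mtI.
  move=> x /=; rewrite mulrA [leLHS]normrM indicE.
  by case: (_ \in _); rewrite ?normr1 ?mulr1// normr0 mulr0.
have LB B : measurable B -> L (fun x => theta x * \1_B x) = \int[mu]_x (h x * (theta x * \1_B x)).
  move=> mB; apply: EFin_inj; rewrite Rintegral_EFin; last exact: ihtB.
  transitivity (\int[mu]_(x in B) r x)%E; first exact: (Radon_Nikodym_integral dom mB).
  rewrite [LHS]integral_mkcond.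
  apply: eq_integral => x _; rewrite patchE indicE; case: (boolP (x \in B)) => _.
    by rewrite mulr1 hE.
  by rewrite !mulr0.
(* The class on which [L] is integration against [h]. It is stable under adding multiples of
   indicators, so [indicator_induction] reaches every measurable function with values in [0, 1] up
   to a uniform error. *)
pose P (f : T -> R) := [/\ orliczE mu M (fun x => theta x * f x), measurable_fun setT f,
  mu.-integrable setT (EFin \o (fun x => h x * (theta x * f x))) &
  L (fun x => theta x * f x) = \int[mu]_x (h x * (theta x * f x))].
have P0 : P (fun=> 0).
  have e0 : (fun x => theta x * 0) = (fun x => theta x * \1_set0 x).
    by apply/funext => x; rewrite indic0.
  have e1 : (fun x => h x * (theta x * 0)) = (fun x => h x * (theta x * \1_set0 x)).
    by apply/funext => x; rewrite indic0.
  by split; rewrite ?e1 ?e0; [exact: tI_E|exact: measurable_cst|exact: ihtB|exact: LB].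
have PD f (c : R) B : P f -> measurable_fun setT f -> measurable B ->
    P (fun x => f x + c * \1_B x).
  move=> [Ef mf intf Lf] _ mB.
  have e1 : (fun x => theta x * (f x + c * \1_B x)) =
      (fun x => theta x * f x + c * (theta x * \1_B x)).
    by apply/funext => x; rewrite mulrDr mulrCA.
  have mtf : measurable_fun setT (fun x => theta x * f x) by exact: measurable_funM.
  have e2 : (fun x => h x * (theta x * (f x + c * \1_B x))) =
      (fun x => h x * (theta x * f x) + c * (h x * (theta x * \1_B x))).
    by apply/funext => x; ring.
  have ii := integrable_EFinD intf (integrable_EFinZ c (ihtB _ mB)).
  split.
  - rewrite e1; apply: scale_orliczE => [|r'].
      by apply: measurable_funD => //; apply: measurable_funM => //; exact: mtI.
    rewrite (_ : (fun _ => _) = (fun x => r' * (theta x * f x) + r' * (c * (theta x * \1_B x)))).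
      apply: modularD_lty => //.
      + exact: measurable_funM.
      + by do 2 apply: measurable_funM => //; exact: mtI.
      + by under eq_fun do rewrite mulrA; exact: orliczE_scale.
      + by under eq_fun do rewrite !mulrA -mulrA; exact: (orliczE_scale eM (tI_E mB)).
    by apply/funext => x; rewrite mulrDr.
  - by apply: measurable_funD => //; exact: measurable_funM.
  - by rewrite e2.
  - rewrite e1 LD//; [|exact: mtI|exact: tI_E].
    rewrite Lf LB// -RintegralZl ?ihtB// -RintegralD//; last exact/integrable_EFinZ/ihtB.
    by apply: eq_Rintegral => x _; ring.
pose J := \int[mu]_x `|h x * theta x|.
have J0 : 0 <= J by apply: Rintegral_ge0 => x _.
have key (f : T -> R) : measurable_fun setT f -> (forall x, 0 <= f x <= 1) ->
    [/\ orliczE mu M (fun x => theta x * f x),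
      mu.-integrable setT (EFin \o (fun x => h x * (theta x * f x))) &
      L (fun x => theta x * f x) = \int[mu]_x (h x * (theta x * f x))].
  move=> mf f01.
  have mtf : measurable_fun setT (fun x => theta x * f x) by exact: measurable_funM.
  have Ef : orliczE mu M (fun x => theta x * f x).
    apply: (@theta_dom _ 1) => // x; rewrite mul1r normrM.
    have /andP[f0 f1] := f01 x; have /andP[t0 _] := theta01 x.
    by rewrite (gtr0_norm t0) ger0_norm// ler_piMr// ltW.
  have intf : mu.-integrable setT (EFin \o (fun x => h x * (theta x * f x))).
    apply: (le_integrable_EFin _ _ (integrable_norm iht)).
      exact: measurable_funM.
    move=> x /=; have /andP[f0 f1] := f01 x.
    by rewrite mulrA [leLHS]normrM (ger0_norm f0) ler_piMr.
  split => //; have /choice[g gP] := indicator_induction P0 PD mf f01.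
  pose w n x := theta x * (f x - g n x).
  have mg n : measurable_fun setT (g n) by case: (gP n).
  have mw n : measurable_fun setT (w n) by apply: measurable_funM => //; exact: measurable_funB.
  have wle n x : `|w n x| <= theta x * 2^-1 ^+ n.
    have [_ _ /(_ x) /andP[g0 g1]] := gP n; have /andP[t0 _] := theta01 x.
    by rewrite normrM (gtr0_norm t0) ger0_norm// ler_pM2l.
  have h1 n : 0 <= (2^-1 : R) ^+ n <= 1 by rewrite exprn_ge0 ?invr_ge0//= exprn_ile1//; lra.
  have geo : geometric 1 (2^-1 : R) n @[n --> \oo] --> 0.
    by apply: cvg_geometric; rewrite ger0_norm//; lra.
  apply/eqP; rewrite -subr_eq0 -normr_le0; apply/ler_addgt0Pr => e e0; rewrite add0r.
  have e20 : 0 < e / 2 by rewrite divr_gt0.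
  have eJ : 0 < e / 2 / (J + 1) by rewrite divr_gt0// ltr_wpDl.
  have H1 : \forall n \near \oo, `|L (w n)| <= e / 2.
    apply: (@L_order _ theta) => // [n x|x].
      rewrite (le_trans (wle n x))//; have /andP[t0 _] := theta01 x.
      by rewrite (gtr0_norm t0) ler_piMr ?(ltW t0)//; case/andP: (h1 n).
    apply: (@squeeze_cvgr _ _ _ _ (fun n => - (theta x * 2^-1 ^+ n)) (fun n => theta x * 2^-1 ^+ n)).
    - by apply: nearW => n; rewrite -ler_norml.
    - rewrite -[X in _ --> X]oppr0 -(mulr0 (theta x)); apply: cvgN; apply: cvgM; first exact: cvg_cst.
      by apply: cvg_trans geo; apply: near_eq_cvg; apply: nearW => n; rewrite /= mul1r.
    - rewrite -[X in _ --> X](mulr0 (theta x)); apply: cvgM; first exact: cvg_cst.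
      by apply: cvg_trans geo; apply: near_eq_cvg; apply: nearW => n; rewrite /= mul1r.
  have /cvgr0Pnorm_le /(_ _ eJ) H2 := geo.
  near \oo => n.
  have Lw : `|L (w n)| <= e / 2 by near: n.
  have h2n : 2^-1 ^+ n <= e / 2 / (J + 1).
    have : `|geometric 1 (2^-1 : R) n| <= e / 2 / (J + 1) by near: n.
    by rewrite /= mul1r ger0_norm//; case/andP: (h1 n).
  have [_ [Eg _ ig Lg] _] := gP n.
  have mtg : measurable_fun setT (fun x => theta x * g n x) by exact: measurable_funM.
  have LwE : L (w n) = L (fun x => theta x * f x) + (-1) * L (fun x => theta x * g n x).
    by rewrite -LD//; congr L; apply/funext => x; rewrite /w mulrBr mulN1r.
  have hw : `|\int[mu]_x (h x * w n x)| <= e / 2.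
    have ihw : mu.-integrable setT (EFin \o (fun x => h x * w n x)).
      rewrite (_ : (fun _ => _) = (fun x => h x * (theta x * f x) - h x * (theta x * g n x))).
        exact: integrable_EFinB.
      by apply/funext => x; rewrite /w; ring.
    apply: (le_trans (le_normr_Rintegral _ ihw)) => //.
    apply: (@le_trans _ _ (\int[mu]_x (2^-1 ^+ n * `|h x * theta x|))).
      apply: le_Rintegral => //; first exact: integrable_norm.
        by apply: integrable_EFinZ; exact: integrable_norm.
      move=> x _; rewrite normrM [in leRHS]normrM mulrCA ler_wpM2l//.
      have /andP[t0 _] := theta01 x; rewrite (gtr0_norm t0) mulrC; exact: wle.
    rewrite RintegralZl//; last exact: integrable_norm.
    rewrite -/J (@le_trans _ _ (2^-1 ^+ n * (J + 1)))//.
      by rewrite ler_wpM2l ?lerDl//; case/andP: (h1 n).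
    by rewrite -ler_pdivlMr// ltr_wpDl.
  have -> : L (fun x => theta x * f x) - \int[mu]_x (h x * (theta x * f x)) =
      L (w n) - \int[mu]_x (h x * w n x).
    rewrite LwE Lg mulN1r -addrA; congr (_ + _).
    rewrite -opprD; congr (- _); rewrite -RintegralD//.
      by apply: eq_Rintegral => x _; rewrite /w; ring.
    rewrite (_ : (fun _ => _) = (fun x => h x * (theta x * f x) - h x * (theta x * g n x))).
      exact: integrable_EFinB.
    by apply/funext => x; rewrite /w; ring.
  by rewrite (le_trans (ler_normB _ _))// [leRHS]splitr lerD.
have Lsmall (w : T -> R) : small w -> mu.-integrable setT (EFin \o (fun x => h x * w x)) /\
    L w = \int[mu]_x (h x * w x).
  move=> [mw [j wj]]; pose b : R := j.+1%:R * j%:R + 1.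
  have b0 : 0 < b by rewrite ltr_wpDl// mulr_ge0.
  have wb x : `|w x| <= b * theta x.
    have [w1 w2] := wj x; have /andP[t0 _] := theta01 x.
    have [tx|tx] := ltP (theta x) j.+1%:R^-1.
      by rewrite w2// normr0 mulr_ge0// ltW.
    rewrite (le_trans w1)// mulrDl mul1r ler_wpDr ?(ltW t0)//.
    by rewrite mulrAC ler_peMl// -ler_pdivrMl// mulr1.
  (* As [|w| <= b * theta], this affine change brings [w / theta] into [0, 1]. It inverts to
     [w = - b * theta + 2 * b * theta * f]. *)
  pose f x := (w x * (theta x)^-1 / b + 1) / 2.
  have mf : measurable_fun setT f.
    apply: measurable_funM => //; apply: measurable_funD => //; apply: measurable_funM => //.
    apply: measurable_funM => //; apply: measurable_funV_pos => // x.
    by have /andP[] := theta01 x.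
  have f01 x : 0 <= f x <= 1.
    have : `|w x * (theta x)^-1 / b| <= 1.
      have /andP[t0 _] := theta01 x.
      by rewrite 2!normrM normfV (gtr0_norm t0) normfV (gtr0_norm b0) !ler_pdivrMr// mul1r wb.
    by rewrite ler_norml /f; lra.
  have [Ef itf Lf] := key f mf f01.
  have [E1 it1 L1] := key (fun=> 1) (measurable_cst _) (fun=> ltac:(by rewrite ler01 lexx)).
  have wE : w = (fun x => (- b) * (theta x * 1) + 2 * b * (theta x * f x)).
    by apply/funext => x; rewrite /f; field; rewrite ?tn0 ?gt_eqF.
  have hwE : (fun x => h x * w x) =
      (fun x => (- b) * (h x * (theta x * 1)) + 2 * b * (h x * (theta x * f x))).
    by apply/funext => x; rewrite [in LHS]wE; ring.
  have i1 := integrable_EFinZ (- b) it1; have i2 := integrable_EFinZ (2 * b) itf.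
  split; first by rewrite hwE; exact: integrable_EFinD.
  have mt1 : measurable_fun setT (fun x => theta x * 1) by exact: measurable_funM.
  have mtf : measurable_fun setT (fun x => theta x * f x) by exact: measurable_funM.
  rewrite hwE RintegralD// !RintegralZl// -L1 -Lf {1}wE.
  have L0 : L (fun=> 0) = 0.
    by have := limit_charge0; rewrite /limit_charge => -[]; under eq_fun do rewrite indic0 mulr0.
  rewrite LD//; last first.
    apply: (@theta_dom _ b); first exact: measurable_funM.
    move=> x; have /andP[t0 _] := theta01 x.
    by rewrite mulr1 normrM normrN (gtr0_norm b0) (gtr0_norm t0).
    exact: measurable_funM.
  congr (_ + _); have := @LD (fun=> 0) (fun x => theta x * 1) (- b).
  have -> : (fun x => 0 + - b * (theta x * 1)) = (fun x => - b * (theta x * 1)).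
    by apply/funext => x; rewrite add0r.
  move=> ->//; first by rewrite L0 add0r.
  by have [] := P0; under eq_fun do rewrite mulr0.
(* Weak lower semicontinuity of the modular: each [A i] obeys [int A i * w <= k * (C + int M w)],
   the limit inherits it, and [modular_dual] turns it into the bound on [h / k]. *)
have hC : (modular mu N (fun x => h x / k)%R <= C%:E)%E.
  apply: (modular_dual mtheta theta01 itheta (conjugate_pairC MN)); first exact: measurable_funM.
  move=> w wS; have [mw _] := wS; have [ihw Lw] := Lsmall w wS.
  have Ew := small_support_orliczE theta01 itheta eM wS.
  have -> : \int[mu]_x (h x / k * w x) = k^-1 * \int[mu]_x (h x * w x).
    by rewrite -RintegralZl//; apply: eq_Rintegral => x _; rewrite mulrAC mulrC.
  rewrite ler_pdivrMl// -Lw.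
  rewrite /L; apply: limr_le.
    by apply/cvg_ex; exists (L w); exact: L_cvg.
  apply: nearW => i; apply: (le_trans (ler_norm _)).
  have w1 : (modular mu M (fun x => w x / 1)%R <= (\int[mu]_x M (w x))%:E)%E.
    under eq_fun do rewrite divr1.
    by rewrite modularE//; exact: (small_support_modular theta01 itheta).
  have [iAw] := orlicz_holder (conjugate_pairC MN) (mA i) mw k0 ltr01 (AC i) w1.
  rewrite mulr1; apply: le_trans; exact: le_normr_Rintegral.
exists h; split => // w mw Ew.
have ihw (v : T -> R) : measurable_fun setT v -> orliczE mu M v ->
    mu.-integrable setT (EFin \o (fun x => h x * v x)).
  move=> mv Ev; apply: (orliczLE_integrable (conjugate_pairC MN)) => //.
    split; first by exists h => //; exact: aeW.
    by exists k => //; apply: (le_lt_trans hC); exact: ltry.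
  exact: orliczE_L.
suff <- : L w = \int[mu]_x (h x * w x) by exact: L_cvg.
apply/eqP; rewrite -subr_eq0 -normr_le0; apply/ler_addgt0Pr => e e0; rewrite add0r.
have e20 : 0 < e / 2 by rewrite divr_gt0.
(* For general [w] in E_M the remainders of the truncations are negligible for [L] by [L_order], and
   for [h] by [holder_tail], because [h] satisfies the same modular bound as the [A i]. *)
pose t n x := w x - trunc theta w n x.
have mt n : measurable_fun setT (trunc theta w n) by exact: measurable_trunc.
have mwt n : measurable_fun setT (t n) by exact: measurable_funB.
have tle n x : `|t n x| <= `|w x|.
  rewrite /t /trunc indicE; case: (_ \in _); rewrite ?mulr1 ?mulr0 ?subrr ?subr0//.
  by rewrite normr0.
have t0 x : t n x @[n --> \oo] --> 0.
  rewrite -(subrr (w x)); apply: cvgB; first exact: cvg_cst.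
  exact: trunc_cvg.
have H1 := L_order e20 mwt mw Ew tle t0.
have H2 := holder_tail MN k0 C0 e20 mwt mw Ew tle t0.
near \oo => n.
have tS : small (trunc theta w n) by exact: small_support_trunc.
have [_ LT] := Lsmall _ tS.
have ET := small_support_orliczE theta01 itheta eM tS.
have i1 := ihw _ mw Ew; have i2 := ihw _ (mt n) ET.
have htE : (fun x => h x * t n x) = (fun x => h x * w x - h x * trunc theta w n x).
  by apply/funext => x; rewrite mulrBr.
have -> : L w - \int[mu]_x (h x * w x) = L (t n) - \int[mu]_x (h x * t n x).
  have -> : L (t n) = L w + (-1) * L (trunc theta w n).
    by rewrite -LD//; congr L; apply/funext => x; rewrite mulN1r.
  by rewrite htE RintegralB// LT; ring.
rewrite (le_trans (ler_normB _ _))// [leRHS]splitr lerD//; first by near: n.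
apply: (@le_trans _ _ (\int[mu]_x `|h x * t n x|)).
  by apply: le_normr_Rintegral => //; rewrite htE; exact: integrable_EFinB.
have : forall A : T -> R, measurable_fun setT A -> (modular mu N (fun x => A x / k)%R <= C%:E)%E ->
    \int[mu]_x `|A x * t n x| <= e / 2 by near: n.
exact.
Unshelve. all: by end_near. Qed.

End weak_limit.

(** * The monotonicity argument *)

Section limsup_bound.
Context {R : realType}.

Lemma limn_esup_near (x : nat -> R) (l e : R) : 0 < e ->
  (limn_esup (fun i => (x i)%:E) <= l%:E)%E -> \forall i \near \oo, x i <= l + e.
Proof.
move=> e0 xl; have : (limn_esup (fun i => (x i)%:E) < (l + e)%:E)%E.
  by apply: (le_lt_trans xl); rewrite lte_fin ltrDl.
rewrite /limn_esup /limf_esup => /ereal_inf_lt[_ [B B1 <-] Bl].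
apply: filterS B1 => i Bi; rewrite -lee_fin; apply: le_trans (ltW Bl).
by apply: ereal_sup_ubound; exists i.
Qed.

End limsup_bound.

Section minty.
Context d (T : measurableType d) (R : realType).
Variable mu : {sigma_finite_measure set T -> \bar R}.
Variable theta : T -> R.
Hypothesis mtheta : measurable_fun setT theta.
Hypothesis theta01 : forall x, 0 < theta x <= 1.
Hypothesis itheta : mu.-integrable setT (EFin \o theta).
Local Notation small := (small_support theta).
Variables (M N : R -> R).
Hypothesis MN : conjugate_pair M N.
Let eM : even_convex M. Proof. by case: MN. Qed.
Let eN : even_convex N. Proof. by case: MN. Qed.

Variables (a : T -> R -> R) (dd : T -> R) (b c m0 : R) (I : R -> R).
Hypothesis acont : forall p, continuous (a p).
Hypothesis a0 : forall p, a p 0 = 0.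
Hypothesis amono : forall p x y, 0 <= (a p x - a p y) * (x - y).
Hypothesis ameas : forall w : T -> R, measurable_fun setT w ->
  measurable_fun setT (fun p => a p (w p)).
Hypothesis mdd : measurable_fun setT dd.
Hypothesis Edd : orliczE mu N dd.
Hypothesis b0 : 0 < b.
Hypothesis c0 : 0 < c.
Hypothesis IP : forall r, 0 <= r -> [/\ 0 <= I r, N (I r) <= r & I r <= r + m0].
Hypothesis agrowth : forall p xi, `|a p xi| <= dd p + b * I (M (c * xi)).

Let lam := 2 * b.
Let lam0 : 0 < lam. Proof. by rewrite mulr_gt0. Qed.

(** Division by [lam = 2 * b] makes the midpoint inequality return exactly [I (M (c * xi))], whose
    image under [N] is at most [M (c * xi)]. The two factors [1 / 2] are discarded. *)
Lemma flux_young p xi : N (a p xi / lam) <= N (2 / lam * dd p) + M (c * xi).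
Proof.
have M0 := even_convex_ge0 eM (c * xi); have [I0 NI _] := IP M0.
apply: (@le_trans _ _ (N (dd p / lam + b * I (M (c * xi)) / lam))).
  apply: even_convex_mono => //; rewrite normrM (gtr0_norm (_ : 0 < lam^-1)) ?invr_gt0//.
  rewrite -mulrDl normrM (gtr0_norm (_ : 0 < lam^-1)) ?invr_gt0// ler_wpM2r ?invr_ge0 ?(ltW lam0)//.
  exact: (le_trans (agrowth p xi) (ler_norm _)).
apply: (le_trans (even_convex_midpoint eN _ _)).
have -> : 2 * (b * I (M (c * xi)) / lam) = I (M (c * xi)).
  by rewrite /lam; field; rewrite gt_eqF.
have -> : 2 * (dd p / lam) = 2 / lam * dd p by rewrite mulrA mulrAC.
have := even_convex_ge0 eN (2 / lam * dd p); have := even_convex_ge0 eN (I (M (c * xi))).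
lra.
Qed.

(** Where [theta] is below the level of [w], both [w] and its flux vanish; elsewhere the flux is at
    most [|dd|] plus a constant. Membership in E_N, and not merely in L_N, allows testing the weak
    convergence of [U] against this flux. *)
Lemma flux_orliczE w : small w -> orliczE mu N (fun p => a p (w p)).
Proof.
move=> wS; have [mw [j wj]] := wS.
pose B := b * (M (c * j%:R) + m0).
have m00 : 0 <= M (c * j%:R) + m0.
  by have [I0 _ /(le_trans I0)] := IP (even_convex_ge0 eM (c * j%:R)).
have B0 : 0 <= B by rewrite mulr_ge0// ltW.
pose S := [set p | j.+1%:R^-1 <= theta p].
have mS : measurable S by apply: measurable_set_ler.
pose e p := B * \1_S p.
have eS : small e.
  split; first exact: measurable_funM.
  exists (maxn j (Num.bound B)) => p; rewrite /e indicE; case: (boolP (p \in S)).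
    rewrite inE /S/= mulr1 => tp; split.
      rewrite (ger0_norm B0) (le_trans (ltW (archi_boundP B0)))//.
      by rewrite ler_nat leq_maxr.
    move=> tx; move: tp; rewrite leNgt => /negP[]; apply: (lt_le_trans tx).
    by rewrite lef_pV2 ?posrE// ler_nat ltnS leq_maxl.
  by move=> _; rewrite mulr0 normr0.
have ae p : `|a p (w p)| <= `|dd p| + e p.
  have [w1 w2] := wj p; have [tp|tp] := ltP (theta p) j.+1%:R^-1.
    by rewrite w2// a0 normr0 addr_ge0// mulr_ge0.
  rewrite /e indicE mem_set// mulr1 (le_trans (agrowth _ _))// lerD ?ler_norm//.
  have [_ _ Ile] := IP (even_convex_ge0 eM (c * w p)).
  rewrite ler_pM2l// (le_trans Ile)// lerD2r; apply: even_convex_mono => //.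
  by rewrite !normrM ler_wpM2l// (le_trans w1)// ler_norm.
apply: scale_orliczE; first exact: ameas.
move=> r; have mnd : measurable_fun setT (fun p => `|dd p|) by exact: measurableT_comp.
have me : measurable_fun setT e by case: eS.
apply: (@le_lt_trans _ _ (modular mu N (fun p => r * `|dd p| + r * e p))).
  apply: le_modular => //.
  - by apply: measurable_funM => //; exact: ameas.
  - by apply: measurable_funD; exact: measurable_funM.
  - move=> p; rewrite -mulrDr !normrM ler_wpM2l// (le_trans (ae p))// ler_norm//.
apply: modularD_lty => //; [exact: measurable_funM|exact: measurable_funM| |].
  have := orliczE_scale eN Edd (2 * r); apply: le_lt_trans.
  apply: le_modular => //; [by do 2 apply: measurable_funM => //|exact: measurable_funM|].
  by move=> p; rewrite mulrA !normrM normr_id.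
by have := small_support_modular theta01 itheta eN (small_supportZ 2 (small_supportZ r eS)).
Qed.

Variables (U : nat -> T -> R) (u : T -> R) (l : R).
Hypothesis mU : forall i, measurable_fun setT (U i).
Hypothesis LU : forall i, orliczL mu M (U i).
Hypothesis LA : forall i, orliczL mu N (fun p => a p (U i p)).
Hypothesis mu' : measurable_fun setT u.
Hypothesis Lu : orliczL mu M u.
Hypothesis weakU : forall g : T -> R, measurable_fun setT g -> orliczE mu N g ->
  \int[mu]_p (U i p * g p) @[i --> \oo] --> \int[mu]_p (u p * g p).
Let A i p := a p (U i p).
Hypothesis supA : (limn_esup (fun i => (\int[mu]_p (A i p * U i p))%:E) <= l%:E)%E.
(** The only point where the abstract setting sees the Sobolev space: every ultrafilter limit of the
    fluxes has the same energy [l] against [u]. In the application this is the annihilation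
    result. *)
Hypothesis limA : forall (F : set_system nat) (h : T -> R), UltraFilter F -> \oo `<=` F ->
  measurable_fun setT h -> orliczL mu N h ->
  (forall w : T -> R, measurable_fun setT w -> orliczE mu M w ->
    \int[mu]_p (A i p * w p) @[i --> F] --> \int[mu]_p (h p * w p)) ->
  \int[mu]_p (h p * u p) = l.

Let mA i : measurable_fun setT (A i). Proof. exact: ameas. Qed.
Let NM := conjugate_pairC MN.

Let intAU i : mu.-integrable setT (EFin \o (fun p => A i p * U i p)).
Proof. exact: (orliczLE_integrable NM (mA i) (mU i) (LA i) (LU i)). Qed.

Let smallE w : small w -> orliczE mu M w.
Proof. exact: (small_support_orliczE theta01 itheta). Qed.

Let int_pair (f g : T -> R) : measurable_fun setT f -> measurable_fun setT g ->
  orliczL mu N f -> orliczL mu M g -> mu.-integrable setT (EFin \o (fun p => f p * g p)).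
Proof. by move=> *; exact: (orliczLE_integrable NM). Qed.

(* This is [0 <= (a V - a w) (V - w)], integrated. *)
Let monotone_int (V w : T -> R) : measurable_fun setT V -> orliczL mu M V ->
  orliczL mu N (fun p => a p (V p)) -> small w ->
  0 <= \int[mu]_p (a p (V p) * V p) - \int[mu]_p (a p (V p) * w p) -
    \int[mu]_p (V p * a p (w p)) + \int[mu]_p (a p (w p) * w p).
Proof.
move=> mV LV LaV wS; have [mw _] := wS.
have Lw := orliczE_L (smallE wS); have Law := orliczE_L (flux_orliczE wS).
have i1 := int_pair (ameas mV) mV LaV LV.
have i2 := int_pair (ameas mV) mw LaV Lw.
have i3 : mu.-integrable setT (EFin \o (fun p => V p * a p (w p))).
  by rewrite (_ : (fun _ => _) = (fun p => a p (w p) * V p)) ?int_pair//;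
    [exact: ameas|apply/funext => p; rewrite mulrC].
have i4 := int_pair (ameas mw) mw Law Lw.
rewrite -RintegralB// -RintegralB//; last exact: integrable_EFinB.
rewrite -RintegralD//; last by apply: integrable_EFinB => //; exact: integrable_EFinB.
apply: Rintegral_ge0 => p _; apply: (le_trans (amono p (V p) (w p))).
by rewrite le_eqVlt; apply/orP; left; apply/eqP; ring.
Qed.

(** Monotonicity turns an upper bound on the energy of [U i] into an upper bound on [int A i * w]
    for every small [w], with a right-hand side linear in the modular of the test function;
    [modular_dual] then applies. Only large [i] are covered, because the limsup controls the
    energies only eventually. *)
Let flux_bound : exists k C : R, [/\ 0 < k, 0 <= C &
  \forall i \near \oo, (modular mu N (fun p => A i p / k)%R <= C%:E)%E].
Proof.
have [K K0 UK] : exists2 K : R, 0 < K &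
    forall i, (modular mu M (fun x => U i x / K)%R <= 1%:E)%E.
  apply: (weakly_bounded_modular mtheta theta01 itheta MN mU LU) => g mg Eg.
  have /cvg_seq_bounded := cvgP _ (weakU mg Eg).
  move=> [B [_ /(_ (B + 1))]]; rewrite ltrDl ltr01 => /(_ isT) H.
  by exists (B + 1) => i; exact: H.
have [mD iD] : (modular mu N (fun p => (2 / lam * dd p)%R) < +oo)%E /\
    mu.-integrable setT (EFin \o (fun p => N (2 / lam * dd p))).
  have H := orliczE_scale eN Edd (2 / lam); split => //.
  by apply: modular_integrable => //; exact: measurable_funM.
pose D := \int[mu]_p N (2 / lam * dd p).
have D0 : 0 <= D by apply: Rintegral_ge0 => p _; exact: even_convex_ge0.
(* Read off from the last estimate of this proof: [C2] is the coefficient of the modular [m] of the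
   test function and [C1] is the rest, so that division by [C2] leaves [C1 / C2 + m]. *)
pose C2 := c * lam * K + 2 * lam.
pose C1 := `|c * (l + 1)| + c * lam * K * (D + 1) + lam * D.
have C20 : 0 < C2 by rewrite addr_gt0 ?mulr_gt0.
have C10 : 0 <= C1.
  have [c0' lam0' K0'] := And3 (ltW c0) (ltW lam0) (ltW K0).
  apply: addr_ge0; last exact: mulr_ge0.
  apply: addr_ge0 => //; apply: mulr_ge0; last exact: addr_ge0.
  by apply: mulr_ge0 => //; exact: mulr_ge0.
exists C2, (C1 / C2); split => //; first by rewrite divr_ge0// ltW.
have := limn_esup_near ltr01 supA; apply: filterS => i Ai.
apply: (modular_dual mtheta theta01 itheta NM); first exact: measurable_funM.
move=> W WS; have [mW _] := WS.
(* Scaling by [1 / c] absorbs the constant of the growth bound: [flux_young] then controls the flux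
   of [w] by the modular of [W] itself. *)
pose w p := c^-1 * W p; have wS : small w by exact: small_supportZ.
have [mw _] := wS.
have cw p : c * w p = W p by rewrite /w mulrA divff ?mul1r// gt_eqF.
have Lw := orliczE_L (smallE wS); have Law := orliczE_L (flux_orliczE wS).
pose m := \int[mu]_p M (W p).
have mWf := small_support_modular theta01 itheta eM WS.
have Waw : (modular mu N (fun p => a p (w p) / lam)%R <= (D + m)%:E)%E.
  have iW := modular_integrable eM mW mWf.
  rewrite EFinD /D /m !Rintegral_EFin//.
  rewrite -ge0_integralD//=; last 4 first.
  - by move=> p _; rewrite lee_fin even_convex_ge0.
  - by case/integrableP: iD.
  - by move=> p _; rewrite lee_fin even_convex_ge0.
  - by case/integrableP: iW.
  apply: ge0_le_integral => //.
  - by move=> p _; rewrite lee_fin even_convex_ge0.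
  - apply/measurable_EFinP/even_convex_comp => //; apply: measurable_funM => //; exact: ameas.
  - by apply: emeasurable_funD; [case/integrableP: iD|case/integrableP: iW].
  - by move=> p _; rewrite -EFinD lee_fin -cw flux_young.
have [i1 H1] := orlicz_holder NM (ameas mw) (mU i) lam0 K0 Waw (UK i).
have wM : (modular mu M (fun p => w p / c^-1)%R <= m%:E)%E.
  by under eq_fun do rewrite invrK mulrC cw; rewrite modularE.
have [|i2 H2] := orlicz_holder NM (ameas mw) mw lam0 (_ : 0 < c^-1) Waw wM.
  by rewrite invr_gt0.
have i2' := int_pair (mA i) mw (LA i) Lw.
have H := monotone_int (mU i) (LU i) (LA i) wS.
have e1 : \int[mu]_p (A i p / C2 * W p) = C2^-1 * c * \int[mu]_p (A i p * w p).
  rewrite -RintegralZl//; apply: eq_Rintegral => p _.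
  by rewrite -cw; ring.
rewrite e1 -mulrA ler_pdivrMl// mulrDr mulrCA divff ?gt_eqF// mulr1.
have m00 : 0 <= m by apply: Rintegral_ge0 => p _; exact: even_convex_ge0.
have H3 : \int[mu]_p (A i p * w p) <= (l + 1) + lam * K * (D + m + 1) + lam / c * (D + m + m).
  have n1 : - (\int[mu]_p (U i p * a p (w p))) <= lam * K * (D + m + 1).
    apply: le_trans H1; rewrite (le_trans (ler_norm _))// normrN.
    have -> : \int[mu]_p (U i p * a p (w p)) = \int[mu]_p (a p (w p) * U i p).
      by apply: eq_Rintegral => p _; rewrite mulrC.
    exact: le_normr_Rintegral.
  have n2 : \int[mu]_p (a p (w p) * w p) <= lam / c * (D + m + m).
    by apply: le_trans H2; rewrite (le_trans (ler_norm _))// le_normr_Rintegral.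
  by move: H Ai; rewrite /A; lra.
have -> : C1 + C2 * m = `|c * (l + 1)| + c * (lam * K * (D + m + 1)) + lam * (D + m + m).
  by rewrite /C1 /C2; ring.
apply: (@le_trans _ _ (c * (l + 1 + lam * K * (D + m + 1) + lam / c * (D + m + m)))).
  by rewrite ler_pM2l.
have -> : c * (l + 1 + lam * K * (D + m + 1) + lam / c * (D + m + m)) =
    c * (l + 1) + c * (lam * K * (D + m + 1)) + lam * (D + m + m).
  by field; rewrite gt_eqF.
by rewrite !lerD2r ler_norm.
Qed.

Let flux_limit (F : set_system nat) : UltraFilter F -> \oo `<=` F ->
  exists h : T -> R, [/\ measurable_fun setT h, orliczL mu N h,
    forall w : T -> R, measurable_fun setT w -> orliczE mu M w ->
      \int[mu]_p (A i p * w p) @[i --> F] --> \int[mu]_p (h p * w p) &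
    \int[mu]_p (h p * u p) = l].
Proof.
move=> UF oF; have [k [C [k0 C0 AC]]] := flux_bound.
(* Indices that violate the bound are excluded from a tail of the sequence; there the flux is
   replaced by 0, a change invisible to a filter finer than [\oo]. *)
pose A' i p := if `[< (modular mu N (fun p => A i p / k)%R <= C%:E)%E >] then A i p else 0.
have mA' i : measurable_fun setT (A' i).
  by rewrite /A'; case: asboolP => _; [exact: mA|exact: measurable_cst].
have A'C i : (modular mu N (fun p => A' i p / k)%R <= C%:E)%E.
  rewrite /A'; case: asboolP => [//|_].
  rewrite /modular (eq_integral (fun=> 0%E)) ?integral0 ?lee_fin// => p _.
  by rewrite mul0r; have [-> _ _] := eN.
have [h [mh hC hlim]] := weak_limit_exists mtheta theta01 itheta MN k0 C0 mA' A'C UF.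
have Lh : orliczL mu N h.
  split; first by exists h => //; exact: aeW.
  by exists k => //; apply: (le_lt_trans hC); exact: ltry.
have hA w : measurable_fun setT w -> orliczE mu M w ->
    \int[mu]_p (A i p * w p) @[i --> F] --> \int[mu]_p (h p * w p).
  move=> mw Ew; have := hlim w mw Ew; apply: cvg_trans; apply: near_eq_cvg.
  have : F [set i | (modular mu N (fun p => (A i p / k)%R) <= C%:E)%E] by exact: oF.
  apply: filterS => i Hi; apply: eq_Rintegral => p _.
  by rewrite /A'; case: asboolP.
by exists h; split => //; exact: (limA UF oF).
Qed.

Let trunc_int_cvg (f : T -> R) : mu.-integrable setT (EFin \o (fun p => f p * u p)) ->
  measurable_fun setT f ->
  \int[mu]_p (f p * trunc theta u j p) @[j --> \oo] --> \int[mu]_p (f p * u p).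
Proof.
move=> ifu mf.
apply: (proj2 (Rintegral_dominated_cvg _ _ (integrable_norm ifu) _)) => [j|p|j p].
- by apply: measurable_funM => //; exact: measurable_trunc.
- by apply: cvgM; [exact: cvg_cst|exact: trunc_cvg].
- by rewrite /= normrM [leRHS]normrM ler_wpM2l// trunc_le.
Qed.

(** The test function is [u] truncated at level [j] plus [t * psi], with [psi] supported in a fixed
    core of level [k <= j]. As [j] grows, [l - int h * trunc theta u j] tends to 0 and leaves an
    inequality about the core only. Then [t] tends to 0, and [psi] carries the sign of the
    difference to be annihilated. *)
Let flux_ae_limit (h : T -> R) : measurable_fun setT h -> orliczL mu N h ->
  (forall w, small w -> 0 <= l - \int[mu]_p (h p * w p) -
     \int[mu]_p (u p * a p (w p)) + \int[mu]_p (a p (w p) * w p)) ->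
  \int[mu]_p (h p * u p) = l ->
  {ae mu, forall p, h p = a p (u p)}.
Proof.
move=> mh Lh H hl.
have ihu := int_pair mh mu' Lh Lu.
have mt j : measurable_fun setT (trunc theta u j) by exact: measurable_trunc.
have mc j : measurable (core theta u j) by exact: measurable_core.
(* Minty's trick on [core u k]. *)
have step k (phi : T -> R) (t : R) : measurable_fun setT phi -> (forall p, `|phi p| <= 1) ->
    0 < t -> \int[mu]_p ((h p - a p (trunc theta u k p + t * (phi p * \1_(core theta u k) p)))
      * (phi p * \1_(core theta u k) p)) <= 0.
  move=> mphi phi1 t0; set psi := fun p => phi p * \1_(core theta u k) p.
  have mpsi : measurable_fun setT psi by exact: measurable_funM.
  have psiS : small psi.
    split => //; exists k.+1 => p; rewrite /psi indicE; case: (boolP (_ \in _)) => [|_].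
      rewrite inE mulr1 => -[_ tk]; split; first by rewrite (le_trans (phi1 p))// ler1n.
      move=> tx; move: tk; rewrite leNgt => /negP[]; apply: (lt_le_trans tx).
      by rewrite lef_pV2 ?posrE// ler_nat.
    by rewrite mulr0 normr0.
  have wS j : small (fun p => trunc theta u j p + t * psi p).
    by apply: small_supportD; [exact: small_support_trunc|exact: small_supportZ].
  have mw j : measurable_fun setT (fun p => trunc theta u j p + t * psi p) by case: (wS j).
  have Law j := orliczE_L (flux_orliczE (wS j)).
  have Lpsi := orliczE_L (smallE psiS).
  have ihp := int_pair mh mpsi Lh Lpsi.
  have iap := int_pair (ameas (mw k)) mpsi (Law k) Lpsi.
  rewrite (_ : (fun _ => _) = (fun p => h p * psi p - a p (trunc theta u k p + t * psi p) * psi p));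
    last by apply/funext => p; rewrite mulrBl.
  rewrite RintegralB//.
  have main j : (k <= j)%N -> t * (\int[mu]_p (h p * psi p) -
      \int[mu]_p (a p (trunc theta u k p + t * psi p) * psi p)) <=
      l - \int[mu]_p (h p * trunc theta u j p).
    move=> kj; have := H _ (wS j).
    have iht := int_pair mh (mt j) Lh (orliczE_L (smallE (small_support_trunc mtheta j mu'))).
    have -> : \int[mu]_p (h p * (trunc theta u j p + t * psi p)) =
        \int[mu]_p (h p * trunc theta u j p) + t * \int[mu]_p (h p * psi p).
      rewrite -RintegralZl// -RintegralD//; last exact: integrable_EFinZ.
      by apply: eq_Rintegral => p _ /=; ring.
    (* On the core of level [k] both truncations equal [u]. Off it the perturbation vanishes, and
       the truncation is [u] or 0, the flux at 0 being 0. Hence the integral of [u] times the flux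
       cancels against the third term of [H], which leaves only the perturbation. *)
    have e1 p : a p (trunc theta u j p + t * psi p) * (trunc theta u j p + t * psi p) =
        u p * a p (trunc theta u j p + t * psi p) +
        t * (a p (trunc theta u k p + t * psi p) * psi p).
      have [pk|pk] := pselect (core theta u k p).
        have pj : core theta u j p by move/subsetPset : (core_nd theta u kj); exact.
        have -> : trunc theta u k p = u p by rewrite /trunc indicE mem_set// mulr1.
        have -> : trunc theta u j p = u p by rewrite /trunc indicE mem_set// mulr1.
        by ring.
      have -> : psi p = 0 by rewrite /psi indicE memNset// mulr0.
      rewrite !mulr0 !addr0 /trunc indicE.
      case: (_ \in _); first by rewrite mulr1 mulrC.
      by rewrite mulr0 a0 !mulr0.
    have -> : \int[mu]_p (a p (trunc theta u j p + t * psi p) * (trunc theta u j p + t * psi p)) =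
        \int[mu]_p (u p * a p (trunc theta u j p + t * psi p)) +
        t * \int[mu]_p (a p (trunc theta u k p + t * psi p) * psi p).
      rewrite -RintegralZl// -RintegralD//; last exact: integrable_EFinZ.
        by apply: eq_Rintegral => p _; rewrite e1.
      by rewrite (_ : (fun _ => _) = (fun p => a p (trunc theta u j p + t * psi p) * u p));
        [apply: int_pair => //; exact: ameas|apply/funext => p; rewrite mulrC].
    by lra.
  rewrite -(pmulr_rle0 _ t0).
  have cv := trunc_int_cvg ihu mh; rewrite hl in cv.
  have cv' : (l - \int[mu]_p (h p * trunc theta u j p)) @[j --> \oo] --> 0.
    by rewrite -(subrr l); apply: cvgB => //; exact: cvg_cst.
  rewrite -(cvg_lim _ cv')//; apply: limr_ge; first by apply/cvg_ex; exists 0.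
  by exists k => // j /= kj; exact: main.
have core0 k : mu.-negligible [set p | core theta u k p /\ h p != a p (u p)].
  pose g p := h p - a p (trunc theta u k p).
  have mat := ameas (mt k).
  have mg : measurable_fun setT g by exact: measurable_funB.
  pose phi p := Num.sg (g p).
  have mphi : measurable_fun setT phi.
    rewrite (_ : phi = (fun p => \1_[set p | 0 < g p] p - \1_[set p | g p < 0] p)).
      by apply: measurable_funB; apply: measurable_indic; exact: measurable_set_ltr.
    apply/funext => p; rewrite /phi !indicE; case: (ltgtP (g p) 0) => gp.
    - by rewrite memNset ?mem_set ?ltr0_sg ?sub0r//= => /ltW; rewrite leNgt gp.
    - by rewrite mem_set// memNset ?gtr0_sg ?subr0//= => /ltW; rewrite leNgt gp.
    - by rewrite gp sgr0 !memNset ?subr0//=; rewrite gp ltxx.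
  have phi1 p : `|phi p| <= 1 by rewrite /phi normr_sg; case: eqP.
  pose psi p := phi p * \1_(core theta u k) p.
  have mpsi : measurable_fun setT psi by exact: measurable_funM.
  pose w n p := trunc theta u k p + n.+1%:R^-1 * psi p.
  have mw n : measurable_fun setT (w n) by apply: measurable_funD => //; exact: measurable_funM.
  have gpsi p : g p * psi p = `|g p| * \1_(core theta u k) p.
    by rewrite /psi mulrA /phi mulrC [in LHS]mulrC normrEsg [in RHS]mulrC [Num.sg _ * _]mulrC; ring.
  (* Dominates the integrands for all step sizes [1 / (n + 1) <= 1]: on the core the argument of [a]
     has absolute value at most [k + 1]. *)
  pose Z p := (`|h p| + (`|dd p| + b * (M (c * k.+1%:R) + m0))) * \1_(core theta u k) p.
  have mI : measurable_fun setT (\1_(core theta u k) : T -> R) by exact: measurable_indic.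
  have IS : small (\1_(core theta u k)).
    split; first by exact: measurable_indic.
    exists k.+1 => p; rewrite indicE; case: (boolP (_ \in _)) => [|_]; last by rewrite normr0.
    rewrite inE => -[_ tk]; split; first by rewrite normr1 ler1n.
    move=> tx; move: tk; rewrite leNgt => /negP[]; apply: (lt_le_trans tx).
    by rewrite lef_pV2 ?posrE// ler_nat.
  have iZ : mu.-integrable setT (EFin \o Z).
    have LI := orliczE_L (smallE IS).
    have ih := int_pair mh mI Lh LI.
    have id := int_pair mdd mI (orliczE_L Edd) LI.
    have i1 := small_support_integrable theta01 itheta IS.
    have := integrable_EFinD (integrable_norm ih) (integrable_EFinD (integrable_norm id)
      (integrable_EFinZ (b * (M (c * k.+1%:R) + m0)) i1)).
    congr (_.-integrable _ _); apply/funext => p /=; rewrite /Z !normrM; congr EFin.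
    by rewrite [`|\1__ _|]ger0_norm ?mulrDl.
  have wk n p : core theta u k p -> `|w n p| <= k.+1%:R.
    move=> pk; rewrite /w /psi /trunc indicE mem_set// !mulr1 (le_trans (ler_normD _ _))//.
    rewrite (@le_trans _ _ (k%:R + 1))//; last by rewrite -natr1.
    rewrite lerD//; first by case: pk.
    rewrite normrM ger0_norm ?invr_ge0// mulr_ile1 ?invr_ge0//.
    by rewrite invf_le1 ?ltr0n// ler1n.
  have bnd p xi : `|xi| <= k.+1%:R -> `|a p xi| <= `|dd p| + b * (M (c * k.+1%:R) + m0).
    move=> xik; rewrite (le_trans (agrowth _ _))// lerD ?ler_norm// ler_pM2l//.
    have [_ _ /le_trans->//] := IP (even_convex_ge0 eM (c * xi)).
    rewrite lerD2r; apply: even_convex_mono => //; rewrite !normrM ler_wpM2l//.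
    by rewrite [leRHS]ger0_norm.
  have [igp cvI] : mu.-integrable setT (EFin \o (fun p => g p * psi p)) /\
      (\int[mu]_p ((h p - a p (w n p)) * psi p)) @[n --> \oo] --> \int[mu]_p (g p * psi p).
    apply: (Rintegral_dominated_cvg _ _ iZ _) => [n|p|n p].
    - by apply: measurable_funM => //; apply: measurable_funB => //; exact: ameas.
    - apply: cvgM; last exact: cvg_cst.
      apply: cvgB; first exact: cvg_cst.
      apply: continuous_cvg; first exact: acont.
      rewrite /w -[X in _ --> X]addr0; apply: cvgD; first exact: cvg_cst.
      by rewrite -(mul0r (psi p)); apply: cvgM; [exact: cvg_harmonic|exact: cvg_cst].
    - rewrite /Z /psi indicE; case: (boolP (p \in _)) => pk; last by rewrite !mulr0 normr0.
      rewrite inE in pk; rewrite !mulr1 normrM (le_trans (ler_piMr _ (phi1 p)))//.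
      by rewrite (le_trans (ler_normB _ _))// lerD2l bnd// wk.
  have int0 : \int[mu]_p (g p * psi p) <= 0.
    rewrite -(cvg_lim _ cvI)//; apply: limr_le; first by apply/cvg_ex; eexists; exact: cvI.
    by apply: nearW => n; apply: step.
  have gpsi0 p : 0 <= g p * psi p by rewrite gpsi mulr_ge0.
  have mgp : measurable_fun setT (fun p => g p * psi p) by exact: measurable_funM.
  have eint : (\int[mu]_p `|(g p * psi p)%:E| = 0)%E.
    under eq_integral do rewrite gee0_abs ?lee_fin//.
    rewrite -Rintegral_EFin//; congr EFin; apply/eqP; rewrite eq_le int0/=.
    exact: Rintegral_ge0.
  have : ae_eq mu setT (fun p => (g p * psi p)%:E) (cst 0%E).
    by apply/(ae_eq_integral_abs mu measurableT) => //; exact/measurable_EFinP.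
  apply: negligibleS => p /= [pk hp] K; move: hp => /eqP; apply.
  have [] := K Logic.I; rewrite gpsi indicE mem_set// mulr1 => /eqP.
  by rewrite normr_eq0 subr_eq0 /trunc indicE mem_set// mulr1 => /eqP.
apply: (negligibleS _ (negligible_bigcup core0)) => p /= hp.
have [k _ /(_ k (leqnn k)) pk] := near_core theta01 u p.
by exists k => //; split => //; exact/eqP.
Qed.

(** Monotonicity is tested with a truncation [w] of [u]. Pointwise [u * a w = a w * w], so two of
    the three limits cancel and the energies are at least [int h * w - e / 2] along [F]; the level
    of truncation brings [int h * w] within [e / 2] of [l]. *)
Let energy_ge (F : set_system nat) (e : R) : UltraFilter F -> \oo `<=` F -> 0 < e ->
  F [set i | l - e <= \int[mu]_p (A i p * U i p)].
Proof.
move=> UF oF e0; have [h [mh Lh hA hl]] := flux_limit UF oF.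
have FF : ProperFilter F by exact: ultra_proper.
have ihu := int_pair mh mu' Lh Lu.
have := trunc_int_cvg ihu mh; rewrite hl => /cvgrPdist_le /(_ (e / 2)).
rewrite divr_gt0// => /(_ isT)[j _ /(_ j (leqnn j))]; rewrite /= => hj.
have wS : small (trunc theta u j) by exact: small_support_trunc.
have [mw _] := wS; have Ew := smallE wS; have Eaw := flux_orliczE wS.
pose x i := \int[mu]_p (A i p * trunc theta u j p) + \int[mu]_p (U i p * a p (trunc theta u j p))
  - \int[mu]_p (a p (trunc theta u j p) * trunc theta u j p).
have xlim : x i @[i --> F] --> \int[mu]_p (h p * trunc theta u j p).
  have -> : \int[mu]_p (h p * trunc theta u j p) = \int[mu]_p (h p * trunc theta u j p) +
      \int[mu]_p (u p * a p (trunc theta u j p)) - \int[mu]_p (a p (trunc theta u j p) * trunc theta u j p).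
    rewrite -addrA; have -> : \int[mu]_p (u p * a p (trunc theta u j p)) =
        \int[mu]_p (a p (trunc theta u j p) * trunc theta u j p).
      apply: eq_Rintegral => p _; rewrite /trunc indicE; case: (_ \in _).
        by rewrite mulr1 mulrC.
      by rewrite mulr0 a0 !mulr0.
    by rewrite subrr addr0.
  apply: cvgB; last exact: cvg_cst.
  apply: cvgD; first exact: hA.
  apply: (cvg_trans _ (weakU (ameas mw) Eaw)).
  by move=> V; exact: oF.
have xi : F [set i | l - e <= x i].
  move/cvgrPdist_le : xlim => /(_ (e / 2)); rewrite divr_gt0// => /(_ isT).
  by apply: filterS => i /=; move: hj; rewrite !ler_norml; lra.
apply: filterS xi => i /= /le_trans; apply.
by have := monotone_int (mU i) (LU i) (LA i) wS; rewrite /x /A; lra.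
Qed.

Theorem minty_limit : [/\ orliczL mu N (fun p => a p (u p)),
  exists F : set_system nat, [/\ UltraFilter F, \oo `<=` F &
    forall w : T -> R, measurable_fun setT w -> orliczE mu M w ->
    \int[mu]_p (A i p * w p) @[i --> F] --> \int[mu]_p (a p (u p) * w p)] &
  \int[mu]_p (A i p * U i p) @[i --> \oo] --> l].
Proof.
have [F [UF oF]] := ultraFilterLemma (@eventually_filter : ProperFilter \oo).
have FF : ProperFilter F by exact: ultra_proper.
have [h [mh Lh hA hl]] := flux_limit UF oF.
have [Z [mZ Z0 hZ]] : {ae mu, forall p, h p = a p (u p)}.
  apply: flux_ae_limit => // w wS; have [mw _] := wS.
  apply/ler_addgt0Pl => e e0.
  have Ew := smallE wS; have Eaw := flux_orliczE wS.
  have := limn_esup_near e0 supA => /oF Fe.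
  pose x i := l + e - \int[mu]_p (A i p * w p) - \int[mu]_p (U i p * a p (w p)) +
    \int[mu]_p (a p (w p) * w p).
  have xlim : x i @[i --> F] --> l + e - \int[mu]_p (h p * w p) -
      \int[mu]_p (u p * a p (w p)) + \int[mu]_p (a p (w p) * w p).
    apply: cvgD; last exact: cvg_cst.
    apply: cvgB; first by apply: cvgB; [exact: cvg_cst|exact: hA].
    apply: (cvg_trans _ (weakU (ameas mw) Eaw)).
    by move=> V; exact: oF.
  have -> : e + (l - \int[mu]_p (h p * w p) - \int[mu]_p (u p * a p (w p)) +
      \int[mu]_p (a p (w p) * w p)) = l + e - \int[mu]_p (h p * w p) -
      \int[mu]_p (u p * a p (w p)) + \int[mu]_p (a p (w p) * w p) by ring.
  rewrite -(cvg_lim _ xlim)//; apply: limr_ge; first by apply/cvg_ex; eexists; exact: xlim.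
  apply: filterS Fe => i /= Fi.
  by have := monotone_int (mU i) (LU i) (LA i) wS; rewrite /x /A in Fi *; lra.
have mau := ameas mu'.
have eqZ p : (~` Z) p -> h p = a p (u p).
  by move=> nZ; apply: contrapT => H; apply: nZ; exact: hZ.
have Z0' : mu (~` (~` Z)) = 0 by rewrite setCK.
split.
- split; first by exists (fun p => a p (u p)) => //; exact: aeW.
  have [_ [k k0 hk]] := Lh; exists k => //; apply: le_lt_trans hk.
  rewrite le_eqVlt; apply/orP; left; apply/eqP; apply: ae_eq_integral => //.
  + by apply/measurable_EFinP; apply: even_convex_comp => //; exact: measurable_funM.
  + by apply/measurable_EFinP; apply: even_convex_comp => //; exact: measurable_funM.
  + exists Z; split => // p /= H; apply: contrapT => nZ; apply: H => _.
    by rewrite eqZ.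
- exists F; split => // w mw Ew.
  rewrite -(@eq_Rintegral_ae _ _ _ _ (~` Z) (fun p => h p * w p)).
  + exact: hA.
  + exact: measurableC.
  + by [].
  + exact: measurable_funM.
  + exact: measurable_funM.
  + by move=> p nZ; rewrite eqZ.
apply/cvgrPdist_le => e e0.
have H1 := limn_esup_near e0 supA.
(* If the bound failed infinitely often, some ultrafilter finer than [\oo] would contain the set of
   failures, against [energy_ge]. This recovers convergence of the full sequence. *)
have H2 : \forall i \near \oo, l - e <= \int[mu]_p (A i p * U i p).
  apply: contrapT => nH.
  pose S := [set i | ~ (l - e <= \int[mu]_p (A i p * U i p))].
  have PS : ProperFilter (within S \oo).
    apply: Build_ProperFilter_ex => B WB; apply: contrapT => nB; apply: nH.
    apply: (@filterS _ \oo _ _ _ _ WB) => i Bi; apply: contrapT => nSi; apply: nB; exists i.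
    exact: Bi.
  have [G [UG SG]] := ultraFilterLemma PS.
  have GG : ProperFilter G by exact: ultra_proper.
  have oG : \oo `<=` G by move=> B oB; apply: SG; apply: filterS oB => i Bi _.
  have GS : G S by apply: SG; apply: nearW => i.
  have [i [/= Si ei]] := filter_ex (filterI GS (energy_ge UG oG e0)).
  exact: Si.
near=> i.
have h1 : \int[mu]_p (A i p * U i p) <= l + e by near: i.
have h2 : l - e <= \int[mu]_p (A i p * U i p) by near: i.
by rewrite ler_norml; lra.
Unshelve. all: by end_near. Qed.

End minty.

(** * Measures on [R^n] and on pairs of points *)

Section measure_preserving.
Context d (T : measurableType d) (R : realType) (mu : {measure set T -> \bar R}).
Variable phi : T -> T.
Hypothesis mphi : measurable_fun setT phi.
Hypothesis pphi : forall A, measurable A -> mu (phi @^-1` A) = mu A.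

Lemma ge0_integral_preserving (f : T -> \bar R) : measurable_fun setT f ->
  (forall x, 0 <= f x)%E -> (\int[mu]_x f (phi x) = \int[mu]_x f x)%E.
Proof.
move=> mf f0; have := @ge0_integral_pushforward _ _ _ _ R _ mphi mu setT f measurableT mf.
rewrite preimage_setT => /(_ (fun x _ => f0 x)) <-.
by apply: eq_measure_integral => A mA _; exact: pphi.
Qed.

Lemma integral_preserving (f : T -> \bar R) : measurable_fun setT f ->
  (\int[mu]_x f (phi x) = \int[mu]_x f x)%E.
Proof.
move=> mf; rewrite integralE [RHS]integralE; congr (_ - _)%E.
  transitivity (\int[mu]_x f^\+ (phi x))%E; first by apply: eq_integral => x _; rewrite !funeposE.
  by apply: ge0_integral_preserving => //; exact: measurable_funepos.
transitivity (\int[mu]_x f^\- (phi x))%E; first by apply: eq_integral => x _; rewrite !funenegE.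
by apply: ge0_integral_preserving => //; exact: measurable_funeneg.
Qed.

Lemma Rintegral_preserving (f : T -> R) : measurable_fun setT f ->
  \int[mu]_x f (phi x) = \int[mu]_x f x.
Proof.
by move=> mf; congr fine; apply: (integral_preserving (f := EFin \o f)); exact/measurable_EFinP.
Qed.

Lemma integrable_preserving (f : T -> R) : mu.-integrable setT (EFin \o f) ->
  mu.-integrable setT (EFin \o (fun x => f (phi x))).
Proof.
move=> fi; have mf := measurable_integrable fi.
have [_ ffin] := integrableP _ _ _ fi; apply/integrableP; split.
  by apply/measurable_EFinP; exact: (measurableT_comp mf mphi).
rewrite (ge0_integral_preserving (f := fun x => `|(f x)%:E|%E))//.
by apply: measurableT_comp => //; exact/measurable_EFinP.
Qed.

End measure_preserving.

Section translation.
Context {R : realType}.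

Lemma measurable_shift (c : R) : measurable_fun setT (fun x : R => x + c).
Proof. exact: measurable_funD. Qed.

Lemma lebesgue_measure_shift (c : R) (A : set R) : measurable A ->
  lebesgue_measure ((fun x => x + c) @^-1` A) = lebesgue_measure A.
Proof.
move=> mA.
have ms : measurable_fun setT (fun x : measurableTypeR R => (x + c : measurableTypeR R)).
  exact: measurable_shift.
pose m' := measure_function_pushforward__canonical__measure_function_Measure
  (@lebesgue_measure R) ms.
apply/esym; apply: (@lebesgue_measure_unique _ m') => // _ [[a b]] _ <-.
rewrite /m' /= /pushforward.
have -> : (fun x => x + c) @^-1` [set` Interval (BRight a) (BRight b)] =
    [set` Interval (BRight (a - c)) (BRight (b - c))].
  apply/seteqP; split=> x /=; rewrite !in_itv/= ltrBlDr lerBrDr//.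
rewrite !lebesgue_measure_itv/= !lte_fin ltrD2r.
by case: ifP => // _; rewrite -EFinB -EFinB; congr EFin; ring.
Qed.

Lemma measurable_rV_shift n (k : 'rV[R]_n) : measurable_fun setT (fun x : 'rV[R]_n => x + k).
Proof.
apply: measurable_fun_rV => i; under eq_fun do rewrite mxE.
by apply: measurable_funD => //; exact: measurable_coord.
Qed.

Lemma pair_shift_measure d1 d2 (T1 : measurableType d1) (T2 : measurableType d2)
    (m1 : {sigma_finite_measure set T1 -> \bar R})
    (m2 : {sigma_finite_measure set T2 -> \bar R}) (f1 : T1 -> T1) (f2 : T2 -> T2) :
  measurable_fun setT f1 -> measurable_fun setT f2 ->
  (forall A, measurable A -> m1 (f1 @^-1` A) = m1 A) ->
  (forall A, measurable A -> m2 (f2 @^-1` A) = m2 A) ->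
  forall A, measurable A -> (m1 \x m2)%E ((fun p => (f1 p.1, f2 p.2)) @^-1` A) = (m1 \x m2)%E A.
Proof.
move=> mf1 mf2 pf1 pf2 A mA.
have mphi : measurable_fun setT (fun p : T1 * T2 => (f1 p.1, f2 p.2)).
  by apply: measurable_fun_pair; exact: measurableT_comp.
pose m' : {measure set (T1 * T2) -> \bar R} :=
  measure_function_pushforward__canonical__measure_function_Measure (m1 \x m2)%E mphi.
rewrite [RHS](@product_measure_unique _ _ _ _ _ m1 m2 m')// => B C mB mC.
have pT1 : measurable (f1 @^-1` B) by rewrite -[X in measurable X]setTI; exact: mf1.
have pT2 : measurable (f2 @^-1` C) by rewrite -[X in measurable X]setTI; exact: mf2.
rewrite /m' /= /pushforward -(pf1 _ mB) -(pf2 _ mC) -product_measure1E//.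
Qed.

Lemma cons_rVD n (p q : R * 'rV[R]_n) : cons_rV p + cons_rV q = cons_rV (p.1 + q.1, p.2 + q.2).
Proof.
apply/rowP => i; rewrite mxE; have [j ->|->] := unliftP ord0 i.
  by rewrite !cons_rVS mxE.
by rewrite !cons_rV0.
Qed.

Lemma uncons_rVK n : cancel (@uncons_rV R n) (@cons_rV R n).
Proof.
move=> x; apply/rowP => i; have [j ->|->] := unliftP ord0 i.
  by rewrite cons_rVS mxE.
by rewrite cons_rV0.
Qed.

Lemma lebesgue_rV_shift n (k : 'rV[R]_n) A : measurable A ->
  lebesgue_rV n ((fun x => x + k) @^-1` A) = lebesgue_rV n A.
Proof.
elim: n k A => [|n IH] k A mA.
  congr (\d__ _); apply/seteqP; split => x; rewrite /preimage/=;
    by rewrite (_ : x + k = x)//; apply/rowP => -[].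
rewrite /= /lebesgue_rVS /pushforward -comp_preimage.
have mA' : measurable (@cons_rV R n @^-1` A).
  by rewrite -[X in measurable X]setTI; exact: measurable_cons_rV.
have ms : measurable_fun setT (fun x : measurableTypeR R => (x + (uncons_rV k).1 : measurableTypeR R)).
  exact: measurable_shift.
have := @pair_shift_measure _ _ (measurableTypeR R) _ lebesgue_measure (lebesgue_rV n) _ _ ms
  (measurable_rV_shift (uncons_rV k).2) (lebesgue_measure_shift _) (IH _) _ mA'.
apply: etrans; rewrite -comp_preimage; congr (_ _).
have e p : cons_rV p + k = cons_rV (p.1 + (uncons_rV k).1, p.2 + (uncons_rV k).2).
  by rewrite -[in LHS](uncons_rVK k) cons_rVD.
by apply/seteqP; split => p; rewrite /preimage/= e.
Qed.

Lemma lebesgue_rV2_shift n (k : 'rV[R]_n) A : measurable A ->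
  (lebesgue_rV n \x lebesgue_rV n)%E ((fun p => (p.1 + k, p.2 + k)) @^-1` A) =
  (lebesgue_rV n \x lebesgue_rV n)%E A.
Proof.
exact: (pair_shift_measure (measurable_rV_shift k) (measurable_rV_shift k)
  (lebesgue_rV_shift k) (lebesgue_rV_shift k)).
Qed.

Lemma measurable_rV2_shift n (k : 'rV[R]_n) :
  measurable_fun setT (fun p : 'rV[R]_n * 'rV[R]_n => (p.1 + k, p.2 + k)).
Proof.
apply: measurable_fun_pair.
  exact: (measurableT_comp (measurable_rV_shift k) measurable_fst).
exact: (measurableT_comp (measurable_rV_shift k) measurable_snd).
Qed.

End translation.

Section density.
Context d (T : measurableType d) (R : realType) (m mw : {measure set T -> \bar R}).
Variable w : T -> R.
Hypothesis mw0 : measurable_fun setT w.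
Hypothesis w0 : forall x, 0 <= w x.
Hypothesis mwE : forall A, measurable A -> mw A = (\int[m]_(x in A) (w x)%:E)%E.

Import HBNNSimple.

Lemma ge0_integral_density (f : T -> R) : measurable_fun setT f ->
  (forall x, 0 <= f x) -> (\int[mw]_x (f x)%:E = \int[m]_x (f x * w x)%:E)%E.
Proof.
move=> mf f0; have mw0' : measurable_fun setT (fun x => (w x)%:E) by exact/measurable_EFinP.
have mf' : measurable_fun setT (fun x => (f x)%:E) by exact/measurable_EFinP.
pose g := nnsfun_approx measurableT mf'.
have gf x : (g n x)%:E @[n --> \oo] --> (f x)%:E.
  by apply: (cvg_nnsfun_approx measurableT mf') => // y _; rewrite lee_fin.
have gnd x : nondecreasing_seq (fun n => (g n x)%:E).
  by move=> i j ij; rewrite lee_fin; exact/lefP/nd_nnsfun_approx.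
have ind B (r : R) : measurable B -> 0 <= r ->
    (\int[mw]_x (r * \1_B x)%:E = \int[m]_x ((r * \1_B x)%:E * (w x)%:E))%E.
  move=> mB r0; under eq_integral do rewrite EFinM.
  rewrite ge0_integralZl_EFin//; last first.
    by apply/measurable_EFinP; exact: measurable_indic.
  rewrite integral_indic// setIT mwE// integral_mkcond.
  under [in RHS]eq_integral do rewrite EFinM -muleA.
  rewrite ge0_integralZl_EFin//; last 2 first.
    by move=> x _; rewrite mule_ge0// lee_fin.
    by apply: emeasurable_funM => //; apply/measurable_EFinP; exact: measurable_indic.
  congr (_ * _)%E; apply: eq_integral => x _; rewrite patchE indicE.
  by case: (_ \in _); rewrite ?mul1e ?mul0e.
have step n : (\int[mw]_x (g n x)%:E = \int[m]_x ((g n x)%:E * (w x)%:E))%E.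
  under eq_integral do rewrite fimfunE -fsumEFin//.
  have e x : ((g n x)%:E * (w x)%:E =
      \sum_(k \in range (g n)) (k * \1_(g n @^-1` [set k]) x)%:E * (w x)%:E)%E.
    rewrite fimfunE -fsumEFin// ge0_mule_fsuml// => r.
    by rewrite nnfun_muleindic_ge0.
  under [in RHS]eq_integral do rewrite e.
  rewrite !ge0_integral_fsum//.
  - apply: eq_fsbigr => k; rewrite inE => -[y _ <-]; exact: ind.
  - move=> r; apply: emeasurable_funM => //; apply/measurable_EFinP.
    by apply: measurable_funM => //; exact: measurable_indic.
  - by move=> r x _; rewrite mule_ge0 ?lee_fin// -lee_fin EFinM nnfun_muleindic_ge0.
  - move=> r; apply/measurable_EFinP; apply: measurable_funM => //.
  - by move=> r x _; rewrite nnfun_muleindic_ge0.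
have l1 : (\int[mw]_x (g n x)%:E)%E @[n --> \oo] --> (\int[mw]_x (f x)%:E)%E.
  have -> : (\int[mw]_x (f x)%:E = \int[mw]_x limn (fun n => (g n x)%:E))%E.
    by apply: eq_integral => x _; apply/esym/cvg_lim => //; exact: gf.
  apply: cvg_monotone_convergence => //.
  - by move=> n; apply/measurable_EFinP.
  - by move=> n x _; rewrite lee_fin.
have l2 : (\int[m]_x ((g n x)%:E * (w x)%:E))%E @[n --> \oo] --> (\int[m]_x (f x * w x)%:E)%E.
  have -> : (\int[m]_x (f x * w x)%:E = \int[m]_x limn (fun n => (g n x)%:E * (w x)%:E))%E.
    apply: eq_integral => x _; apply/esym/cvg_lim => //.
    apply: cvg_EFin; first exact: nearW.
    have /fine_cvgP[_ gx] := gf x.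
    by apply: (@cvgM _ _ _ _ (fun n => g n x) (fun=> w x)); [exact: gx|exact: cvg_cst].
  apply: cvg_monotone_convergence => //.
  - by move=> n; apply: emeasurable_funM => //; apply/measurable_EFinP.
  - by move=> n x _; rewrite mule_ge0// lee_fin.
  - by move=> x _ i j ij; rewrite lee_wpmul2r ?lee_fin//; exact: gnd.
have l1' : (\int[mw]_x (g n x)%:E)%E @[n --> \oo] --> (\int[m]_x (f x * w x)%:E)%E.
  by under eq_fun do rewrite step; exact: l2.
by rewrite -(cvg_lim _ l1)// -(cvg_lim _ l1').
Qed.

End density.

Section sigma_finite_weight.
Context d (T : measurableType d) (R : realType).
Variable mu : {sigma_finite_measure set T -> \bar R}.

Lemma sigma_finite_weight : exists theta : T -> R, [/\ measurable_fun setT theta,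
  forall x, 0 < theta x <= 1 & mu.-integrable setT (EFin \o theta)].
Proof.
have [F TF Ffin] := sigma_finiteT mu.
have mF k : measurable (F k) by case: (Ffin k).
pose mk k := fine (mu (F k)).
have mk0 k : 0 <= mk k by apply: fine_ge0.
have mkE k : mu (F k) = (mk k)%:E.
  by rewrite /mk fineK// ge0_fin_numE//; case: (Ffin k).
(* Division by [1 + mk k] keeps both [c k] and [c k * mk k] below [2^-(k+1)]: the first sum bounds
   [theta] by 1, the second one its integral. *)
pose c k := 2^-1 ^+ k.+1 / (1 + mk k).
have h0 k : 0 < 2^-1 ^+ k.+1 :> R by rewrite exprn_gt0// invr_gt0.
have c0 k : 0 < c k by rewrite divr_gt0// ltr_pwDl.
have c1 k : c k <= 2^-1 ^+ k.+1 by rewrite ler_pdivrMr ?ltr_pwDl// ler_peMr ?(ltW (h0 _))// lerDl.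
have cm k : c k * mk k <= 2^-1 ^+ k.+1.
  by rewrite /c mulrAC ler_pdivrMr ?ltr_pwDl// ler_pM2l// lerDr.
pose f x := (\sum_(k <oo) (c k * \1_(F k) x)%:E)%E.
have t0 k x : 0 <= c k * \1_(F k) x by rewrite mulr_ge0// ltW.
have mt k : measurable_fun setT (fun x => c k * \1_(F k) x).
  by apply: measurable_funM => //; exact: measurable_indic.
have f1 x : (f x <= 1)%E.
  apply: lime_le; first by apply: is_cvg_nneseries => l _ _; rewrite lee_fin.
  apply: nearW => n; rewrite big_mkord sumEFin lee_fin.
  apply: (le_trans _ (half_series_le R n)); apply: ler_sum => l _.
  by rewrite (le_trans _ (c1 l))// ler_piMr ?(ltW (c0 _)).
have f0 x : (0 < f x)%E.
  have : setT x by []; rewrite TF => -[k _ Fk].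
  apply: (@lt_le_trans _ _ (c k * \1_(F k) x)%:E); first by rewrite indicE mem_set// mulr1 lte_fin.
  apply: (le_trans _ (nneseries_lim_ge k.+1 _)) => [|l _ _]; last by rewrite lee_fin.
  rewrite big_nat_recr//= leeDr//; apply: sume_ge0 => l _; by rewrite lee_fin.
have ffin x : f x \is a fin_num by rewrite ge0_fin_numE ?(ltW (f0 x))// (le_lt_trans (f1 x))// ltry.
have mf : measurable_fun setT f.
  by apply: ge0_emeasurable_sum => l; [move=> x _ _; rewrite lee_fin|move=> _; exact/measurable_EFinP].
have fE x : (fine (f x))%:E = f x by rewrite fineK.
exists (fun x => fine (f x)); split.
- by apply: measurableT_comp => //.
- by move=> x; rewrite -lte_fin -lee_fin fE f0 f1.
- apply/integrableP; split; first by apply/measurable_EFinP; exact: measurableT_comp.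
  rewrite (_ : \int[mu]_x _ = \int[mu]_x f x)%E; last first.
    apply: eq_integral => x _; rewrite -[X in `|X|%E]/((fine (f x))%:E) fE.
    by rewrite gee0_abs// ltW.
  rewrite integral_nneseries//; last 2 first.
    by move=> l; exact/measurable_EFinP.
    by move=> l x _; rewrite lee_fin.
  apply: (@le_lt_trans _ _ 1%E); last exact: ltry.
  apply: lime_le.
    by apply: is_cvg_nneseries => l _ _; apply: integral_ge0 => x _; rewrite lee_fin.
  apply: nearW => n; apply: (@le_trans _ _ (\sum_(0 <= l < n) (2^-1 ^+ l.+1)%:E)%E).
    apply: lee_sum => l _; under eq_integral do rewrite EFinM.
    rewrite ge0_integralZl_EFin ?(ltW (c0 _))//; last first.
      by apply/measurable_EFinP; exact: measurable_indic.
    have -> : (\int[mu]_x (\1_(F l) x)%:E = (mk l)%:E)%E.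
      by rewrite integral_indic// setIT; exact: mkE.
    by rewrite -EFinM lee_fin.
  by rewrite big_mkord sumEFin lee_fin half_series_le.
Qed.

End sigma_finite_weight.

Section ae_integral.
Context d (T : measurableType d) (R : realType) (mu : {measure set T -> \bar R}).

Import HBNNSimple.

(** Neither function is assumed measurable, as elements of the Orlicz spaces are so only up to a
    null set. The integral is a supremum over simple functions below; cutting one of them to the
    complement of [Z] puts it below [g] without changing its integral. *)
Let ge0_ae_le_integral (f g : T -> \bar R) : (forall x, 0 <= f x)%E ->
  (forall x, 0 <= g x)%E -> {ae mu, forall x, f x = g x} ->
  (\int[mu]_x f x <= \int[mu]_x g x)%E.
Proof.
move=> f0 g0 [Z [mZ Z0 fgZ]]; have mZC := measurableC mZ.
rewrite [leLHS]ge0_integralTE// [leRHS]ge0_integralTE//.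
apply: ge_ereal_sup => /= _ [h hf <-].
pose h' := mul_nnsfun h (indic_nnsfun R mZC).
have h'E x : h x * mindic R mZC x = h x * \1_(~` Z) x by [].
apply: ereal_sup_ubound; exists h' => /=.
  move=> x; rewrite h'E indicE; have [xZ|xZ] := boolP (x \in ~` Z); rewrite ?mulr1 ?mulr0//.
  have [Zx|nZx] := pselect (Z x).
    by move: xZ; rewrite inE.
  rewrite -(_ : f x = g x) ?hf//; apply: contrapT => ?; apply: nZx; exact: fgZ.
transitivity (\int[mu]_x (h' x)%:E)%E.
  by rewrite (integral_nnsfun mu measurableT) patch_setT.
transitivity (\int[mu]_x (h x)%:E)%E; last first.
  by rewrite (integral_nnsfun mu measurableT) patch_setT.
apply: ae_eq_integral => //; [exact/measurable_EFinP|exact/measurable_EFinP|].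
exists Z; split => // x /= nh; apply: contrapT => nZ; apply: nh => _.
by rewrite h'E indicE mem_set// mulr1.
Qed.

Lemma ae_integral_eq (f g : T -> \bar R) : {ae mu, forall x, f x = g x} ->
  (\int[mu]_x f x = \int[mu]_x g x)%E.
Proof.
move=> fg; rewrite integralE [RHS]integralE.
have gf : {ae mu, forall x, g x = f x} by apply: filterS fg => x ->.
congr (_ - _)%E; apply/eqP; rewrite eq_le !ge0_ae_le_integral// ;
  by [apply: filterS gf => x; rewrite ?funeposE ?funenegE => ->|
      apply: filterS fg => x; rewrite ?funeposE ?funenegE => ->].
Qed.

Lemma ae_Rintegral_eq (f g : T -> R) : {ae mu, forall x, f x = g x} ->
  \int[mu]_x f x = \int[mu]_x g x.
Proof. by move=> fg; congr fine; apply: ae_integral_eq; apply: filterS fg => x ->. Qed.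

Lemma ae_modular_eq (M : R -> R) (u v : T -> R) : {ae mu, forall x, u x = v x} ->
  modular mu M u = modular mu M v.
Proof. by move=> uv; apply: ae_integral_eq; apply: filterS uv => x ->. Qed.

Lemma ae_orliczL (M : R -> R) (u v : T -> R) : {ae mu, forall x, u x = v x} ->
  orliczL mu M u -> orliczL mu M v.
Proof.
move=> uv [[w mw uw] [k k0 uk]]; split.
  by exists w => //; apply: filterS2 uv uw => x <- <-.
exists k => //; rewrite -(@ae_modular_eq _ (fun x => u x / k))//.
by apply: filterS uv => x ->.
Qed.

Lemma ae_orliczE (M : R -> R) (u v : T -> R) : {ae mu, forall x, u x = v x} ->
  orliczE mu M u -> orliczE mu M v.
Proof.
move=> uv [[w mw uw] uk]; split.
  by exists w => //; apply: filterS2 uv uw => x <- <-.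
move=> k k0; rewrite -(@ae_modular_eq _ (fun x => u x / k)) ?uk//.
by apply: filterS uv => x ->.
Qed.

End ae_integral.

Section sup_norm.
Context {R : realType} (n : nat).
Implicit Types x y : 'rV[R]_n.

Lemma coord_le_norm x i : `|x ord0 i| <= `|x|.
Proof. by rewrite /Num.norm/= mx_normrE; apply: (le_bigmax _ _ (ord0, i)). Qed.

Lemma norm_le_coord x (e : R) : 0 <= e -> (forall i, `|x ord0 i| <= e) -> `|x| <= e.
Proof.
move=> e0 xe; rewrite /Num.norm/= mx_normrE; apply: bigmax_le => // -[i j] _ /=.
by rewrite ord1.
Qed.

Lemma norm_lt_coord x (e : R) : 0 < e -> (forall i, `|x ord0 i| < e) -> `|x| < e.
Proof.
move=> e0 xe; rewrite /Num.norm/= mx_normrE; apply: bigmax_lt => // -[i j] _ /=.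
by rewrite ord1.
Qed.

Lemma enorm_ge0 x : 0 <= enorm x.
Proof. exact: sqrtr_ge0. Qed.

Lemma norm_le_enorm x : `|x| <= enorm x.
Proof.
apply: norm_le_coord => [|i]; first exact: enorm_ge0.
rewrite -sqrtr_sqr ler_sqrt ?sumr_ge0// => [|j _]; last exact: sqr_ge0.
by rewrite (bigD1 i)//= lerDl sumr_ge0// => j _; exact: sqr_ge0.
Qed.

Lemma enormN x : enorm (- x) = enorm x.
Proof. by congr Num.sqrt; apply: eq_bigr => i _; rewrite mxE sqrrN. Qed.

Lemma enormC x y : enorm (x - y) = enorm (y - x).
Proof. by rewrite -enormN opprB. Qed.

Lemma measurable_enorm : measurable_fun setT (@enorm R n).
Proof.
apply: (measurableT_comp (continuous_measurable_fun (@sqrt_continuous R))).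
by apply: measurable_sum => i; apply: measurable_funX; exact: measurable_coord.
Qed.

Definition cube (r : R) : set 'rV[R]_n := [set x | forall i, `[- r, r]%classic (x ord0 i)].

Lemma cubeP x r : 0 <= r -> cube r x <-> `|x| <= r.
Proof.
move=> r0; split => [xr|xr i].
  by apply: norm_le_coord => // i; have := xr i; rewrite /= in_itv/= ler_norml.
by rewrite /= in_itv/= -ler_norml (le_trans (coord_le_norm x i)).
Qed.

Lemma measurable_cube r : measurable (cube r).
Proof. by apply: (measurable_box (A := fun=> `[- r, r]%classic)). Qed.

Lemma lebesgue_cube r : 0 <= r -> lebesgue_rV n (cube r) = ((r *+ 2) ^+ n)%:E.
Proof.
move=> r0; rewrite (lebesgue_rV_box (A := fun=> `[- r, r]%classic))//.
have -> : lebesgue_measure `[- r, r]%classic = (r *+ 2)%:E.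
  rewrite lebesgue_measure_itv/= lte_fin; case: ifPn => [_|].
    by rewrite -EFinB opprK mulr2n.
  rewrite -leNgt => rr; have -> : r = 0 by apply: le_anti; rewrite r0 andbT; lra.
  by rewrite mul0rn.
by rewrite prodEFin prodr_const card_ord.
Qed.

End sup_norm.

Section cube.
Context {R : realType} (n : nat).
Local Notation Rn := 'rV[R]_n.
Local Notation leb := (@lebesgue_rV R n).

Lemma integral_cube (r : R) : 0 <= r ->
  (\int[leb]_x (\1_(@cube R n r) x)%:E = ((r *+ 2) ^+ n)%:E)%E.
Proof.
move=> r0; apply: etrans (integral_indic leb measurableT (measurable_cube r)) _.
by rewrite setIT; exact: lebesgue_cube.
Qed.

Lemma integrable_cube (L c : R) : 0 <= L ->
  leb.-integrable setT (EFin \o (fun x => c * \1_(@cube R n L) x)).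
Proof.
move=> L0; have mI : measurable_fun setT (\1_(@cube R n L) : Rn -> R).
  by apply: measurable_indic; exact: measurable_cube.
apply: integrable_EFinZ; apply: integrable_ge0 => //.
by rewrite integral_cube// ltry.
Qed.

Lemma bounded_support_orliczE (P : R -> R) (w : Rn -> R) (L B : R) : even_convex P -> measurable_fun setT w -> 0 <= L ->
  (forall x, ~ cube L x -> w x = 0) -> (forall x, `|w x| <= B) -> orliczE leb P w.
Proof.
move=> eP mw L0 wL wB; apply: scale_orliczE => // r; have [P0 _ _] := eP.
have B0 : 0 <= B := le_trans (normr_ge0 _) (wB 0).
have [_] := integrableP _ _ _ (integrable_cube (P (r * B)) L0).
apply: le_lt_trans; apply: ge0_le_integral => //.
- by move=> x _; rewrite lee_fin even_convex_ge0.
- by apply/measurable_EFinP; apply: even_convex_comp => //; exact: measurable_funM.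
- apply: measurableT_comp => //; apply/measurable_EFinP; apply: measurable_funM => //.
  by apply: measurable_indic; exact: measurable_cube.
- move=> x _ /=; rewrite lee_fin; apply: le_trans (ler_norm _); rewrite indicE.
  case: (boolP (x \in _)) => [_|].
    rewrite mulr1; apply: even_convex_mono => //; rewrite !normrM ler_wpM2l//.
    by rewrite (ger0_norm B0).
  by move=> /negP; rewrite inE => /wL ->; rewrite mulr0 P0 mulr0.
Qed.

End cube.

Section frac_measure.
Context {R : realType} (n : nat).
Local Notation leb := (@lebesgue_rV R n).
Local Notation leb2 := (leb \x leb)%E.
Local Notation nu := (@frac_measure R n).

Definition fweight (p : 'rV[R]_n * 'rV[R]_n) : R := enorm (p.1 - p.2) ^- n.

Lemma fweight_ge0 p : 0 <= fweight p.
Proof. by rewrite invr_ge0 exprn_ge0// enorm_ge0. Qed.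

Lemma measurable_fweight : measurable_fun setT fweight.
Proof. by apply/measurable_EFinP; exact: (@measurable_frac_weight R n). Qed.

Lemma frac_measureE A : nu A = (\int[leb2]_(p in A) (fweight p)%:E)%E.
Proof. by []. Qed.

(** The weight is unbounded near the diagonal, so the exhausting sets bound the weight as well as
    the two points. *)
Let frac_sigma_finite : sigma_finite setT nu.
Proof.
pose F (k : nat) := (cube k%:R `*` cube k%:R) `&` [set p | fweight p <= k%:R].
have mw (k : nat) : measurable [set p | fweight p <= k%:R].
  by apply: measurable_set_ler => //; exact: measurable_fweight.
have mC (k : nat) : measurable (cube k%:R `*` cube k%:R : set ('rV[R]_n * 'rV[R]_n)).
  by apply: measurableX; exact: measurable_cube.
have mF k : measurable (F k) by apply: measurableI; [exact: mC|exact: mw].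
exists F.
  apply/esym; rewrite -subTset => p _.
  pose r := Num.max (Num.max `|p.1| `|p.2|) (fweight p).
  have [k rk] : exists k : nat, r <= k%:R by exists (Num.truncn r).+1; exact/ltW/truncnS_gt.
  move: rk; rewrite !ge_max => /andP[/andP[p1 p2] p3]; exists k => //; split => //.
  by split; apply/cubeP.
move=> k; split; first exact: measurableI.
rewrite frac_measureE; apply: (@le_lt_trans _ _ (\int[leb2]_(p in F k) (cst k%:R%:E p))%E).
  apply: ge0_le_integral => //.
  - by move=> p _; rewrite lee_fin fweight_ge0.
  - by apply: measurable_funTS; apply/measurable_EFinP; exact: measurable_fweight.
  - by move=> p [_ /=]; rewrite lee_fin.
rewrite integral_cst//.
rewrite lte_mul_pinfty// (@le_lt_trans _ _ (leb2 (cube k%:R `*` cube k%:R)))//.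
  by apply: le_measure; rewrite ?inE//; exact: subIsetl.
apply: (@le_lt_trans _ _ (leb (cube k%:R) * leb (cube k%:R))%E).
  by rewrite -product_measure1E//; exact: measurable_cube.
by rewrite lebesgue_cube// -EFinM ltry.
Qed.

HB.instance Definition _ := Measure_isSigmaFinite.Build _ _ _ nu frac_sigma_finite.

Lemma ge0_integral_frac (f : 'rV[R]_n * 'rV[R]_n -> R) : measurable_fun setT f ->
  (forall p, 0 <= f p) ->
  (\int[nu]_p (f p)%:E = \int[leb]_x \int[leb]_y (f (x, y) * fweight (x, y))%:E)%E.
Proof.
move=> mf f0; have mw := measurable_fweight.
rewrite (ge0_integral_density (m := leb2) (w := fweight))//; last exact: fweight_ge0.
rewrite -(@fubini_tonelli1 _ _ _ _ _ leb leb (fun p => (f p * fweight p)%:E))//.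
- by apply/measurable_EFinP; exact: measurable_funM.
- by move=> p; rewrite lee_fin mulr_ge0// fweight_ge0.
Qed.

Lemma ge0_integral_frac2 (f : 'rV[R]_n * 'rV[R]_n -> R) : measurable_fun setT f ->
  (forall p, 0 <= f p) ->
  (\int[nu]_p (f p)%:E = \int[leb]_y \int[leb]_x (f (x, y) * fweight (x, y))%:E)%E.
Proof.
move=> mf f0; have mw := measurable_fweight.
rewrite (ge0_integral_density (m := leb2) (w := fweight))//; last exact: fweight_ge0.
rewrite -(@fubini_tonelli2 _ _ _ _ _ leb leb (fun p => (f p * fweight p)%:E))//.
- by apply/measurable_EFinP; exact: measurable_funM.
- by move=> p; rewrite lee_fin mulr_ge0// fweight_ge0.
Qed.

Lemma frac_measure_shift (k : 'rV[R]_n) A : measurable A ->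
  nu ((fun p => (p.1 + k, p.2 + k)) @^-1` A) = nu A.
Proof.
move=> mA; rewrite !frac_measureE [LHS]integral_mkcond [RHS]integral_mkcond.
rewrite -[RHS](ge0_integral_preserving (measurable_rV2_shift k) (lebesgue_rV2_shift k)); last 2 first.
- apply/(measurable_restrictT _ mA)/measurable_funTS/measurable_EFinP.
  exact: measurable_fweight.
- by move=> p; rewrite patchE; case: ifP => // _; rewrite lee_fin fweight_ge0.
apply: eq_integral => p _; rewrite !patchE.
have -> : (p \in (fun p => (p.1 + k, p.2 + k)) @^-1` A) = ((p.1 + k, p.2 + k) \in A).
  by apply/idP/idP; rewrite !inE.
by case: ifP => // _; rewrite /fweight/= opprD addrACA subrr addr0.
Qed.

Lemma frac_measure_ae2 (P : 'rV[R]_n * 'rV[R]_n -> Prop) :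
  {ae leb2, forall p, P p} -> {ae nu, forall p, P p}.
Proof.
move=> [Z [mZ Z0 PZ]]; exists Z; split => //; rewrite frac_measureE.
apply: null_set_integral => //; apply/measurable_funTS/measurable_EFinP.
exact: measurable_fweight.
Qed.

Lemma frac_measure_ae (P : 'rV[R]_n -> Prop) :
  {ae leb, forall x, P x} -> {ae nu, forall p, P p.1 /\ P p.2}.
Proof.
move=> [Z [mZ Z0 PZ]]; apply: frac_measure_ae2.
have mZ1 : measurable (Z `*` setT : set ('rV[R]_n * 'rV[R]_n)) by exact: measurableX.
have mZ2 : measurable (setT `*` Z : set ('rV[R]_n * 'rV[R]_n)) by exact: measurableX.
exists ((Z `*` setT) `|` (setT `*` Z)); split; first exact: measurableU.
  have e1 : leb2 (Z `*` setT) = 0%E.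
    apply: etrans (product_measure1E leb leb mZ measurableT) _.
    by rewrite -[RHS](mul0e (leb setT)); congr (_ * _)%E.
  have e2 : leb2 (setT `*` Z) = 0%E.
    apply: etrans (product_measure1E leb leb measurableT mZ) _.
    by rewrite -[RHS](mule0 (leb setT)); congr (_ * _)%E.
  by apply: etrans (measureU0 mZ1 mZ2 e2) e1.
move=> p /= nP; have [P1|nP1] := pselect (P p.1); last by left; split => //; exact: PZ.
have [P2|nP2] := pselect (P p.2); first by exfalso; apply: nP.
by right; split => //; exact: PZ.
Qed.

End frac_measure.

(** * Borel sets of the space of row vectors *)

Section borel_rV.
Context {R : realType} (n : nat).

Lemma measurable_rV_ind (Q : set (set 'rV[R]_n)) : Q set0 ->
  (forall A, Q A -> Q (~` A)) -> (forall F : nat -> set 'rV[R]_n, (forall i, Q (F i)) -> Q (\bigcup_i F i)) ->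
  (forall i r, Q [set x | r < x ord0 i]) -> forall A, measurable A -> Q A.
Proof.
move=> Q0 QC QU Qg.
have sQ : sigma_algebra [set: 'rV[R]_n] Q.
  by split => // A QA; rewrite setTD; exact: QC.
have Qc i (B : set R) : measurable B -> Q ((fun x : 'rV[R]_n => x ord0 i) @^-1` B).
  have -> : @measurable _ R = <<s @RGenOInfty.G R >> := RGenOInfty.measurableE R.
  apply: (smallest_sub (X := fun B => Q ((fun x : 'rV[R]_n => x ord0 i) @^-1` B))).
    split => [|D QD|F QF]; first by rewrite preimage_set0.
      by rewrite setTD preimage_setC; exact: QC.
    by rewrite preimage_bigcup; exact: QU.
  move=> _ [r ->]; apply: (eq_ind _ Q (Qg i r)).
  by apply/seteqP; split => x /=; rewrite in_itv/= andbT.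
move=> A; apply: smallest_sub; first exact: sQ.
case: n Q Q0 QC QU Qg sQ Qc => [|m] Q' _ _ _ _ _ Qc; first by rewrite big_ord0.
rewrite -bigcup_mkord_ord; apply: bigcup_sub => i Ii.
by move=> B [D mD <-]; rewrite setTI; exact: Qc.
Qed.

(** The sigma-algebra is generated by the coordinates. An open set is the union of the closed cubes
    with rational centre and radius [1 / (k + 1)] that it contains, and these are countably many. *)
Lemma open_measurable_rV (O : set 'rV[R]_n) : open O -> measurable O.
Proof.
move=> oO.
pose B (qk : 'rV[rat]_n * nat) : set 'rV[R]_n :=
  [set x | forall i, `[ratr (qk.1 ord0 i) - qk.2.+1%:R^-1, ratr (qk.1 ord0 i) + qk.2.+1%:R^-1]%classic (x ord0 i)].
pose D : set ('rV[rat]_n * nat) := [set qk | B qk `<=` O].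
have -> : O = \bigcup_qk (if `[< D qk >] then B qk else set0).
  apply/seteqP; split => [x Ox|x [qk _]]; last by case: asboolP => // Dq /Dq.
  have /nbhs_ballP[e /= e0 eO] : nbhs x O by exact: open_nbhs_nbhs.
  have e2 : 0 < e / 2 by rewrite divr_gt0.
  pose k := Num.truncn (e / 2)^-1; pose d : R := k.+1%:R^-1.
  have d0 : 0 < d by rewrite invr_gt0.
  have de : d < e / 2.
    by rewrite -[ltRHS]invrK ltf_pV2 ?posrE ?ltr0n ?invr_gt0// truncnS_gt.
  have qx i : exists q : rat, x ord0 i - d < ratr q < x ord0 i + d.
    have : x ord0 i - d < x ord0 i + d by lra.
    by move=> /rat_in_itvoo[q]; rewrite in_itv/=; exists q.
  have [q qE] := choice qx.
  exists (\row_i q i, k) => //; case: asboolP => [_|]; last first.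
    case=> y Bq; apply: eO; rewrite -ball_normE/=; apply: norm_lt_coord => // i.
    have := Bq i; rewrite /= !mxE in_itv/= -/d => /andP[y1 y2].
    have /andP[q1 q2] := qE i; rewrite ltr_norml; apply/andP; split; lra.
  move=> i /=; rewrite mxE in_itv/= -/d; have /andP[q1 q2] := qE i; apply/andP; split; lra.
apply: countable_bigcupT_measurable => // qk; case: asboolP => _ //.
exact: (measurable_box (A := fun i => `[ratr (qk.1 ord0 i) - qk.2.+1%:R^-1, ratr (qk.1 ord0 i) + qk.2.+1%:R^-1]%classic)).
Qed.

Lemma continuous_measurable_rV (f : 'rV[R]_n -> R) : continuous f -> measurable_fun setT f.
Proof.
move=> /continuousP cf; apply: (measurability _ (RGenOpens.measurableE R)).
move=> _ [_ [a [b ->] <-]]; rewrite setTI; apply: open_measurable_rV.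
exact/cf/interval_open.
Qed.

End borel_rV.

(** * Almost everywhere convergence of small translates *)

Section translation_continuity.
Context {R : realType} (n : nat).
Local Notation leb := (@lebesgue_rV R n).
Variable k_ : nat -> 'rV[R]_n.
Hypothesis k_1 : forall i, `|k_ i| <= 1.
Hypothesis k_0 : k_ i @[i --> \oo] --> (0 : 'rV[R]_n).

Let sh i (x : 'rV[R]_n) : 'rV[R]_n := x - k_ i.

(** The symmetric difference of [A] and its translate by [k_ i]. *)
Let D (A : set 'rV[R]_n) i : set 'rV[R]_n :=
  (A `&` sh i @^-1` ~` A) `|` (~` A `&` sh i @^-1` A).

Let Q (A : set 'rV[R]_n) := measurable A /\ forall (N : nat) (e : R), 0 < e ->
  \forall i \near \oo, (leb (cube N%:R `&` D A i) <= e%:E)%E.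

Let mpre A i : measurable A -> measurable (sh i @^-1` A).
Proof.
by move=> mA; rewrite -[X in measurable X]setTI; exact: (measurable_rV_shift (- k_ i)).
Qed.

Let mD A i : measurable A -> measurable (D A i).
Proof.
move=> mA; have mAC := measurableC mA.
by apply: measurableU; apply: measurableI => //; exact: mpre.
Qed.

Let mCD N A i : measurable A -> measurable (cube N `&` D A i).
Proof. by move=> mA; apply: measurableI; [exact: measurable_cube|exact: mD]. Qed.

Let shift_cube_le (B : set 'rV[R]_n) (N : nat) i : measurable B ->
  (leb (cube N%:R `&` sh i @^-1` B) <= leb (cube N.+1%:R `&` B))%E.
Proof.
move=> mB; rewrite -(lebesgue_rV_shift (- k_ i) (A := cube N.+1%:R `&` B)); last first.
  by apply: measurableI => //; exact: measurable_cube.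
apply: le_measure; rewrite ?inE.
- by apply: measurableI; [exact: measurable_cube|exact: mpre].
- by apply: mpre; apply: measurableI => //; exact: measurable_cube.
move=> x [/cubeP xN /= Bx]; split => //; apply/cubeP => //.
by rewrite -natr1 (le_trans (ler_normB _ _))// lerD ?xN.
Qed.

(** Finitely many of the sets are handled one by one, with total error [e / 2]. The remainder of the
    union has measure at most [e / 4] in the cube of radius [N + 1] by continuity from above, and so
    has its translate in the cube of radius [N], since [|k_ i| <= 1]. *)
Let QU (F : nat -> set 'rV[R]_n) : (forall i, Q (F i)) -> Q (\bigcup_i F i).
Proof.
move=> QF; have mF i : measurable (F i) by case: (QF i).
set U := \bigcup_i F i; have mU : measurable U by exact: bigcup_measurable.
split => // N e e0.
pose G J := \bigcup_(j < J) F j.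
have mG J : measurable (G J) by apply: bigcup_measurable.
pose E J := cube N.+1%:R `&` (U `\` G J).
have mE J : measurable (E J).
  by apply: measurableI; [exact: measurable_cube|exact: measurableD].
have E0 : leb (E J) @[J --> \oo] --> 0%E.
  have -> : 0%E = leb (\bigcap_J E J).
    rewrite (_ : \bigcap_J E J = set0) ?measure0// -subset0 => x Ex.
    have [_ [[j _ Fj] _]] := Ex 0%N I.
    have [_ [_]] := Ex j.+1 I; apply; exists j => //=.
  apply: nonincreasing_cvg_mu => //.
  - rewrite (@le_lt_trans _ _ (leb (cube N.+1%:R)))//.
      by apply: le_measure; rewrite ?inE; [exact: mE|exact: measurable_cube|move=> x []].
    by rewrite lebesgue_cube// ltry.
  - exact: bigcapT_measurable.
  - move=> i j ij; apply/subsetPset => x [? [? nG]]; split => //; split => // Gi; apply: nG.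
    move: Gi => -[l /= li Fl]; exists l => //=; exact: leq_trans ij.
have e4 : 0 < e / 4 by rewrite divr_gt0.
have [J EJ] : exists J, (leb (E J) <= (e / 4)%:E)%E.
  move/fine_cvgP: E0 => [_] /cvgrPdist_le/(_ _ e4)[J _ /(_ J (leqnn _))]; rewrite sub0r normrN.
  move=> h; exists J; rewrite -(@fineK _ (leb (E J))) ?lee_fin; first exact: (le_trans (ler_norm _)).
  rewrite ge0_fin_numE// (@le_lt_trans _ _ (leb (cube N.+1%:R)))//.
    by apply: le_measure; rewrite ?inE; [exact: mE|exact: measurable_cube|move=> x []].
  by rewrite lebesgue_cube// ltry.
have JS : \forall i \near \oo, (\sum_(j < J) leb (cube N%:R `&` D (F j) i) <= (e / 2)%:E)%E.
  have e2 : 0 < e / 2 / J.+1%:R by rewrite !divr_gt0.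
  have h : \forall i \near \oo, forall j : 'I_J, (leb (cube N%:R `&` D (F j) i) <= (e / 2 / J.+1%:R)%:E)%E.
    by apply: filter_forall => j; have [_] := QF j; apply.
  apply: filterS h => i h; apply: (@le_trans _ _ (\sum_(j < J) (e / 2 / J.+1%:R)%:E)%E).
    by apply: lee_sum.
  rewrite sumEFin lee_fin sumr_const card_ord -[leLHS]mulr_natr.
  by rewrite mulrAC ler_pdivrMr// ler_pM2l ?divr_gt0// ler_nat.
apply: filterS JS => i JS.
have sub : cube N%:R `&` D U i `<=` (\bigcup_(j < J) (cube N%:R `&` D (F j) i)) `|`
    (E J `|` (cube N%:R `&` sh i @^-1` (U `\` G J))).
  move=> x [xN Dx].
  have xN1 : cube N.+1%:R x.
    by apply/cubeP => //; apply: (@le_trans _ _ N%:R); [exact/cubeP|rewrite ler_nat].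
  case: Dx => -[] /= Ux nUx.
    have [Gx|nGx] := pselect (G J x); last by right; left.
    left; move: Gx => -[j jJ Fj]; exists j => //; split => //.
    by left; split => //= Fj'; apply: nUx; exists j.
  have [Gx|nGx] := pselect (G J (x - k_ i)); last by right; right.
  left; move: Gx => -[j jJ Fj]; exists j => //; split => //.
  by right; split => //= Fj'; apply: Ux; exists j.
have m1 : measurable (\bigcup_(j < J) (cube N%:R `&` D (F j) i)).
  by apply: bigcup_measurable => j _; exact: mCD.
have m3 : measurable (cube N%:R `&` sh i @^-1` (U `\` G J)).
  by apply: measurableI; [exact: measurable_cube|apply: mpre; exact: measurableD].
have m2 := measurableU _ _ (mE J) m3.
apply: (@le_trans _ _ (leb (\bigcup_(j < J) (cube N%:R `&` D (F j) i)) +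
    (leb (E J) + leb (cube N%:R `&` sh i @^-1` (U `\` G J))))%E).
  apply: (le_trans (le_measure leb _ _ sub)); rewrite ?inE; first exact: mCD.
    exact: measurableU.
  apply: le_trans (leeD2l _ (measureU2 leb (mE J) m3)).
  exact: (measureU2 leb m1 m2).
have -> : e%:E = ((e / 2)%:E + ((e / 4)%:E + (e / 4)%:E))%E by rewrite -!EFinD; congr EFin; field.
apply: leeD; last first.
  by apply: leeD => //; apply: le_trans (shift_cube_le N i _) _ => //; exact: measurableD.
apply: le_trans JS; rewrite bigcup_mkord.
apply: (Boole_inequality leb (A := fun j => cube N%:R `&` D (F j) i)) => j _.
by apply: mCD.
Qed.

(** The symmetric difference lies in a slab of width [2 * |k_ i|] about the hyperplane; [C] is the
    product of the other sides of the cube. *)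
Let Qhalf j (r : R) : Q [set x | r < x ord0 j].
Proof.
have mH : measurable [set x : 'rV[R]_n | r < x ord0 j].
  by apply: measurable_set_ltr => //; exact: measurable_coord.
split => // N e e0.
pose C : R := \prod_(l < n | l != j) (N%:R *+ 2).
have C0 : 0 <= C by apply: prodr_ge0 => l _.
have d0 : 0 < e / (2 * (C + 1)) by rewrite divr_gt0// mulr_gt0// ltr_wpDl.
have := k_0; move=> /cvgrPdist_le/(_ _ d0); apply: filterS => i.
rewrite sub0r normrN => kd; pose d := `|k_ i|.
pose A (l : 'I_n) : set R := if l == j then `[r - d, r + d]%classic else `[- N%:R, N%:R]%classic.
have mA l : measurable (A l) by rewrite /A; case: ifP.
apply: (@le_trans _ _ (leb [set x | forall l, A l (x ord0 l)])).
  apply: le_measure; rewrite ?inE; [exact: mCD|exact: measurable_box|].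
  move=> x [xN Dx] l; rewrite /A; case: eqVneq => [->|_]; last exact: xN.
  rewrite /= in_itv/=; have := coord_le_norm (k_ i) j; rewrite -/d ler_norml => /andP[k1 k2].
  case: Dx => -[] /=; rewrite !mxE => /negP; rewrite -?leNgt => h1 /negP; rewrite -?leNgt ?negbK => h2;
    by apply/andP; split; lra.
rewrite lebesgue_rV_box// (bigD1 j)//= {1}/A eqxx.
rewrite (eq_bigr (fun=> (N%:R *+ 2)%:E)); last first.
  move=> l /negbTE lj; rewrite /A lj lebesgue_measure_itv/= lte_fin; case: ifPn => [_|].
    by rewrite -EFinB opprK mulr2n.
  by rewrite -leNgt => NN; congr EFin; have N0 : 0 <= N%:R :> R by []; lra.
rewrite prodEFin -/C lebesgue_measure_itv/= lte_fin.
case: ifP => _; last by rewrite mul0e lee_fin ltW.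
rewrite -EFinB -EFinM lee_fin; have -> : r + d - (r - d) = 2 * d by ring.
move: kd; rewrite -/d ler_pdivlMr ?mulr_gt0// ?ltr_wpDl// => kd.
apply: le_trans kd; rewrite [leRHS](_ : _ = 2 * d * C + 2 * d); last by ring.
by rewrite lerDl mulr_ge0// /d.
Qed.

Let Q_measurable A : measurable A -> Q A.
Proof.
apply: (measurable_rV_ind (Q := Q)) => //.
- split => // N e e0; apply: nearW => i.
  rewrite (_ : cube N%:R `&` _ = set0) ?measure0 ?lee_fin ?(ltW e0)//.
  by rewrite -subset0 => x [_ [[]|[_]]].
- move=> B [mB QB]; split; first exact: measurableC.
  move=> N e e0; apply: filterS (QB N e e0) => i; congr (leb (_ `&` _) <= _)%E.
  by rewrite /D setCK setUC.
Qed.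

(* The sets [A] with [|(A + k_i) - A| -> 0] locally form a sigma-algebra; Borel-Cantelli is
   then applied to the rational superlevel sets of [v]. *)
Lemma translation_ae_cvg (v : 'rV[R]_n -> R) : measurable_fun setT v ->
  exists2 phi : nat -> nat, (forall i, (i <= phi i)%N) &
    {ae leb, forall x, v (x - k_ (phi i)) @[i --> \oo] --> v x}.
Proof.
move=> mv; pose q (j : nat) : rat := odflt 0 (unpickle j).
pose A j := [set x | ratr (q j) < v x].
have mA j : measurable (A j) by exact: measurable_set_ltr.
(* Stage [i] treats [i + 1] superlevel sets, each up to [2^-(i+1) / (i+1)]. Their union [G i] then
   has measure at most [2^-(i+1)], which is summable. *)
have h i : exists l, (i <= l)%N /\ forall j : 'I_i.+1,
    (leb (cube i%:R `&` D (A j) l) <= (2^-1 ^+ i.+1 / i.+1%:R)%:E)%E.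
  have e0 : 0 < 2^-1 ^+ i.+1 / i.+1%:R :> R by rewrite divr_gt0// exprn_gt0// invr_gt0.
  have [l0 _ hl] : \forall l \near \oo, forall j : 'I_i.+1,
      (leb (cube i%:R `&` D (A j) l) <= (2^-1 ^+ i.+1 / i.+1%:R)%:E)%E.
    by apply: filter_forall => j; have [_] := Q_measurable (mA j); apply.
  exists (maxn l0 i); split; first exact: leq_maxr.
  by apply: hl; exact: leq_maxl.
have [phi phiP] := choice h.
exists phi; first by move=> i; case: (phiP i).
pose G i := \big[setU/set0]_(j < i.+1) (cube i%:R `&` D (A j) (phi i)).
have mG i : measurable (G i) by apply: bigsetU_measurable => j _; exact: mCD.
have Gi i : (leb (G i) <= (2^-1 ^+ i.+1)%:E)%E.
  apply: (@le_trans _ _ (\sum_(j < i.+1) leb (cube i%:R `&` D (A j) (phi i)))%E).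
    apply: (Boole_inequality leb (A := fun j => cube i%:R `&` D (A j) (phi i))) => j _.
    by apply: mCD.
  apply: (@le_trans _ _ (\sum_(j < i.+1) (2^-1 ^+ i.+1 / i.+1%:R)%:E)%E).
    by apply: lee_sum => j _; case: (phiP i) => _; apply.
  by rewrite sumEFin lee_fin sumr_const card_ord -[leLHS]mulr_natr divfK.
exists (lim_sup_set G); split.
- by apply: bigcapT_measurable => k; exact: bigcup_measurable.
- apply: lim_sup_set_cvg0 => //; apply: (@le_lt_trans _ _ 1%E); last exact: ltry.
  apply: lime_le; first by apply: is_cvg_nneseries => l _ _.
  apply: nearW => m; apply: (@le_trans _ _ (\sum_(0 <= l < m) (2^-1 ^+ l.+1)%:E)%E).
    by apply: lee_sum => l _; exact: Gi.
  by rewrite big_mkord sumEFin lee_fin half_series_le.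
move=> x /=; apply: contra_notP => nG.
have [i0 Hi] : exists i0, forall i, (i0 <= i)%N -> ~ G i x.
  apply: contrapT => nex; apply: nG => i0 _; apply: contrapT => nU; apply: nex.
  by exists i0 => i i0i Gi'; apply: nU; exists i.
(* Outside the limsup set, every rational superlevel set eventually contains both [x] and
   [x - k_ (phi i)] or neither. Two rationals enclosing [v x] then force the convergence. *)
have key (r : rat) : \forall i \near \oo, (ratr r < v (x - k_ (phi i))) = (ratr r < v x).
  pose i1 := maxn i0 (maxn (pickle r) (Num.truncn `|x|).+1).
  exists i1 => // i /=; rewrite !geq_max => /andP[ii /andP[ri xi]].
  have xc : cube i%:R x.
    apply/cubeP => //; apply: (@le_trans _ _ (Num.truncn `|x|).+1%:R); last by rewrite ler_nat.
    exact/ltW/truncnS_gt.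
  have Ar : A (pickle r) = [set x | ratr r < v x] by rewrite /A /q pickleK.
  have nG' := Hi i ii; apply: contra_notP nG' => /eqP ne.
  rewrite /G -(bigcup_mkord _ (fun j => cube i%:R `&` D (A j) (phi i))).
  exists (pickle r); first by rewrite /= ltnS.
  split => //; rewrite /D Ar.
  by move: ne; case: (boolP (ratr r < v (x - k_ (phi i)))) => h1; case: (boolP (ratr r < v x)) => h2 //= _;
    [right|left]; split => //=; exact/negP.
apply/cvgrPdist_lt => e e0.
have : v x - e < v x by lra.
move=> /rat_in_itvoo[q1]; rewrite in_itv/= => /andP[q11 q12].
have : v x < v x + e by lra.
move=> /rat_in_itvoo[q2]; rewrite in_itv/= => /andP[q21 q22].
have := key q2; have := key q1; apply: filterS2 => i.
rewrite q12 => k1; rewrite (ltNge _ (v x)) (ltW q21)/= => /negbT; rewrite -leNgt => k2.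
by rewrite ltr_distlC; apply/andP; split; lra.
Qed.

End translation_continuity.

(** * Fractional difference quotients of Lipschitz functions *)

Section frac_kernel.
Context {R : realType} (n : nat) (s : R).
Hypothesis n0 : (0 < n)%N.
Hypothesis s01 : 0 < s < 1.
Local Notation Rn := 'rV[R]_n.
Local Notation leb := (@lebesgue_rV R n).
Local Notation nu := (@frac_measure R n).

(** Bounds, up to a constant, the fractional quotient of a bounded Lipschitz function. Multiplied by
    [enorm h ^- n] it is integrable: the singularity at 0 has order [n + s - 1 < n], the decay at
    infinity has order [n + s > n]. *)
Definition frac_decay (h : Rn) : R := Num.min (enorm h) 1 / enorm h `^ s.

Definition frac_kernel (h : Rn) : R := frac_decay h * enorm h ^- n.

Lemma measurable_frac_decay : measurable_fun setT frac_decay.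
Proof.
have me := @measurable_enorm R n.
apply: measurable_funM; first exact: measurable_minr.
rewrite (_ : (fun _ => _) = (@powR R)^~ (- s) \o (@enorm R n)).
  by apply: measurableT_comp => //; exact: measurable_powR.
by apply/funext => h /=; rewrite powRN.
Qed.

Lemma measurable_frac_kernel : measurable_fun setT frac_kernel.
Proof.
have me := @measurable_enorm R n.
apply: measurable_funM; first exact: measurable_frac_decay.
rewrite (_ : (fun _ => _) = (@powR R)^~ (- n%:R) \o (@enorm R n)).
  by apply: measurableT_comp => //; exact: measurable_powR.
by apply/funext => h /=; rewrite powRN powR_mulrn// enorm_ge0.
Qed.

Lemma frac_decay_ge0 h : 0 <= frac_decay h.
Proof. by rewrite divr_ge0 ?powR_ge0// le_min enorm_ge0 ler01. Qed.

Lemma frac_kernel_ge0 h : 0 <= frac_kernel h.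
Proof. by rewrite mulr_ge0 ?frac_decay_ge0// invr_ge0 exprn_ge0// enorm_ge0. Qed.

Lemma frac_decay_le1 h : frac_decay h <= 1.
Proof.
have /andP[s0 s1] := s01; rewrite /frac_decay; set r := enorm h.
have r0 : 0 <= r := enorm_ge0 h.
have [->|rn0] := eqVneq r 0; first by rewrite min_l ?ler01// mul0r.
have rp : 0 < r by rewrite lt_neqAle eq_sym rn0.
rewrite ler_pdivrMr ?powR_gt0// mul1r; have [r1|r1] := leP r 1.
  by rewrite ger1_powR ?rp ?r1 ?ltW.
by rewrite -[leLHS](powRr0 r) ler_powR// ltW.
Qed.

Lemma frac_decayN h : frac_decay (- h) = frac_decay h.
Proof. by rewrite /frac_decay enormN. Qed.

(** The kernel is radially nonincreasing: after one power of the norm is cancelled, which uses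
    [n > 0], it is a product of nonincreasing factors. *)
Lemma frac_kernel_le q h : 0 < q -> q <= enorm h ->
  frac_kernel h <= Num.min q 1 / q `^ s * q ^- n.
Proof.
move=> q0 qr; have /andP[s0 s1] := s01; rewrite /frac_kernel/frac_decay; set r := enorm h.
have r0 : 0 < r := lt_le_trans q0 qr.
have e x : 0 < x -> Num.min x 1 / x `^ s * x ^- n =
    Num.min 1 x^-1 * (x `^ s)^-1 * x ^- n.-1.
  move=> x0; rewrite -{1}(prednK n0) exprS invfM; have [x1|x1] := leP x 1.
    rewrite min_l; last by rewrite invf_ge1.
    by field; rewrite !gt_eqF ?powR_gt0// exprn_gt0.
  rewrite min_r; last by rewrite invf_le1// ltW.
  by field; rewrite !gt_eqF ?powR_gt0// exprn_gt0.
rewrite !e//; have qi : r^-1 <= q^-1 by rewrite lef_pV2.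
apply: ler_pM.
- by rewrite mulr_ge0 ?invr_ge0 ?powR_ge0// le_min ler01 invr_ge0 ltW.
- by rewrite invr_ge0 exprn_ge0// ltW.
- apply: ler_pM; rewrite ?invr_ge0 ?powR_ge0 ?le_min ?ler01 ?invr_ge0 ?(ltW r0)//.
    by rewrite ge_min lexx ge_min qi orbT.
  by rewrite lef_pV2 ?posrE ?powR_gt0// ge0_ler_powR// ?nnegrE ltW.
- by rewrite lef_pV2 ?posrE ?exprn_gt0// lerXn2r ?nnegrE// ltW.
Qed.

(** The geometric ratios are [a / b = 2^(s-1)] for the shells near 0 and [b = 2^-s] for those near
    infinity; both are below 1 because [0 < s < 1]. *)
Let a : R := 2^-1.
Let b : R := 2^-1 `^ s.

Let a01 : 0 < a < 1. Proof. by rewrite /a; lra. Qed.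
Let ab : a < b < 1.
Proof.
have /andP[s0 s1] := s01; apply/andP; split.
  have e : a = b * 2^-1 `^ (1 - s).
    rewrite /b -powRD; first by rewrite addrC subrK powRr1.
    by apply/implyP => _; rewrite invr_eq0 pnatr_eq0.
  have c1 : 2^-1 `^ (1 - s) < (1 : R).
    have := @gt0_ltr_powR R (1 - s) _ 2^-1 1; rewrite powR1; apply; rewrite ?nnegrE//; lra.
  by rewrite {1}e gtr_pMr// powR_gt0.
have := @gt0_ltr_powR R s s0 2^-1 1; rewrite powR1; apply; rewrite ?nnegrE//; lra.
Qed.

(* The two new dyadic shells of [shell J.+1] contribute geometric terms. *)
Let shell J h : R := frac_kernel h * \1_[set h : Rn | a ^+ J < `|h| <= 2 ^+ J] h.

Let mshell_set J : measurable [set h : Rn | a ^+ J < `|h| <= 2 ^+ J].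
Proof.
have aJ : 0 <= a ^+ J by rewrite exprn_ge0// ltW//; case/andP: a01.
rewrite (_ : mkset _ = cube (2 ^+ J) `\` cube (a ^+ J)).
  by apply: measurableD; exact: measurable_cube.
apply/seteqP; split=> h /=.
  by move=> /andP[h1 h2]; split; [apply/cubeP => //; exact: exprn_ge0|move/cubeP => /(_ aJ); rewrite leNgt h1].
move=> [/cubeP h1 h2]; rewrite h1 ?exprn_ge0// andbT ltNge; apply/negP => h3.
by apply: h2; exact/cubeP.
Qed.

Let mshell J : measurable_fun setT (shell J).
Proof. by apply: measurable_funM; [exact: measurable_frac_kernel|apply: measurable_indic; exact: mshell_set]. Qed.

Let shell_ge0 J h : 0 <= shell J h.
Proof. by rewrite mulr_ge0// frac_kernel_ge0. Qed.

Let shellS J h : shell J.+1 h <= shell J h + ((a / b) ^+ J.+1 * (2 ^+ J.+1) ^+ n * \1_(cube (a ^+ J)) h +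
  b ^+ J * a ^+ J ^+ n * \1_(cube (2 ^+ J.+1)) h).
Proof.
have /andP[a0 a1] := a01; have /andP[ab' b1] := ab; have b0 := lt_trans a0 ab'.
have i0 (A : set Rn) h' : 0 <= \1_A h' :> R by [].
have t1 : 0 <= (a / b) ^+ J.+1 * (2 ^+ J.+1) ^+ n * \1_(cube (a ^+ J)) h.
  by rewrite !mulr_ge0// !exprn_ge0// ?divr_ge0// ltW.
have t2 : 0 <= b ^+ J * a ^+ J ^+ n * \1_(cube (2 ^+ J.+1)) h.
  by rewrite !mulr_ge0// !exprn_ge0// ltW.
have a2 : a ^+ J * 2 ^+ J = 1 by rewrite -exprMn /a mulVf ?expr1n.
rewrite {1}/shell [X in _ * X]indicE; case: (boolP (_ \in _)) => [|_]; last first.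
  by rewrite mulr0 addr_ge0 ?addr_ge0.
rewrite mulr1 inE /= => /andP[h1 h2].
have [hJ|hJ] := boolP (a ^+ J < `|h| <= 2 ^+ J).
  rewrite /shell [X in _ * X]indicE mem_set// mulr1 lerDl addr_ge0//.
have bX k : (a ^+ k) `^ s = b ^+ k by rewrite -powR_mulrn ?ltW// powRAC powR_mulrn ?powR_ge0.
have [ha|ha] := leP `|h| (a ^+ J).
  have hc : h \in cube (a ^+ J) by rewrite inE; apply/cubeP => //; rewrite exprn_ge0// ltW.
  apply: (@le_trans _ _ ((a / b) ^+ J.+1 * (2 ^+ J.+1) ^+ n * \1_(cube (a ^+ J)) h)).
    have aJ0 : 0 < a ^+ J.+1 by rewrite exprn_gt0.
    apply: (le_trans (frac_kernel_le aJ0 (ltW (lt_le_trans h1 (norm_le_enorm h))))).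
    rewrite indicE hc mulr1 bX min_l; last by rewrite exprn_ile1// ltW.
    have -> : 2 ^+ J.+1 = (a ^+ J.+1)^-1 :> R by rewrite /a exprVn invrK.
    by rewrite (expr_div_n a b) (exprVn (a ^+ J.+1)).
  by rewrite -[leLHS]add0r lerD// lerDl.
have h3 : 2 ^+ J < `|h| by move: hJ; rewrite ha/= ltNge.
apply: (@le_trans _ _ (b ^+ J * a ^+ J ^+ n * \1_(cube (2 ^+ J.+1)) h)).
  have aJ0 : 0 < 2 ^+ J :> R by rewrite exprn_gt0.
  apply: (le_trans (frac_kernel_le aJ0 (ltW (lt_le_trans h3 (norm_le_enorm h))))).
  have hc : h \in cube (2 ^+ J.+1) by rewrite inE; apply/cubeP => //; rewrite exprn_ge0.
  rewrite indicE hc mulr1 min_r; last by rewrite exprn_ege1// ler1n.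
  have e : (2 ^+ J) `^ s * b ^+ J = 1.
    by rewrite -bX -powRM ?exprn_ge0 ?(ltW a0)// mulrC a2 powR1.
  have -> : 1 / (2 ^+ J) `^ s = b ^+ J.
    have P0 := lt0r_neq0 (powR_gt0 s aJ0).
    by rewrite mul1r; apply: (mulfI P0); rewrite e; exact: divff.
  by have -> : 2 ^+ J = (a ^+ J)^-1 :> R; [rewrite /a exprVn invrK|rewrite (exprVn (a ^+ J)) invrK].
by rewrite -[leLHS]add0r lerD// lerDr.
Qed.

(** A cube of side [2 * a^J] meets the factor [(2^(J+1))^n], and a cube of side [2 * 2^(J+1)] the
    factor [(a^J)^n]. In both cases the powers cancel down to [4^n]. *)
Let c : R := 4 ^+ n.

Let shell_int J : (\int[leb]_h (shell J h)%:E <=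
  (c * (a / b * (1 - (a / b) ^+ J) / (1 - a / b) + (1 - b ^+ J) / (1 - b)))%:E)%E.
Proof.
have /andP[a0 a1] := a01; have /andP[ab' b1] := ab; have b0 := lt_trans a0 ab'.
have x1 : a / b < 1 by rewrite ltr_pdivrMr// mul1r.
elim: J => [|J IH].
  rewrite !expr0 !subrr !mulr0 !mul0r addr0 mulr0 integral0_eq// => h _.
  rewrite /shell indicE; case: (boolP (_ \in _)); rewrite ?mulr0// inE/= !expr0.
  by case/andP => h1 /(lt_le_trans h1); rewrite ltxx.
pose f2 h := (a / b) ^+ J.+1 * (2 ^+ J.+1) ^+ n * \1_(@cube R n (a ^+ J)) h.
pose f3 h := b ^+ J * a ^+ J ^+ n * \1_(@cube R n (2 ^+ J.+1)) h.
have m2 : measurable_fun setT f2 by apply: measurable_funM => //; apply: measurable_indic; exact: measurable_cube.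
have m3 : measurable_fun setT f3 by apply: measurable_funM => //; apply: measurable_indic; exact: measurable_cube.
have k2 : 0 <= (a / b) ^+ J.+1 * (2 ^+ J.+1) ^+ n by rewrite !mulr_ge0// !exprn_ge0// ?divr_ge0// ltW.
have k3 : 0 <= b ^+ J * a ^+ J ^+ n by rewrite !mulr_ge0// !exprn_ge0// ltW.
have p2 h : 0 <= f2 h by rewrite mulr_ge0.
have p3 h : 0 <= f3 h by rewrite mulr_ge0.
have intc k r : 0 <= k -> 0 <= r -> (\int[leb]_h (k * \1_(@cube R n r) h)%:E = (k * (r *+ 2) ^+ n)%:E)%E.
  move=> k0 r0; under eq_integral do rewrite EFinM.
  rewrite ge0_integralZl_EFin//; last first.
    by apply/measurable_EFinP; apply: measurable_indic; exact: measurable_cube.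
  by rewrite integral_cube.
apply: (@le_trans _ _ (\int[leb]_h ((shell J h)%:E + ((f2 h)%:E + (f3 h)%:E)))%E).
  apply: ge0_le_integral => //.
  - by move=> h _; rewrite lee_fin.
  - exact/measurable_EFinP.
  - by apply: emeasurable_funD; [|apply: emeasurable_funD]; exact/measurable_EFinP.
  - by move=> h _; rewrite -!EFinD lee_fin shellS.
rewrite ge0_integralD//; last 4 first.
- by move=> h _; rewrite lee_fin.
- exact/measurable_EFinP.
- by move=> h _; rewrite -EFinD lee_fin addr_ge0.
- by apply: emeasurable_funD; exact/measurable_EFinP.
rewrite ge0_integralD//; last 4 first.
- by move=> h _; rewrite lee_fin.
- exact/measurable_EFinP.
- by move=> h _; rewrite lee_fin.
- exact/measurable_EFinP.
rewrite !intc ?exprn_ge0// ?(ltW a0)//.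
apply: (le_trans (leeD2r _ IH)); rewrite -!EFinD lee_fin le_eqVlt; apply/orP; left; apply/eqP.
have a2 : a ^+ J * 2 ^+ J = 1 by rewrite -exprMn /a mulVf ?expr1n.
have e2 : (a / b) ^+ J.+1 * (2 ^+ J.+1) ^+ n * (a ^+ J *+ 2) ^+ n = (a / b) ^+ J.+1 * c.
  rewrite -mulrA -exprMn; congr (_ * _ ^+ _).
  transitivity (4 * (a ^+ J * 2 ^+ J)); last by rewrite a2 mulr1.
  by rewrite -(mulr_natr (a ^+ J)) exprS; ring.
have e3 : b ^+ J * a ^+ J ^+ n * (2 ^+ J.+1 *+ 2) ^+ n = b ^+ J * c.
  rewrite -mulrA -exprMn; congr (_ * _ ^+ _).
  transitivity (4 * (a ^+ J * 2 ^+ J)); last by rewrite a2 mulr1.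
  by rewrite -(mulr_natr (2 ^+ J.+1)) exprS; ring.
rewrite e2 e3 !exprS; move: (a / b) x1 => x x1.
by field; rewrite !subr_eq0 !gt_eqF.
Qed.

Lemma frac_kernel_integrable : (\int[leb]_h (frac_kernel h)%:E < +oo)%E.
Proof.
have /andP[a0 a1] := a01; have /andP[ab' b1] := ab; have b0 := lt_trans a0 ab'.
have x1 : a / b < 1 by rewrite ltr_pdivrMr// mul1r.
have x0 : 0 < a / b by rewrite divr_gt0.
apply: (@le_lt_trans _ _ (c * (a / b / (1 - a / b) + 1 / (1 - b)))%:E); last exact: ltry.
apply: (@fatou_bound _ _ _ leb shell) => //.
- move=> h; have [h0|h0] := eqVneq h 0.
    rewrite (_ : shell^~ h = fun=> frac_kernel h); first exact: cvg_cst.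
    apply/funext => J; rewrite /shell (_ : frac_kernel h = 0) ?mul0r//.
    rewrite /frac_kernel /frac_decay h0 (_ : enorm 0 = 0) ?min_l ?ler01 ?mul0r//.
    by rewrite /enorm big1 ?sqrtr0// => i _; rewrite mxE expr0n.
  have hp : 0 < `|h| by rewrite normr_gt0.
  have ev : \forall J \near \oo, a ^+ J < `|h| <= 2 ^+ J.
    have az : (fun J => a ^+ J) @ \oo --> (0 : R).
      by apply: cvg_expr; rewrite gtr0_norm.
    have h1 : \forall J \near \oo, a ^+ J < `|h|.
      move/cvgrPdist_lt: az => /(_ _ hp); apply: filterS => J.
      by rewrite sub0r normrN => /(le_lt_trans (ler_norm _)).
    have h2 : \forall J \near \oo, a ^+ J < `|h|^-1.
      have hi : 0 < `|h|^-1 by rewrite invr_gt0.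
      move/cvgrPdist_lt: az => /(_ _ hi); apply: filterS => J.
      by rewrite sub0r normrN => /(le_lt_trans (ler_norm _)).
    move: h1 h2; apply: filterS2 => J -> /= h2.
    rewrite -[leRHS]invrK -exprVn -[leLHS]invrK lef_pV2 ?posrE ?invr_gt0 ?exprn_gt0//.
    exact: ltW.
  apply: cvg_near_cst; apply: filterS ev => J hJ.
  by rewrite /shell indicE mem_set// mulr1.
- move=> J; apply: (le_trans (shell_int J)); rewrite lee_fin ler_wpM2l// ?exprn_ge0//.
  apply: lerD; (rewrite ler_pM2r ?invr_gt0 ?subr_gt0//).
    by rewrite ler_piMr ?(ltW x0)// lerBlDr lerDl exprn_ge0// ltW.
  by rewrite lerBlDr lerDl exprn_ge0// ltW.
Qed.

Definition frac_factor (p : Rn * Rn) : R := frac_decay (p.1 - p.2).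

Lemma measurable_frac_factor : measurable_fun setT frac_factor.
Proof.
apply: (measurableT_comp measurable_frac_decay); apply: measurable_fun_rV => i.
under eq_fun do rewrite !mxE; apply: measurable_funB.
  exact: (measurableT_comp (measurable_coord i) measurable_fst).
exact: (measurableT_comp (measurable_coord i) measurable_snd).
Qed.

Let shift_kernel y : (\int[leb]_x (frac_kernel (x - y))%:E = \int[leb]_h (frac_kernel h)%:E)%E.
Proof.
apply: (ge0_integral_preserving (measurable_rV_shift (- y)) (lebesgue_rV_shift (- y))
  (f := fun h => (frac_kernel h)%:E)).
  by apply/measurable_EFinP; exact: measurable_frac_kernel.
by move=> h; rewrite lee_fin frac_kernel_ge0.
Qed.

(** With the weight of the measure included, the integrand is [f y] times the kernel at [x - y];
    Tonelli's theorem and translation invariance factor the integral. *)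
Lemma frac_factor_integrable2 (f : Rn -> R) : measurable_fun setT f -> (forall x, 0 <= f x) ->
  (\int[leb]_x (f x)%:E < +oo)%E -> (\int[nu]_p (f p.2 * frac_factor p)%:E < +oo)%E.
Proof.
move=> mf f0 foo; have mk := measurable_frac_kernel.
rewrite ge0_integral_frac2; last 2 first.
- apply: measurable_funM; last exact: measurable_frac_factor.
  exact: measurableT_comp.
- by move=> p; rewrite mulr_ge0// frac_decay_ge0.
under eq_integral => y _.
  under eq_integral do rewrite /= -mulrA -/(frac_kernel _) EFinM.
  rewrite ge0_integralZl_EFin//; last 2 first.
  - by move=> x _; rewrite lee_fin frac_kernel_ge0.
  - by apply/measurable_EFinP; exact: (measurableT_comp mk (measurable_rV_shift (- y))).
  rewrite shift_kernel; over.
rewrite ge0_integralZr//; last 3 first.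
- exact/measurable_EFinP.
- by move=> x _; rewrite lee_fin.
- by apply: integral_ge0 => h _; rewrite lee_fin frac_kernel_ge0.
rewrite lte_mul_pinfty ?frac_kernel_integrable//.
- by apply: integral_ge0 => h _; rewrite lee_fin.
- by rewrite ge0_fin_numE//; apply: integral_ge0 => h _; rewrite lee_fin.
Qed.

Lemma frac_measure_swap (f : Rn * Rn -> R) : measurable_fun setT f ->
  (forall p, 0 <= f p) -> (\int[nu]_p (f (p.2, p.1))%:E = \int[nu]_p (f p)%:E)%E.
Proof.
move=> mf f0; have msw : measurable_fun setT (fun p : Rn * Rn => (p.2, p.1)).
  exact: measurable_fun_pair.
rewrite ge0_integral_frac; [|exact: (measurableT_comp mf msw)|by []].
apply: etrans (esym (ge0_integral_frac2 mf f0)).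
apply: eq_integral => x _.
apply: eq_integral => y _.
by rewrite /fweight/= enormC.
Qed.

Lemma frac_factor_integrable1 (f : Rn -> R) : measurable_fun setT f -> (forall x, 0 <= f x) ->
  (\int[leb]_x (f x)%:E < +oo)%E -> (\int[nu]_p (f p.1 * frac_factor p)%:E < +oo)%E.
Proof.
move=> mf f0 foo; have mF := measurable_frac_factor.
rewrite -frac_measure_swap; last 2 first.
- by apply: measurable_funM => //; exact: measurableT_comp.
- by move=> p; rewrite mulr_ge0// frac_decay_ge0.
have e : (fun p : Rn * Rn => (f (p.2, p.1).1 * frac_factor (p.2, p.1))%:E) =
    (fun p => (f p.2 * frac_factor p)%:E).
  by apply/funext => p; rewrite /frac_factor/= -frac_decayN opprB.
by rewrite e; exact: frac_factor_integrable2.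
Qed.

End frac_kernel.

Section orlicz_space.
Context d (T : measurableType d) (R : realType) (mu : {measure set T -> \bar R}).
Variable M : R -> R.
Hypothesis eM : even_convex M.
Implicit Types u v : T -> R.

Lemma measurable_orliczL u (k : R) : measurable_fun setT u -> 0 < k ->
  (modular mu M (fun x => u x / k)%R < +oo)%E -> orliczL mu M u.
Proof. by move=> mu' k0 uk; split; [exists u => //; exact: aeW|exists k]. Qed.

Lemma orliczL_le u v : measurable_fun setT u -> measurable_fun setT v ->
  (forall x, `|u x| <= `|v x|) -> orliczL mu M v -> orliczL mu M u.
Proof.
move=> mu' mv uv [_ [k k0 vk]]; apply: (measurable_orliczL mu' k0).
apply: le_lt_trans vk; apply: le_modular => //; [exact: measurable_funM|exact: measurable_funM|].
by move=> x; rewrite !normrM ler_wpM2r.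
Qed.

Lemma orliczLZ (c : R) u : measurable_fun setT u -> orliczL mu M u ->
  orliczL mu M (fun x => c * u x).
Proof.
move=> mu' [_ [k k0 uk]]; have c0 : 0 < `|c| + 1 by rewrite ltr_wpDl.
have mcu : measurable_fun setT (fun x => c * u x) by exact: measurable_funM.
apply: (measurable_orliczL mcu (mulr_gt0 c0 k0)).
apply: le_lt_trans uk; apply: le_modular => //; [exact: measurable_funM|exact: measurable_funM|].
move=> x; rewrite invfM !normrM [in leLHS]mulrA ler_wpM2r// mulrAC mulrC ler_piMr//.
by rewrite normfV (gtr0_norm c0) ler_pdivrMr// mul1r lerDl.
Qed.

Lemma orliczLD u v : measurable_fun setT u -> measurable_fun setT v ->
  orliczL mu M u -> orliczL mu M v -> orliczL mu M (fun x => u x + v x).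
Proof.
move=> mu' mv [_ [k k0 uk]] [_ [l l0 vl]].
have kl0 : 0 < 2 * (k + l) by rewrite mulr_gt0// addr_gt0.
have muv : measurable_fun setT (fun x => u x + v x) by exact: measurable_funD.
have bnd (w : T -> R) c : measurable_fun setT w -> 0 < c -> c <= k + l ->
    (modular mu M (fun x => w x / c)%R < +oo)%E ->
    (modular mu M (fun x => 2 * (w x / (2 * (k + l))))%R < +oo)%E.
  move=> mw c0 ckl; apply: le_lt_trans; apply: le_modular => //.
    by apply: measurable_funM => //; exact: measurable_funM.
    exact: measurable_funM.
  move=> x; have -> : 2 * (w x / (2 * (k + l))) = w x / (k + l).
    by field; rewrite gt_eqF// addr_gt0.
  rewrite !normrM ler_wpM2l// !normfV !gtr0_norm ?addr_gt0// lef_pV2// ?posrE ?addr_gt0//.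
apply: (measurable_orliczL muv kl0).
rewrite (_ : (fun x => _) = (fun x => u x / (2 * (k + l)) + v x / (2 * (k + l)))); last first.
  by apply/funext => x; rewrite mulrDl.
apply: modularD_lty => //; [exact: measurable_funM|exact: measurable_funM| |].
  by apply: (bnd u k) => //; rewrite lerDl ltW.
by apply: (bnd v l) => //; rewrite lerDr ltW.
Qed.

End orlicz_space.

Section frac_sobolev.
Context {R : realType} (n : nat) (s : R).
Hypothesis n0 : (0 < n)%N.
Hypothesis s01 : 0 < s < 1.
Variable M : R -> R.
Hypothesis eM : even_convex M.
Local Notation Rn := 'rV[R]_n.
Local Notation leb := (@lebesgue_rV R n).
Local Notation nu := (@frac_measure R n).
Implicit Types u v : Rn -> R.

Lemma measurable_fracD v : measurable_fun setT v -> measurable_fun setT (fracD s v).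
Proof.
move=> mv; apply: measurable_funM.
  apply: measurable_funB.
    exact: (measurableT_comp mv measurable_fst).
  exact: (measurableT_comp mv measurable_snd).
rewrite (_ : (fun _ => _) = (@powR R)^~ (- s) \o (fun p : Rn * Rn => enorm (p.1 - p.2))).
  by apply: measurableT_comp; [exact: measurable_powR|exact: measurable_enormB].
by apply/funext => p /=; rewrite powRN.
Qed.

Lemma fracD_shift k v p : fracD s (fun x => v (x + k)) p = fracD s v (p.1 + k, p.2 + k).
Proof. by rewrite /fracD/= opprD addrACA subrr addr0. Qed.

Lemma fracDD u v p : fracD s (fun x => u x + v x) p = fracD s u p + fracD s v p.
Proof. by rewrite /fracD -mulrDl; congr (_ * _); ring. Qed.

Lemma fracD_mul (chi v : Rn -> R) p :
  fracD s (fun x => chi x * v x) p = chi p.1 * fracD s v p + v p.2 * fracD s chi p.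
Proof. by rewrite /fracD; ring. Qed.

Lemma fracD_ae u v : {ae leb, forall x, u x = v x} ->
  {ae nu, forall p, fracD s u p = fracD s v p}.
Proof. by move=> /frac_measure_ae; apply: filterS => p [e1 e2]; rewrite /fracD e1 e2. Qed.

Section lipschitz.
Variables (f : Rn -> R) (C B : R).
Hypothesis C0 : 0 <= C.
Hypothesis fC : forall x y, `|f x - f y| <= C * `|x - y|.
Hypothesis fB : forall x, `|f x| <= B.

Lemma fracD_lip_le p : `|fracD s f p| <= (C + 2 * B) * frac_factor s p.
Proof.
have B0 : 0 <= B := le_trans (normr_ge0 _) (fB 0).
rewrite /fracD normrM /frac_factor /frac_decay mulrA normfV (ger0_norm (powR_ge0 _ _)).
rewrite ler_wpM2r ?invr_ge0 ?powR_ge0//; set r := enorm _.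
have r0 : 0 <= r := enorm_ge0 _.
have h1 : `|f p.1 - f p.2| <= C * r.
  by apply: (le_trans (fC _ _)); rewrite ler_wpM2l// norm_le_enorm.
have h2 : `|f p.1 - f p.2| <= 2 * B.
  by apply: (le_trans (ler_normB _ _)); have := fB p.1; have := fB p.2; lra.
have [r1|r1] := leP r 1; last by rewrite ?min_r ?(ltW r1)// mulr1 (le_trans h2)// lerDr.
by rewrite ?min_l// (le_trans h1)// ler_wpM2r// lerDl mulr_ge0.
Qed.

Hypothesis mf : measurable_fun setT f.

(** Each multiple of the quotient is at most a constant times some [t] in [0, 1] proportional to
    [frac_factor]. Convexity makes [M] at most linear in [t], and [frac_factor] is integrable over
    the pairs with a point in the cube. *)
Lemma lip_orliczE (N : R) : 0 <= N -> (forall x, ~ cube N x -> f x = 0) ->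
  orliczE leb M f /\ orliczE nu M (fracD s f).
Proof.
move=> N0 fN; have mI : measurable_fun setT (\1_(@cube R n N) : Rn -> R).
  by apply: measurable_indic; exact: measurable_cube.
have B0 : 0 <= B := le_trans (normr_ge0 _) (fB 0).
split; first exact: (bounded_support_orliczE eM mf N0 fN fB).
have mw := @measurable_frac_factor R n s.
apply: scale_orliczE => [|r]; first exact: measurable_fracD.
pose K := C + 2 * B; have K0 : 0 <= K by rewrite addr_ge0// mulr_ge0.
pose c := M (2 * `|r| * K); have c0 : 0 <= c := even_convex_ge0 eM _.
pose g x := c * \1_(@cube R n N) x.
have mg : measurable_fun setT g by exact: measurable_funM.
have g0 x : 0 <= g x by rewrite mulr_ge0.
have ig : (\int[leb]_x (g x)%:E < +oo)%E.
  have [_] := integrableP _ _ _ (integrable_cube n c N0); congr (_ < _)%E.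
  by apply: eq_integral => x _ /=; rewrite ger0_norm ?g0.
have mg1 : measurable_fun setT (fun p : Rn * Rn => g p.1 * frac_factor s p).
  by apply: measurable_funM => //; exact: measurableT_comp.
have mg2 : measurable_fun setT (fun p : Rn * Rn => g p.2 * frac_factor s p).
  by apply: measurable_funM => //; exact: measurableT_comp.
have w0 (p : Rn * Rn) : 0 <= frac_factor s p := frac_decay_ge0 s _.
have w1 (p : Rn * Rn) : frac_factor s p <= 1 := frac_decay_le1 s01 _.
apply: (@le_lt_trans _ _ (\int[nu]_p ((g p.1 * frac_factor s p)%:E + (g p.2 * frac_factor s p)%:E))%E).
  apply: ge0_le_integral => //.
  - by move=> p _; rewrite lee_fin even_convex_ge0.
  - apply/measurable_EFinP; apply: even_convex_comp => //.
    by apply: measurable_funM => //; exact: measurable_fracD.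
  - by apply: emeasurable_funD; exact/measurable_EFinP.
  - move=> p _; rewrite -EFinD lee_fin -mulrDl -mulrDr.
    (* Counts the points of the pair inside the cube; the quotient vanishes when there are none. As
       [i <= 2], the factor 2 in [c] keeps [t] at most 1. *)
    pose i : R := \1_(@cube R n N) p.1 + \1_(@cube R n N) p.2.
    rewrite -/i; have [i0 i2] : 0 <= i /\ i <= 2.
      by rewrite /i !indicE; case: (_ \in _); case: (_ \in _) => /=; lra.
    have Kw0 : 0 <= K * frac_factor s p by rewrite mulr_ge0// w0.
    have Di : `|fracD s f p| <= K * frac_factor s p * i.
      have [p1|p1] := pselect (cube N p.1).
        apply: (le_trans (fracD_lip_le p)); rewrite ler_peMr//.
        by rewrite /i !indicE mem_set// lerDl.
      have [p2|p2] := pselect (cube N p.2).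
        apply: (le_trans (fracD_lip_le p)); rewrite ler_peMr//.
        by rewrite /i !indicE (mem_set p2) lerDr.
      by rewrite /fracD !fN// subrr mul0r normr0 mulr_ge0.
    pose t := frac_factor s p * i / 2.
    have t01 : 0 <= t <= 1.
      rewrite /t divr_ge0 ?(mulr_ge0 (w0 p) i0)//= ler_pdivrMr// mul1r.
      by rewrite -[leRHS]mul1r ler_pM// ?w0 ?w1.
    apply: (@le_trans _ _ (M (t * (2 * `|r| * K)))).
      apply: even_convex_mono => //; rewrite normrM [leRHS]ger0_norm; last first.
        by case/andP: t01 => t0 _; apply: mulr_ge0 => //; rewrite !mulr_ge0.
      apply: (le_trans (ler_wpM2l (normr_ge0 r) Di)); rewrite /t le_eqVlt.
      by apply/orP; left; apply/eqP; field.
    apply: (le_trans (even_convex_shrink eM _ t01)); rewrite -/c /t.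
    rewrite [leRHS](_ : _ = frac_factor s p * i * c); last by ring.
    rewrite ler_wpM2r// ler_pdivrMr// ler_peMr ?ler1n//.
    exact: mulr_ge0 (w0 p) i0.
rewrite ge0_integralD//; last 4 first.
- by move=> p _; rewrite lee_fin mulr_ge0.
- exact/measurable_EFinP.
- by move=> p _; rewrite lee_fin mulr_ge0.
- exact/measurable_EFinP.
by rewrite lte_add_pinfty// ?(frac_factor_integrable1 n0 s01 mg)// ?(frac_factor_integrable2 n0 s01 mg)//.
Qed.

End lipschitz.

Definition frac_sobolev v := [/\ measurable_fun setT v, orliczL leb M v & orliczL nu M (fracD s v)].

(** Leibniz rule. In the term with the quotient of [chi], the value of [v] at the second point is
    multiplied by a constant times [frac_factor], which lies in [0, 1]; convexity pulls it out of
    [M], and the result is integrable by Tonelli's theorem. *)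
Lemma frac_sobolev_mul (chi v : Rn -> R) (C : R) : measurable_fun setT chi -> 0 <= C ->
  (forall x y, `|chi x - chi y| <= C * `|x - y|) -> (forall x, `|chi x| <= 1) ->
  frac_sobolev v -> frac_sobolev (fun x => chi x * v x).
Proof.
move=> mc C0 cC c1 [mv Lv LDv].
have mcv : measurable_fun setT (fun x => chi x * v x) by exact: measurable_funM.
have mDv := measurable_fracD mv; have mDc := measurable_fracD mc.
have mw := @measurable_frac_factor R n s.
have mv2 : measurable_fun setT (fun p : Rn * Rn => v p.2) by exact: measurableT_comp.
have mc1 : measurable_fun setT (fun p : Rn * Rn => chi p.1) by exact: measurableT_comp.
split => //.
  apply: (orliczL_le eM mcv mv) => // x; rewrite normrM ler_piMl//.
rewrite (_ : fracD s _ = fun p => chi p.1 * fracD s v p + v p.2 * fracD s chi p); last first.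
  by apply/funext => p; exact: fracD_mul.
apply: orliczLD => //.
- exact: measurable_funM.
- exact: measurable_funM.
- apply: (orliczL_le eM _ mDv) => //; first exact: measurable_funM.
  by move=> p; rewrite normrM ler_piMl.
pose K := C + 2 * 1.
have K0 : 0 <= K by rewrite addr_ge0.
have w0 (p : Rn * Rn) : 0 <= frac_factor s p := frac_decay_ge0 s _.
have w1 (p : Rn * Rn) : frac_factor s p <= 1 := frac_decay_le1 s01 _.
have mvw : measurable_fun setT (fun p : Rn * Rn => v p.2 * frac_factor s p) by exact: measurable_funM.
apply: (@orliczL_le _ _ _ _ _ eM _ (fun p => K * (v p.2 * frac_factor s p))).
- exact: measurable_funM.
- exact: measurable_funM.
- move=> p; have -> : `|K * (v p.2 * frac_factor s p)| = `|v p.2| * (K * frac_factor s p).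
    by rewrite normrM (ger0_norm K0) (normrM (v p.2)) (ger0_norm (w0 p)) mulrCA.
  by rewrite normrM ler_wpM2l// fracD_lip_le.
apply: orliczLZ => //; have [_ [k k0 vk]] := Lv.
have mMv : measurable_fun setT (fun x => M (v x / k)).
  by apply: even_convex_comp => //; exact: measurable_funM.
apply: (measurable_orliczL mvw k0).
have := frac_factor_integrable2 n0 s01 mMv (fun x => even_convex_ge0 eM _) vk.
apply: le_lt_trans; apply: ge0_le_integral => //.
- by move=> p _; rewrite lee_fin even_convex_ge0.
- by apply/measurable_EFinP; apply: even_convex_comp => //; exact: measurable_funM.
- apply/measurable_EFinP; apply: measurable_funM => //.
  exact: (measurableT_comp mMv measurable_snd).
- move=> p _; rewrite lee_fin (_ : v p.2 * _ / k = frac_factor s p * (v p.2 / k)); last by ring.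
  by rewrite [leRHS]mulrC even_convex_shrink// w0 w1.
Qed.

End frac_sobolev.

(** * Translations and convolutions *)

Section real_fubini.
Context d1 d2 (T : measurableType d1) (Y : measurableType d2) (R : realType).
Variables (m1 : {sigma_finite_measure set T -> \bar R}) (m2 : {sigma_finite_measure set Y -> \bar R}).

(** A bound [C] uniform in [y], together with the integrability of [phi], gives joint integrability.
    In the application the uniformity comes from the invariance of modulars under translation. *)
Lemma Rintegral_fubini (phi : Y -> R) (K : T -> R) (W : T * Y -> R) (C : R) :
  measurable_fun setT K -> measurable_fun setT W -> m2.-integrable setT (EFin \o phi) ->
  (forall y, m1.-integrable setT (EFin \o (fun t => K t * W (t, y))) /\
    \int[m1]_t `|K t * W (t, y)| <= C) ->
  (forall t, m2.-integrable setT (EFin \o (fun y => phi y * W (t, y)))) ->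
  [/\ m2.-integrable setT (EFin \o (fun y => phi y * \int[m1]_t (K t * W (t, y)))),
      m1.-integrable setT (EFin \o (fun t => K t * \int[m2]_y (phi y * W (t, y)))) &
      \int[m2]_y (phi y * \int[m1]_t (K t * W (t, y))) =
      \int[m1]_t (K t * \int[m2]_y (phi y * W (t, y)))].
Proof.
move=> mK mW iphi KW phiW; have mphi := measurable_integrable iphi.
pose f (q : T * Y) := (K q.1 * (phi q.2 * W q))%:E.
have mf : measurable_fun setT f.
  apply/measurable_EFinP; apply: measurable_funM; first exact: measurableT_comp.
  by apply: measurable_funM => //; exact: measurableT_comp.
have fi : (m1 \x m2)%E.-integrable setT f.
  apply/(integrable21ltyP m1 m2 mf).
  apply: (@le_lt_trans _ _ (\int[m2]_y (C%:E * `|(phi y)%:E|))%E).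
    apply: ge0_le_integral => //.
    - by move=> y _; apply: integral_ge0.
    - apply: (@measurable_fun_fubini_tonelli_G _ _ _ _ _ m1 (abse \o f)) => //;
        [exact: measurableT_comp|by move=> q /=].
    - apply: emeasurable_funM => //; apply: measurableT_comp => //; exact/measurable_EFinP.
    - move=> y _; have [iKW leC] := KW y.
      have iaKW := integrable_norm iKW.
      rewrite (eq_integral (fun t => (`|phi y| * `|K t * W (t, y)|)%:E)); last first.
        by move=> t _; rewrite /f/= -!normrM; congr (`|_|%:E); ring.
      under eq_integral do rewrite EFinM.
      rewrite ge0_integralZl_EFin//; last by have := measurable_int _ iaKW.
      by rewrite -(Rintegral_EFin iaKW) -!EFinM lee_fin mulrC ler_wpM2r.
  have [_ foo] := integrableP _ _ _ iphi.
  have C0 : 0 <= C.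
    have [y|ny] := pselect (inhabited Y); last first.
      by exfalso; apply: ny; exact: (inhabits point).
    by case: y => y; case: (KW y) => _; apply: le_trans; exact: Rintegral_ge0.
  rewrite ge0_integralZl_EFin//; last by apply: measurableT_comp => //; exact/measurable_EFinP.
  by rewrite lte_mul_pinfty.
have FE : fubini_F m2 f = EFin \o (fun t => K t * \int[m2]_y (phi y * W (t, y))).
  apply/funext => t; rewrite /fubini_F /f /= -RintegralZl// -Rintegral_EFin//.
  exact: integrable_EFinZ.
have GE : fubini_G m1 f = EFin \o (fun y => phi y * \int[m1]_t (K t * W (t, y))).
  apply/funext => y; rewrite /fubini_G /f /=.
  have [iKW _] := KW y.
  rewrite -RintegralZl// Rintegral_EFin//; last exact: integrable_EFinZ.
  by apply: eq_integral => t _; congr EFin; ring.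
split.
- have mG : measurable_fun setT (fun y => phi y * \int[m1]_t (K t * W (t, y))).
    have mG := measurable_fubini_G fi.
    by apply/measurable_EFinP; rewrite -GE; exact: mG.
  apply: (le_integrable_EFin mG _ (integrable_EFinZ C (integrable_norm iphi))) => y.
  have [iKW KWC] := KW y; rewrite normrM mulrC ler_wpM2r//.
  by apply: le_trans KWC; exact: le_normr_Rintegral.
- by rewrite -FE; exact: integrable_fubini_F.
- have := Fubini fi; rewrite -/(fubini_F m2 f) /Rintegral => e; congr fine.
  transitivity (\int[m2]_y fubini_G m1 f y)%E; first by rewrite GE.
  by transitivity (\int[m1]_t fubini_F m2 f t)%E; [rewrite -e|rewrite FE].
Qed.

End real_fubini.

Section generalized_dct.
Context d (T : measurableType d) (R : realType) (mu : {measure set T -> \bar R}).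

(* Fatou applied to [Z_i + |f| - |f_i - f| >= 0]. *)
Lemma generalized_dominated_cvg (f_ Z_ : nat -> T -> R) (f Z : T -> R) (z : R) :
  (forall i, measurable_fun setT (f_ i)) -> measurable_fun setT f ->
  {ae mu, forall x, f_ i x @[i --> \oo] --> f x} ->
  (forall i x, `|f_ i x| <= Z_ i x) ->
  {ae mu, forall x, Z_ i x @[i --> \oo] --> Z x} ->
  (forall i, mu.-integrable setT (EFin \o Z_ i)) -> mu.-integrable setT (EFin \o Z) ->
  (forall i, \int[mu]_x Z_ i x = z) -> \int[mu]_x Z x = z ->
  \int[mu]_x f_ i x @[i --> \oo] --> \int[mu]_x f x.
Proof.
move=> mf_ mf ff fZ ZZ iZ_ iZ eZ_ eZ.
have fZa : {ae mu, forall x, `|f x| <= Z x}.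
  apply: filterS2 ff ZZ => x fx Zx; apply: (ler_cvg_to (cvg_norm fx) Zx).
  by apply: nearW => i; exact: fZ.
have mZ := measurable_integrable iZ.
have ifn i : mu.-integrable setT (EFin \o f_ i) by apply: (le_integrable_EFin _ (fZ i)).
have fi : mu.-integrable setT (EFin \o f).
  apply/integrableP; split; first exact/measurable_EFinP.
  have [_] := integrableP _ _ _ iZ; apply: le_lt_trans.
  apply: ae_ge0_le_integral => //.
  - by apply: measurableT_comp => //; exact/measurable_EFinP.
  - by apply: measurableT_comp => //; exact/measurable_EFinP.
  - by apply: filterS fZa => x h _ /=; rewrite lee_fin (le_trans h)// ler_norm.
have ifa := integrable_norm fi.
pose h i x := Z_ i x + `|f x| - `|f_ i x - f x|.
have ida i : mu.-integrable setT (EFin \o (fun x => `|f_ i x - f x|)).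
  exact/(integrable_norm (f := fun x => f_ i x - f x))/integrable_EFinB.
have ih i : mu.-integrable setT (EFin \o h i) by apply: integrable_EFinB => //; exact: integrable_EFinD.
have h0 i x : 0 <= h i x.
  rewrite subr_ge0; apply: (le_trans (ler_normB _ _)); rewrite lerD2r; exact: fZ.
pose e i := \int[mu]_x `|f_ i x - f x|.
pose A := z + \int[mu]_x `|f x|.
have eh i : (\int[mu]_x (h i x)%:E = (A - e i)%:E)%E.
  rewrite -Rintegral_EFin//; congr EFin.
  by rewrite RintegralB ?RintegralD ?eZ_//; exact: integrable_EFinD.
have fat : (A%:E <= limn_einf (fun i => (A - e i)%:E))%E.
  have -> : (A%:E = \int[mu]_x (Z x + `|f x|)%:E)%E.
    rewrite -Rintegral_EFin; last exact: integrable_EFinD.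
    by rewrite RintegralD// eZ.
  rewrite (_ : \int[mu]_x _ = \int[mu]_x limn_einf (fun i => (h i x)%:E))%E; last first.
    apply: ae_integral_eq; apply: filterS2 ff ZZ => x fx Zx.
    have : (h i x)%:E @[i --> \oo] --> (Z x + `|f x|)%:E.
      apply: cvg_EFin; first exact: nearW.
      have : h i x @[i --> \oo] --> Z x + `|f x| - `|f x - f x|.
        apply: cvgB; first by apply: cvgD => //; exact: cvg_cst.
        by apply: cvg_norm; apply: cvgB => //; exact: cvg_cst.
      by rewrite subrr normr0 subr0.
    by move=> /cvg_limn_einf_sup[->].
  apply: (@le_trans _ _ (limn_einf (fun i => \int[mu]_x (h i x)%:E)%E)).
    by apply: fatou => // [i|i x _]; [exact: measurable_int (ih i)|rewrite lee_fin].
  by under eq_fun do rewrite eh.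
have e0 i : 0 <= e i by apply: Rintegral_ge0.
have e_0 : e i @[i --> \oo] --> 0.
  apply/cvgrPdist_le => r r0.
  have sup : (limn_esup (fun i => (- (A - e i))%:E) <= (- A)%:E)%E.
    have := limn_esupN (fun i => (A - e i)%:E) => E; rewrite (_ : (fun i => _) = -%E \o (fun i => (A - e i)%:E))//.
    by rewrite E EFinN leeN2.
  apply: filterS (limn_esup_near r0 sup) => i.
  by rewrite sub0r normrN ger0_norm//; lra.
apply/cvgrPdist_le => r r0; move/cvgrPdist_le: e_0 => /(_ _ r0).
apply: filterS => i; rewrite sub0r normrN ger0_norm// => er.
rewrite distrC -RintegralB//; apply: le_trans er.
by apply: le_normr_Rintegral => //; exact: integrable_EFinB.
Qed.

End generalized_dct.

(* Instances: [D v = v] on [R^n], and [D v = fracD s v] on [R^n * R^n] with the diagonal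
   translations. *)
Section translation_operator.
Context {R : realType} (n : nat) d (T : measurableType d).
Local Notation Rn := 'rV[R]_n.
Local Notation leb := (@lebesgue_rV R n).
Variable m : {sigma_finite_measure set T -> \bar R}.
Variables (sh : Rn -> T -> T) (D : (Rn -> R) -> T -> R).
Hypothesis msh : measurable_fun setT (fun q : T * Rn => sh q.2 q.1).
Hypothesis psh : forall k A, measurable A -> m (sh k @^-1` A) = m A.
Hypothesis mD : forall v, measurable_fun setT v -> measurable_fun setT (D v).
Hypothesis Dsh : forall v k t, D (fun x => v (x + k)) t = D v (sh k t).
Hypothesis Dint : forall (phi : Rn -> R) (W : Rn -> Rn -> R),
  (forall x, leb.-integrable setT (EFin \o (fun z => phi z * W x z))) ->
  forall t, leb.-integrable setT (EFin \o (fun z => phi z * D (W^~ z) t)) /\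
    D (fun x => \int[leb]_z (phi z * W x z)) t = \int[leb]_z (phi z * D (W^~ z) t).
Hypothesis Dae : forall (v_ : nat -> Rn -> R) v,
  {ae leb, forall x, v_ i x @[i --> \oo] --> v x} ->
  {ae m, forall t, D (v_ i) t @[i --> \oo] --> D v t}.
Variables (M N : R -> R) (K : T -> R).
Hypothesis MN : conjugate_pair M N.
Hypothesis mK : measurable_fun setT K.
Hypothesis LK : orliczL m N K.

Let msh1 k : measurable_fun setT (sh k).
Proof. exact: (measurableT_comp msh (pair2_measurable k)). Qed.

Let mcomp (w : T -> R) (k : Rn) a : measurable_fun setT w ->
  (\int[m]_t (M (w (sh k t) / a))%:E = \int[m]_t (M (w t / a))%:E)%E.
Proof.
move=> mw; have [eM _ _ _ _] := MN.
apply: (ge0_integral_preserving (msh1 k) (psh k) (f := fun t => (M (w t / a))%:E)).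
  by apply/measurable_EFinP; apply: even_convex_comp => //; exact: measurable_funM.
by move=> t; rewrite lee_fin even_convex_ge0.
Qed.

Let holder_shift (w : T -> R) : measurable_fun setT w -> orliczL m M w ->
  exists C, forall k, m.-integrable setT (EFin \o (fun t => K t * w (sh k t))) /\
    \int[m]_t `|K t * w (sh k t)| <= C.
Proof.
move=> mw Lw; have [eM eN _ _ _] := MN.
have [a [a0 [al Ka]]] := orliczL_bound eN LK.
have [b [b0 [be wb]]] := orliczL_bound eM Lw.
exists (a * b * (al + be)) => k.
have mwk : measurable_fun setT (fun t => w (sh k t)) by exact: measurableT_comp.
apply: (orlicz_holder (conjugate_pairC MN) mK mwk a0 b0 Ka).
by rewrite /modular mcomp.
Qed.

(** Both sides are the integral of [K] against [D] applied to the convolution of [v] and [rho],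
    translated by [k]. Fubini's theorem is used on each side, [D] commutes with the averages, and
    the change of variable uses that [rho] is even. *)
Lemma translation_convolution (v rho : Rn -> R) (B : R) (k : Rn) :
  measurable_fun setT rho -> leb.-integrable setT (EFin \o v) ->
  leb.-integrable setT (EFin \o rho) -> (forall h, `|rho h| <= B) ->
  (forall h, rho (- h) = rho h) -> orliczL m M (D v) -> orliczL m M (D rho) ->
  [/\ leb.-integrable setT (EFin \o (fun h => rho h * \int[m]_t (K t * D (fun x => v (x + (h - k))) t))),
      leb.-integrable setT (EFin \o (fun z => v z * \int[m]_t (K t * D (fun x => rho (x - (k + z))) t))) &
      \int[leb]_h (rho h * \int[m]_t (K t * D (fun x => v (x + (h - k))) t)) =
      \int[leb]_z (v z * \int[m]_t (K t * D (fun x => rho (x - (k + z))) t))].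
Proof.
move=> mrho iv irho rhoB rhoN Lv Lrho; have mv := measurable_integrable iv.
have mDv := mD mv; have mDr := mD mrho.
have msh' (A : Rn -> Rn) : measurable_fun setT A ->
    measurable_fun setT (fun q : T * Rn => sh (A q.2) q.1).
  move=> mA; have mp : measurable_fun setT (fun q : T * Rn => (q.1, A q.2)).
    by apply: measurable_fun_pair => //; exact: measurableT_comp.
  exact: (measurableT_comp msh mp).
have [C1 H1] := holder_shift mDv Lv; have [C2 H2] := holder_shift mDr Lrho.
have i1 x : leb.-integrable setT (EFin \o (fun h => rho h * v (x + (h - k)))).
  have mvx : leb.-integrable setT (EFin \o (fun h => B * `|v (h + (x - k))|)).
    apply: integrable_EFinZ; apply: integrable_norm.
    exact: (integrable_preserving (measurable_rV_shift _) (lebesgue_rV_shift (x - k)) iv).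
  apply: (le_integrable_EFin _ _ mvx).
    apply: measurable_funM => //; apply: (measurableT_comp mv).
    rewrite (_ : (fun _ => _) = (fun h => h + (x - k))); first exact: measurable_rV_shift.
    by apply/funext => h; rewrite addrCA.
  by move=> h; rewrite normrM addrCA ler_wpM2r.
have mopp (y : Rn) : measurable_fun setT (fun z : Rn => - (y + z)).
  apply: measurable_fun_rV => i; under eq_fun do rewrite !mxE.
  by apply: measurableT_comp => //; apply: measurable_funD => //; exact: measurable_coord.
have i2 x : leb.-integrable setT (EFin \o (fun z => v z * rho (x - (k + z)))).
  apply: (le_integrable_EFin _ _ (integrable_EFinZ B (integrable_norm iv))).
    apply: measurable_funM => //; apply: (measurableT_comp mrho).
    rewrite (_ : (fun _ => _) = (fun z => - ((k - x) + z))); first exact: mopp.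
    by apply/funext => z; apply/rowP => i; rewrite !mxE; ring.
  by move=> z; rewrite normrM mulrC ler_wpM2r.
pose Phi x := \int[leb]_z (v z * rho (x - (k + z))).
have PhiE x : \int[leb]_h (rho h * v (x + (h - k))) = Phi x.
  rewrite /Phi -(Rintegral_preserving (measurable_rV_shift _) (lebesgue_rV_shift (x - k))
    (f := fun z => v z * rho (x - (k + z)))); last by have := measurable_integrable (i2 x).
  apply: eq_Rintegral => h _; rewrite mulrC addrCA -(rhoN h); congr (_ * rho _).
  by apply/rowP => i; rewrite !mxE; ring.
have W1E h : D (fun x => v (x + (h - k))) = (fun t => D v (sh (h - k) t)).
  by apply/funext => t; exact: Dsh.
have W2E z : D (fun x => rho (x - (k + z))) = (fun t => D rho (sh (- (k + z)) t)).
  by apply/funext => t; exact: Dsh.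
have mW1 : measurable_fun setT (fun q : T * Rn => D (fun x => v (x + (q.2 - k))) q.1).
  under eq_fun do rewrite Dsh; apply: (measurableT_comp mDv).
  by apply: (msh' (fun h => h - k)); exact: measurable_rV_shift.
have mW2 : measurable_fun setT (fun q : T * Rn => D (fun x => rho (x - (k + q.2))) q.1).
  under eq_fun do rewrite Dsh; apply: (measurableT_comp mDr).
  by apply: (msh' (fun z => - (k + z))); exact: mopp.
have [j1 _ e1] : [/\ leb.-integrable setT (EFin \o (fun h => rho h * \int[m]_t (K t * D (fun x => v (x + (h - k))) t))),
    m.-integrable setT (EFin \o (fun t => K t * \int[leb]_h (rho h * D (fun x => v (x + (h - k))) t))) &
    \int[leb]_h (rho h * \int[m]_t (K t * D (fun x => v (x + (h - k))) t)) =
    \int[m]_t (K t * \int[leb]_h (rho h * D (fun x => v (x + (h - k))) t))].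
  apply: (Rintegral_fubini (C := C1) mK mW1 irho) => [h|t]; last exact: (proj1 (Dint i1 t)).
  by rewrite /= W1E; exact: H1.
have [j2 _ e2] : [/\ leb.-integrable setT (EFin \o (fun z => v z * \int[m]_t (K t * D (fun x => rho (x - (k + z))) t))),
    m.-integrable setT (EFin \o (fun t => K t * \int[leb]_z (v z * D (fun x => rho (x - (k + z))) t))) &
    \int[leb]_z (v z * \int[m]_t (K t * D (fun x => rho (x - (k + z))) t)) =
    \int[m]_t (K t * \int[leb]_z (v z * D (fun x => rho (x - (k + z))) t))].
  apply: (Rintegral_fubini (C := C2) mK mW2 iv) => [z|t]; last exact: (proj1 (Dint i2 t)).
  by rewrite /= W2E; exact: H2.
split => //; rewrite e1 e2; apply: eq_Rintegral => t _; congr (_ * _).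
rewrite -(proj2 (Dint i1 t)) -(proj2 (Dint i2 t)); congr (D _ t).
by apply/funext => x; exact: PhiE.
Qed.

(** Young's inequality dominates the integrands by functions that vary with [i] but keep the same
    integral, since translations preserve modulars. The generalised dominated convergence theorem
    therefore applies although [D v] is only in L_M. *)
Lemma translation_cvg (v : Rn -> R) (k_ : nat -> Rn) : measurable_fun setT v ->
  orliczL m M (D v) -> {ae leb, forall x, v (x - k_ i) @[i --> \oo] --> v x} ->
  \int[m]_t (K t * D (fun x => v (x - k_ i)) t) @[i --> \oo] --> \int[m]_t (K t * D v t).
Proof.
move=> mv Lv vk; have mDv := mD mv; have [eM eN _ _ _] := MN.
have [_ [a a0 Ka]] := LK; have [_ [b b0 vb]] := Lv.
have mKa : measurable_fun setT (fun t => K t / a) by exact: measurable_funM.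
have mvb (w : T -> R) : measurable_fun setT w -> measurable_fun setT (fun t => w t / b).
  by move=> mw; exact: measurable_funM.
have mDk i : measurable_fun setT (D (fun x => v (x - k_ i))).
  by apply: mD; exact: (measurableT_comp mv (measurable_rV_shift _)).
have DE i : D (fun x => v (x - k_ i)) = (fun t => D v (sh (- k_ i) t)).
  by apply/funext => t; exact: Dsh.
have iK := modular_integrable eN mKa Ka.
have modk i : modular m M (fun t => D (fun x => v (x - k_ i)) t / b) = modular m M (fun t => D v t / b).
  by rewrite DE /modular mcomp.
have iD i : m.-integrable setT (EFin \o (fun t => M (D (fun x => v (x - k_ i)) t / b))).
  by apply: modular_integrable => //; [exact: mvb|rewrite modk].
have iDv : m.-integrable setT (EFin \o (fun t => M (D v t / b))).
  by apply: modular_integrable => //; exact: mvb.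
have Dk := Dae vk.
apply: (@generalized_dominated_cvg _ _ _ m _
  (fun i t => a * b * (N (K t / a) + M (D (fun x => v (x - k_ i)) t / b))) _
  (fun t => a * b * (N (K t / a) + M (D v t / b)))
  (a * b * (\int[m]_t N (K t / a) + \int[m]_t M (D v t / b)))).
- by move=> i; exact: measurable_funM.
- exact: measurable_funM.
- by apply: filterS Dk => t ?; apply: cvgM => //; exact: cvg_cst.
- by move=> i t; exact: (young_scale (conjugate_pairC MN)).
- apply: filterS Dk => t Dt; apply: cvgM; first exact: cvg_cst.
  apply: cvgD; first exact: cvg_cst.
  apply: continuous_cvg; first exact: even_convex_continuous.
  by apply: cvgM => //; exact: cvg_cst.
- by move=> i; apply: integrable_EFinZ; exact: integrable_EFinD.
- by apply: integrable_EFinZ; exact: integrable_EFinD.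
- move=> i; rewrite RintegralZl ?RintegralD//; last exact: integrable_EFinD.
  by congr (_ * (_ + _)); rewrite /Rintegral -/(modular m M _) modk.
- by rewrite RintegralZl ?RintegralD//; exact: integrable_EFinD.
Qed.

End translation_operator.

(** * Smooth mollifiers and test functions *)

Section flat.
Context {R : realType}.

Definition bexp (P : {poly R}) (t : R) : R := if 0 < t then P.[t^-1] * expR (- t^-1) else 0.

Lemma is_derive_bexp_pos (P : {poly R}) (t : R) : 0 < t ->
  is_derive t 1 (bexp P) (bexp ('X^2 * (P - P^`())) t).
Proof.
move=> t0; have tn0 : t != 0 by rewrite gt_eqF.
have dV : is_derive t 1 (fun x : R => x^-1) (- t ^- 2).
  by have := is_deriveV tn0 (is_derive_id t 1); rewrite scaler1.
have dP := is_derive1_comp (is_derive_poly P t^-1) dV.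
have dN : is_derive t 1 (fun x : R => - x^-1) (- - t ^- 2) := is_deriveN dV.
have dE := @is_derive1_comp R expR (fun x : R => - x^-1) t _ _ (is_derive_expR (- t^-1)) dN.
have dM := is_deriveM dP dE.
apply: (near_eq_is_derive (f := (horner P \o (fun x => x^-1)) * (expR \o (fun x => - x^-1)))).
  near=> x; rewrite /bexp ifT//; near: x; exact: lt_nbhsr.
apply: is_derive_eq dM _; rewrite /bexp t0 !hornerE /= ; rewrite /GRing.scale/=.
by field.
Unshelve. all: by end_near. Qed.

(** The quadratic bound makes the difference quotient at 0 vanish in the limit, where the formula
    for the derivative gives 0 as well. *)
Lemma bexp_le (P : {poly R}) : exists2 C, 0 <= C & forall t, `|bexp P t| <= C * t ^+ 2.
Proof.
pose d := size P; pose c : R := \sum_(i < d) `|P`_i|.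
have c0 : 0 <= c by apply: sumr_ge0.
(* The two terms [x^2] and [x^(d+2)] are bounded by [2! * expR x] and [(d+2)! * expR x], from single
   terms of the exponential series. *)
have [E E0 HE] : exists2 E : R, 0 <= E & forall x, 0 <= x -> (1 + x ^+ d) * x ^+ 2 <= E * expR x.
  exists (2%:R + (d.+2)`!%:R); first by rewrite addr_ge0.
  move=> x x0; have ge (m : nat) : x ^+ m.+1 <= m.+1`!%:R * expR x.
    have := expR_ge1Dxn m x0; have f0 : 0 < m.+1`!%:R :> R by rewrite ltr0n fact_gt0.
    move=> H; apply: (@le_trans _ _ (m.+1`!%:R * (1 + x ^+ m.+1 / m.+1`!%:R))); last by rewrite ler_pM2l.
    by rewrite mulrDr mulrCA divff ?gt_eqF// mulr1 mulr1 lerDr ltW.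
  have h1 := ge 1%N; have h2 := ge d.+1.
  rewrite mulrDl mul1r -exprD addn2 mulrDl lerD//.
have bP x : 0 <= x -> `|P.[x]| <= c * (1 + x ^+ d).
  move=> x0; rewrite horner_coef; apply: (le_trans (ler_norm_sum _ _ _)).
  rewrite /c mulr_suml; apply: ler_sum => i _; rewrite normrM ler_wpM2l//.
  rewrite normrX (ger0_norm x0); have [x1|x1] := leP x 1.
    by apply: (@le_trans _ _ 1); [exact: exprn_ile1|rewrite lerDl exprn_ge0].
  by apply: (@le_trans _ _ (x ^+ d)); [rewrite ler_eXn2l// ltnW|rewrite lerDr].
exists (c * E); first exact: mulr_ge0.
move=> t; rewrite /bexp; case: ifPn => t0; last by rewrite normr0 mulr_ge0 ?sqr_ge0// mulr_ge0.
set x := t^-1; have x0 : 0 < x by rewrite invr_gt0.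
have -> : t = x^-1 by rewrite invrK.
rewrite normrM (gtr0_norm (expR_gt0 _)) expRN exprVn.
rewrite ler_pdivrMr ?expR_gt0// mulrAC ler_pdivlMr ?exprn_gt0//.
apply: (@le_trans _ _ (c * (1 + x ^+ d) * x ^+ 2)); first by rewrite ler_wpM2r ?sqr_ge0// bP// ltW.
by rewrite -!mulrA ler_wpM2l// HE// ltW.
Qed.

Lemma is_derive_bexp (P : {poly R}) (t : R) :
  is_derive t 1 (bexp P) (bexp ('X^2 * (P - P^`())) t).
Proof.
have [t0|t0|t0] := ltgtP t 0; last 2 first.
- exact: is_derive_bexp_pos.
- have [C C0 HC] := bexp_le P.
  have q : (fun h => h^-1 *: ((bexp P \o shift t) (h *: (1 : R)) - bexp P t)) @ 0^' --> (0 : R).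
    apply/cvgrPdist_le => e e0; near=> h.
    have hn0 : h != 0 by near: h; exact: nbhs_dnbhs_neq.
    have hC : C * `|h| <= e.
      have h1 : `|h| <= e / (C + 1).
        near: h; apply: dnbhs0_le; rewrite divr_gt0// ltr_wpDl//.
      apply: (@le_trans _ _ ((C + 1) * `|h|)); first by rewrite ler_wpM2r// lerDl.
      by rewrite mulrC -ler_pdivlMr// ltr_wpDl.
    rewrite sub0r normrN /= t0 addr0 {2}/bexp ltxx subr0 /GRing.scale/= mulr1 normrM.
    apply: (le_trans (ler_wpM2l (normr_ge0 _) (HC h))).
    apply: le_trans hC; rewrite -real_normK ?num_real// normfV mulrCA expr2 mulKf ?normr_eq0//.
  have -> : bexp ('X^2 * (P - P^`())) t = 0 by rewrite /bexp t0 ltxx.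
  split; first by apply/cvg_ex; exists 0.
  by apply: cvg_lim.
- have -> : bexp ('X^2 * (P - P^`())) t = 0 by rewrite /bexp ltNge (ltW t0).
  have nf : \forall x \near t, cst (0 : R) x = bexp P x.
    near=> x; rewrite /bexp ltNge (_ : x <= 0)//; apply: ltW; near: x; exact: lt_nbhsl.
  exact: near_eq_is_derive nf (is_derive_cst _ _ _).
Unshelve. all: by end_near. Qed.

(** Closed under differentiation by the chain and product rules, so one derivative at a time already
    gives smoothness of every order. *)
Inductive flat : (R -> R) -> Prop :=
| flat_bexp P a b : flat (fun t => bexp P (a + b * t))
| flatD f g : flat f -> flat g -> flat (f \+ g)
| flatM f g : flat f -> flat g -> flat (f \* g).

Lemma flat_derive f : flat f -> exists2 f', flat f' & forall t : R, is_derive t 1 f (f' t).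
Proof.
elim=> [P a b|{}f g ff [f' ff' df] fg [g' fg' dg]|{}f g ff [f' ff' df] fg [g' fg' dg]].
- exists (fun t => bexp (b *: ('X^2 * (P - P^`()))) (a + b * t)); first exact: flat_bexp.
  move=> t; have d1 : is_derive t 1 (fun x : R => a + b * x) b.
    have d2 := is_deriveD (is_derive_cst a t 1) (is_deriveZ b (is_derive_id t (1 : R))).
    by apply: is_derive_eq d2 _; rewrite add0r /GRing.scale/= mulr1.
  have := @is_derive1_comp R (bexp P) (fun x => a + b * x) t _ _ (is_derive_bexp P (a + b * t)) d1 => d3.
  by apply: is_derive_eq d3 _; rewrite /bexp; case: ifP => _; rewrite ?mul0r// hornerZ; ring.
- by exists (f' \+ g'); [exact: flatD|move=> t; exact: is_deriveD].
- exists ((f \* g') \+ (g \* f')); first by apply: flatD; exact: flatM.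
  by move=> t; have := is_deriveM (df t) (dg t).
Qed.

End flat.

Section product_functions.
Context {R : realType} (n : nat).
Local Notation Rn := 'rV[R]_n.

(** A partial derivative changes a single factor and keeps it flat, so iterated partial derivatives
    stay in the class. *)
Definition flat_prod (u : Rn -> R) : Prop := exists2 psi : 'I_n -> R -> R,
  forall i, flat (psi i) & u = fun x => \prod_i psi i (x ord0 i).

Lemma flat_prod_differentiable u x : flat_prod u -> differentiable u x.
Proof.
move=> [psi fpsi ->].
suff: forall r : seq 'I_n, differentiable (fun x : Rn => \prod_(i <- r) psi i (x ord0 i)) x by exact.
elim=> [|i r IH].
  by under eq_fun do rewrite big_nil; exact: differentiable_cst.
under eq_fun do rewrite big_cons.
apply: differentiableM => //.
apply: (differentiable_comp (f := fun x : Rn => x ord0 i) (g := psi i)); first exact: differentiable_coord.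
by apply/derivable1_diffP; have [f' _ df] := flat_derive (fpsi i); exact: ex_derive.
Qed.

Lemma flat_prod_derive u i : flat_prod u -> flat_prod ('D_(delta_mx ord0 i) u).
Proof.
move=> [psi fpsi ->]; have [f' ff' df] := flat_derive (fpsi i).
exists (fun j => if j == i then f' else psi j); first by move=> j; case: ifP.
apply/funext => x; rewrite (bigD1 i)//= eqxx.
rewrite (eq_bigr (fun j => psi j (x ord0 j))); last by move=> j /negbTE ->.
pose C := \prod_(j | j != i) psi j (x ord0 j); rewrite -/C.
have -> : f' (x ord0 i) * C = 'D_1 (fun t => psi i t * C) (x ord0 i).
  have := is_deriveM (df (x ord0 i)) (is_derive_cst C (x ord0 i) 1) => d.
  by rewrite (@derive_val _ _ _ _ _ _ _ d) scaler0 add0r /GRing.scale/= mulrC.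
rewrite /derive (_ : (fun h : R => h^-1 *: _) = (fun h : R =>
    h^-1 *: (((fun t => psi i t * C) \o shift (x ord0 i)) (h *: (1 : R)) - psi i (x ord0 i) * C)))//.
apply/funext => h /=; congr (_ *: _).
have e : \prod_j psi j ((h *: delta_mx ord0 i + x) ord0 j) = psi i (h + x ord0 i) * C.
  rewrite (bigD1 i)//= !mxE !eqxx mulr1; congr (_ * _).
  by apply: eq_bigr => j ji; rewrite !mxE (negbTE ji) andbF mulr0 add0r.
by rewrite e /GRing.scale/= mulr1; congr (_ - _); rewrite (bigD1 i).
Qed.

Lemma flat_prod_smooth u : flat_prod u -> smooth u.
Proof.
move=> fu l x; apply: flat_prod_differentiable.
by elim: l => //= i l IH; exact: flat_prod_derive.
Qed.

(** A bump positive exactly on the open ball of radius [e] about [z] for the sup norm, when [e > 0].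
    Its integral is not normalised, since only signs and vanishing averages are read off it. *)
Definition mollifier (e : R) (z x : Rn) : R :=
  \prod_i (bexp 1 (e + z ord0 i - x ord0 i) * bexp 1 (e - z ord0 i + x ord0 i)).

Lemma bexp1_gt0 t : (0 < bexp (1 : {poly R}) t) = (0 < t).
Proof. by rewrite /bexp; case: ifP => _; rewrite ?ltxx// hornerC mul1r expR_gt0. Qed.

Lemma bexp1_ge0 t : 0 <= bexp (1 : {poly R}) t.
Proof. by rewrite /bexp; case: ifP => // _; rewrite hornerC mul1r expR_ge0. Qed.

Lemma bexp1_eq0 t : t <= 0 -> bexp (1 : {poly R}) t = 0.
Proof. by rewrite /bexp ltNge => ->. Qed.

Lemma mollifier_smooth e z : smooth (mollifier e z).
Proof.
apply: flat_prod_smooth.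
exists (fun i => (fun t => bexp 1 (e + z ord0 i + -1 * t)) \* (fun t => bexp 1 (e - z ord0 i + 1 * t))).
  by move=> i; apply: flatM; exact: flat_bexp.
by apply/funext => x; apply: eq_bigr => i _ /=; rewrite mulN1r mul1r.
Qed.

Lemma mollifier_ge0 e z x : 0 <= mollifier e z x.
Proof. by apply: prodr_ge0 => i _; rewrite mulr_ge0// bexp1_ge0. Qed.

Lemma mollifier_gt0 e z x : `|x - z| < e -> 0 < mollifier e z x.
Proof.
move=> xz; apply: prodr_gt0 => i _.
have := le_lt_trans (coord_le_norm (x - z) i) xz; rewrite !mxE ltr_norml => /andP[h1 h2].
by rewrite mulr_gt0// bexp1_gt0; lra.
Qed.

Lemma mollifier_eq0 e z x : 0 < e -> e <= `|x - z| -> mollifier e z x = 0.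
Proof.
move=> e0 exz; have [i hi] : exists i, e <= `|(x - z) ord0 i|.
  apply: contrapT => nex; have : `|x - z| < e.
    by apply: norm_lt_coord => // i; rewrite ltNge; apply/negP => h; apply: nex; exists i.
  by rewrite ltNge exz.
rewrite /mollifier (bigD1 i)//=; apply/eqP; rewrite mulf_eq0; apply/orP; left.
move: hi; rewrite !mxE leNgt ltr_norml negb_and -!leNgt => /orP[h|h].
  by rewrite (@bexp1_eq0 (e - _ + _)) ?mulr0//; lra.
by rewrite (@bexp1_eq0 (e + _ - _)) ?mul0r//; lra.
Qed.

Lemma mollifier_center e z x : mollifier e z x = mollifier e 0 (x - z).
Proof. by apply: eq_bigr => i _; rewrite !mxE; congr (bexp _ _ * bexp _ _); ring. Qed.

Lemma mollifierN e x : mollifier e 0 (- x) = mollifier e 0 x.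
Proof. by apply: eq_bigr => i _; rewrite !mxE mulrC; congr (bexp _ _ * bexp _ _); ring. Qed.

Lemma mollifier_test (Omega : set Rn) e z : 0 < e ->
  (forall x, `|x - z| <= e -> Omega x) -> test_function Omega (mollifier e z).
Proof.
move=> e0 zO; split; first exact: mollifier_smooth.
pose B : set Rn := [set x | `|x - z| <= e].
have cB : closed B.
  rewrite (_ : B = closed_ball z e); first exact: closed_ball_closed.
  by rewrite closed_ballE//; apply/seteqP; split => x; rewrite /B/closed_ball_/= distrC.
have sB : closure [set x | mollifier e z x != 0] `<=` B.
  rewrite [X in _ `<=` X](closure_id B).1//; apply: closureS => x /= hx; rewrite /B/= leNgt; apply/negP => /ltW h.
  by move/negP: hx; apply; apply/eqP; exact: mollifier_eq0.
split; last by move=> x /sB; exact: zO.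
apply: (subclosed_compact _ _ sB); first exact: closed_closure.
apply: bounded_closed_compact => //.
exists (`|z| + e); split; first exact: num_real.
move=> r hr x Bx; apply: ltW; apply: le_lt_trans hr.
by rewrite -[x](subrK z) (le_trans (ler_normD _ _))// addrC lerD2l.
Qed.

End product_functions.

Section test_functions.
Context {R : realType} (n : nat).
Local Notation Rn := 'rV[R]_n.
Implicit Types phi : Rn -> R.

Lemma compact_support_bounded phi (K : set Rn) : continuous phi -> compact K ->
  (forall x, ~ K x -> phi x = 0) -> exists2 B, 0 <= B & forall x, `|phi x| <= B.
Proof.
move=> cphi cK phiK.
have /compact_bounded[B0 [_ HB]] : compact (phi @` K).
  by apply: continuous_compact => //; exact: continuous_subspaceT.
exists (`|B0| + 1); first by rewrite addr_ge0.
move=> x; have [Kx|nKx] := pselect (K x); last by rewrite phiK// normr0 addr_ge0.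
by apply: (HB (`|B0| + 1)); [rewrite ltr_pwDr// ler_norm|exists x].
Qed.

(** The partial derivatives are continuous and vanish off the support, hence are bounded. The mean
    value theorem on the segment between two points gives the sum of these bounds as Lipschitz
    constant for the sup norm. *)
Lemma test_function_lip (Omega : set Rn) phi : test_function Omega phi ->
  [/\ continuous phi, exists2 C, 0 <= C & forall x y, `|phi x - phi y| <= C * `|x - y|,
      exists2 B, 0 <= B & forall x, `|phi x| <= B &
      exists2 N, 0 <= N & forall x, ~ cube N x -> phi x = 0].
Proof.
move=> [sphi [cS SO]]; set S := closure _ in cS SO.
have phiS x : ~ S x -> phi x = 0.
  by move=> nS; apply/eqP; apply: contrapT => /negP h; apply: nS; exact: subset_closure.
have dphi x : differentiable phi x := sphi [::] x.
have cphi : continuous phi by move=> x; exact/differentiable_continuous.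
have bphi := compact_support_bounded cphi cS phiS.
have [N0 [_ HN]] := compact_bounded cS.
have bD i : exists B, 0 <= B /\ forall x, `|'D_(delta_mx ord0 i) phi x| <= B.
  have [|x nS|B B0 HB] := compact_support_bounded (phi := 'D_(delta_mx ord0 i) phi) _ cS.
  - by move=> x; exact/differentiable_continuous/(sphi [:: i]).
  - rewrite -(derive_cst (0 : R) x (delta_mx ord0 i)); apply: near_eq_derive.
    have oS : open (~` S) by apply: closed_openC; exact: closed_closure.
    by apply: filterS (open_nbhs_nbhs (conj oS nS)) => y; exact: phiS.
  - by exists B.
have [B HB] := choice bD.
have B0 i : 0 <= B i by case: (HB i).
split => //; last first.
  exists (`|N0| + 1); first by rewrite addr_ge0.
  move=> x nx; apply: phiS => Sx; apply: nx; apply/cubeP; first by rewrite addr_ge0.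
  by apply: (HN (`|N0| + 1)) => //; rewrite ltr_pwDr// ler_norm.
exists (\sum_i B i); first exact: sumr_ge0.
move=> y x; pose v := y - x; pose h t := phi (t *: v + x).
have dh (t : R) : is_derive t 1 h ('D_v phi (t *: v + x)).
  have e : (fun k : R => k^-1 *: ((h \o shift t) (k *: (1 : R)) - h t)) =
      (fun k : R => k^-1 *: ((phi \o shift (t *: v + x)) (k *: v) - phi (t *: v + x))).
    apply/funext => k /=; congr (_ *: (_ - _)); rewrite /h; congr phi.
    by rewrite /GRing.scale/= mulr1 -/(GRing.scale _ _) scalerDl addrA.
  have dv : derivable phi (t *: v + x) v by exact: diff_derivable.
  by split; rewrite /derivable /derive e.
have ch : {within `[0, 1], continuous h}.
  apply: continuous_subspaceT => t; apply/differentiable_continuous/derivable1_diffP.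
  exact: ex_derive.
have [c _] := @MVT R h (fun t => 'D_v phi (t *: v + x)) 0 1 ltr01 (fun t _ => dh t) ch.
rewrite /h scale1r scale0r add0r subrK subr0 mulr1 => ->.
move: (c *: v + x) => p; rewrite deriveE// [X in 'd phi _ X](row_sum_delta v) linear_sum; apply: (le_trans (ler_norm_sum _ _ _)).
rewrite mulr_suml; apply: ler_sum => i _; rewrite linearZ/= normrM mulrC ler_pM//.
  by rewrite -deriveE//; case: (HB i).
exact: coord_le_norm.
Qed.

End test_functions.

(** * Functionals annihilating the test functions *)

Lemma Rintegral_eq0 d (T : measurableType d) (R : realType) (mu : {measure set T -> \bar R})
    (f : T -> R) : (forall x, f x = 0) -> \int[mu]_x f x = 0.
Proof. by move=> f0; rewrite /Rintegral integral0_eq// => x _; rewrite f0. Qed.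

Lemma integral_pos_contra (R : realType) n (H : 'rV[R]_n -> R) (e : R) : 0 < e ->
  (lebesgue_rV n).-integrable setT (EFin \o H) -> \int[lebesgue_rV n]_h H h = 0 ->
  (forall h, 0 <= H h) -> (forall h, `|h| < e -> 0 < H h) -> False.
Proof.
move=> e0 iH H0 Hge Hgt; have mH := measurable_int _ iH.
have : (\int[lebesgue_rV n]_h `|(EFin \o H) h| = 0)%E.
  rewrite (eq_integral (EFin \o H)); last by move=> h _ /=; rewrite ger0_norm.
  by rewrite -(Rintegral_EFin iH) H0.
move=> /(ae_eq_integral_abs (lebesgue_rV n) measurableT mH)[Z [mZ Z0 HZ]].
have eh : 0 < e / 2 by rewrite divr_gt0.
have : (lebesgue_rV n (cube (e / 2)) <= lebesgue_rV n Z)%E.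
  apply: le_measure; rewrite ?inE//; first exact: measurable_cube.
  move=> h /cubeP he; apply: HZ => /= /(_ I) [] Hh.
  have he' : `|h| < e by apply: (le_lt_trans (he (ltW eh))); lra.
  by have := Hgt h he'; rewrite Hh ltxx.
have -> : lebesgue_rV n Z = 0%E by [].
by rewrite lebesgue_cube ?(ltW eh)// leNgt lte_fin exprn_gt0// pmulrn_lgt0.
Qed.

Section annihilator.
Context {R : realType} (n : nat) (s : R).
Hypothesis n0 : (0 < n)%N.
Hypothesis s01 : 0 < s < 1.
Variables M N : R -> R.
Hypothesis MN : conjugate_pair M N.
Local Notation Rn := 'rV[R]_n.
Local Notation leb := (@lebesgue_rV R n).
Local Notation nu := (@frac_measure R n).
Implicit Types (u v g : Rn -> R) (G : Rn * Rn -> R).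

Definition functional g G v : R :=
  \int[leb]_x (g x * v x) + \int[nu]_p (G p * fracD s v p).

Definition functional_data g G : Prop :=
  [/\ measurable_fun setT g, measurable_fun setT G, orliczL leb N g & orliczL nu N G].

Lemma measurable_addrV : measurable_fun setT (fun q : Rn * Rn => q.1 + q.2).
Proof.
apply: measurable_fun_rV => i; under eq_fun do rewrite mxE.
apply: measurable_funD.
  exact: (measurableT_comp (measurable_coord i) measurable_fst).
exact: (measurableT_comp (measurable_coord i) measurable_snd).
Qed.

Lemma measurable_pair_addrV : measurable_fun setT (fun q : (Rn * Rn) * Rn => (q.1.1 + q.2, q.1.2 + q.2)).
Proof.
apply: measurable_fun_pair.
  apply: (measurableT_comp measurable_addrV (_ : measurable_fun setT (fun q : (Rn * Rn) * Rn => (q.1.1, q.2)))).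
  by apply: measurable_fun_pair => //; exact: (measurableT_comp measurable_fst measurable_fst).
apply: (measurableT_comp measurable_addrV (_ : measurable_fun setT (fun q : (Rn * Rn) * Rn => (q.1.2, q.2)))).
by apply: measurable_fun_pair => //; exact: (measurableT_comp measurable_snd measurable_fst).
Qed.

Lemma fracD_Rintegral (phi : Rn -> R) (W : Rn -> Rn -> R) :
  (forall x, leb.-integrable setT (EFin \o (fun z => phi z * W x z))) ->
  forall p, leb.-integrable setT (EFin \o (fun z => phi z * fracD s (W^~ z) p)) /\
    fracD s (fun x => \int[leb]_z (phi z * W x z)) p = \int[leb]_z (phi z * fracD s (W^~ z) p).
Proof.
move=> iW p; pose c := (enorm (p.1 - p.2) `^ s)^-1.
have e : (fun z => phi z * fracD s (W^~ z) p) = (fun z => c * (phi z * W p.1 z - phi z * W p.2 z)).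
  by apply/funext => z; rewrite /fracD -/c; ring.
rewrite e; split; first by apply: integrable_EFinZ; exact: integrable_EFinB.
rewrite RintegralZl//; last exact: integrable_EFinB.
by rewrite RintegralB// /fracD -/c mulrC.
Qed.

Lemma fracD_cvg (v_ : nat -> Rn -> R) v : {ae leb, forall x, v_ i x @[i --> \oo] --> v x} ->
  {ae nu, forall p, fracD s (v_ i) p @[i --> \oo] --> fracD s v p}.
Proof.
move=> /frac_measure_ae; apply: filterS => p [h1 h2].
by apply: cvgM; [exact: cvgB|exact: cvg_cst].
Qed.

Definition convolution_leb g := @translation_convolution R n _ 'rV[R]_n leb (fun k x => x + k) (fun v => v)
  measurable_addrV (@lebesgue_rV_shift R n) (fun v mv => mv) (fun v k t => erefl)
  (fun phi W iW t => conj (iW t) erefl) M N g MN.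

Definition convolution_nu G := @translation_convolution R n _ ('rV[R]_n * 'rV[R]_n)%type nu
  (fun k p => (p.1 + k, p.2 + k)) (fracD s)
  measurable_pair_addrV (@frac_measure_shift R n) (@measurable_fracD R n s) (fun v k t => fracD_shift s k v t)
  fracD_Rintegral M N G MN.

Definition cvg_leb g := @translation_cvg R n _ 'rV[R]_n leb (fun k x => x + k) (fun v => v)
  measurable_addrV (@lebesgue_rV_shift R n) (fun v mv => mv) (fun v k t => erefl)
  (fun (v_ : nat -> Rn -> R) (v : Rn -> R) H => H) M N g MN.

Definition cvg_nu G := @translation_cvg R n _ ('rV[R]_n * 'rV[R]_n)%type nu
  (fun k p => (p.1 + k, p.2 + k)) (fracD s)
  measurable_pair_addrV (@frac_measure_shift R n) (@measurable_fracD R n s) (fun v k t => fracD_shift s k v t)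
  fracD_cvg M N G MN.

Lemma bounded_support_integrable v (L : R) : 0 <= L -> measurable_fun setT v -> orliczL leb M v ->
  (forall x, ~ cube L x -> v x = 0) -> leb.-integrable setT (EFin \o v).
Proof.
move=> L0 mv Lv vL; have [eM eN _ _ _] := MN; have [_ [k k0 vk]] := Lv.
have mI : measurable_fun setT (\1_(@cube R n L) : Rn -> R).
  by apply: measurable_indic; exact: measurable_cube.
have [_ EI] : orliczE leb N (\1_(@cube R n L) : Rn -> R).
  apply: (bounded_support_orliczE (B := 1) eN mI L0) => x.
    by rewrite indicE => nx; rewrite memNset.
  by rewrite indicE; case: (_ \in _); rewrite /= ?normr1// normr0.
have := orlicz_integrable MN mv mI k0 ltr01 vk (EI _ ltr01).
congr (_.-integrable _ _); apply/funext => x /=; congr EFin; rewrite indicE.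
by have [xL|/vL->] := pselect (cube L x); [rewrite mem_set// mulr1|rewrite mul0r].
Qed.

Lemma frac_sobolev_mollifier (e : R) (z : Rn) : 0 < e -> [/\ frac_sobolev s M (mollifier e z),
  leb.-integrable setT (EFin \o mollifier e z) & exists B, forall h, `|mollifier e z h| <= B].
Proof.
move=> e0; have [eM _ _ _ _] := MN.
have := test_function_lip (mollifier_test (Omega := setT) e0 (fun x _ => I) : test_function setT (mollifier e z)).
move=> [cb [C C0 HC] [B B0 HB] [L L0 HL]].
have mb := continuous_measurable_rV cb.
have [E1 E2] := lip_orliczE n0 s01 eM C0 HC HB mb L0 HL.
have sb : frac_sobolev s M (mollifier e z) by split => //; exact: orliczE_L.
split => //; last by exists B.
by have [_ Lb _] := sb; exact: (bounded_support_integrable L0 mb Lb HL).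
Qed.

Lemma functional_integrable g G v : functional_data g G -> frac_sobolev s M v ->
  leb.-integrable setT (EFin \o (fun x => g x * v x)) /\
  nu.-integrable setT (EFin \o (fun p => G p * fracD s v p)).
Proof.
move=> [mg mG [_ [a a0 ga]] [_ [b b0 Gb]]] [mv [_ [c c0 vc]] [_ [e e0 De]]].
have NM := conjugate_pairC MN; have mD := measurable_fracD s mv.
by split; [exact: (orlicz_integrable NM mg mv a0 c0)|exact: (orlicz_integrable NM mG mD b0 e0)].
Qed.

Lemma functionalD g G u v : functional_data g G -> frac_sobolev s M u -> frac_sobolev s M v ->
  functional g G (fun x => u x + v x) = functional g G u + functional g G v.
Proof.
move=> gG su sv; have [iu iDu] := functional_integrable gG su.
have [iv iDv] := functional_integrable gG sv.
rewrite /functional addrACA -!RintegralD//; congr (_ + _).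
  by apply: eq_Rintegral => x _; rewrite mulrDr.
by apply: eq_Rintegral => p _; rewrite fracDD mulrDr.
Qed.

Lemma functionalN g G v : functional_data g G -> frac_sobolev s M v ->
  functional (fun x => -1 * g x) (fun p => -1 * G p) v = - functional g G v.
Proof.
move=> gG sv; have [iv iDv] := functional_integrable gG sv.
rewrite /functional opprD -!RintegralN//; congr (_ + _); apply: eq_Rintegral => x _;
  by rewrite mulN1r mulNr.
Qed.

Lemma functional_dataN g G : functional_data g G ->
  functional_data (fun x => -1 * g x) (fun p => -1 * G p).
Proof.
have [_ eN _ _ _] := MN.
move=> [mg mG Lg LG]; split; [exact: measurable_funM|exact: measurable_funM| |]; exact: orliczLZ.
Qed.

Variable Omega : set Rn.

(* Fubini: averaging the translates of [v] against the even mollifier is the same as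
   averaging the translates of the mollifier, which are test functions, against [v]. *)
Lemma functional_mollified g G v (k : Rn) (e : R) : 0 < e -> functional_data g G ->
  frac_sobolev s M v -> leb.-integrable setT (EFin \o v) ->
  leb.-integrable setT (EFin \o (fun h => mollifier e 0 h * functional g G (fun x => v (x - (k - h))))) /\
  \int[leb]_h (mollifier e 0 h * functional g G (fun x => v (x - (k - h)))) =
  \int[leb]_z (v z * functional g G (mollifier e (k + z))).
Proof.
move=> e0 [mg mG Lg LG] [mv Lv LDv] iv.
have [[mb Lb LDb] ib [B HB]] := frac_sobolev_mollifier 0 e0.
have [i1 j1 e1] := convolution_leb mg Lg k mb iv ib HB (@mollifierN R n e) Lv Lb.
have [i2 j2 e2] := convolution_nu mG LG k mb iv ib HB (@mollifierN R n e) LDv LDb.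
have HE : (fun h => mollifier e 0 h * functional g G (fun x => v (x - (k - h)))) =
    (fun h => mollifier e 0 h * (\int[leb]_t (g t * v (t + (h - k)))) +
      mollifier e 0 h * \int[nu]_t (G t * fracD s (fun x => v (x + (h - k))) t)).
  by apply/funext => h; rewrite /functional opprB mulrDr.
have mc z : mollifier e (k + z) = (fun x => mollifier e 0 (x - (k + z))).
  by apply/funext => x; exact: mollifier_center.
have KE : (fun z => v z * functional g G (mollifier e (k + z))) =
    (fun z => v z * (\int[leb]_t (g t * mollifier e 0 (t - (k + z)))) +
      v z * \int[nu]_t (G t * fracD s (fun x => mollifier e 0 (x - (k + z))) t)).
  by apply/funext => z; rewrite mc -mulrDr.
rewrite HE KE; split; first exact: (integrable_EFinD i1 i2).
have d1 := RintegralD measurableT i1 i2; have d2 := RintegralD measurableT j1 j2.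
by apply: (etrans d1); apply: etrans (esym d2); rewrite e1 e2.
Qed.

Section local.
Variables (g : Rn -> R) (G : Rn * Rn -> R).
Hypothesis gG : functional_data g G.
Hypothesis ann : forall phi, test_function Omega phi -> functional g G phi = 0.
Variables (v : Rn -> R) (S : set Rn) (L : R).
Hypothesis L0 : 0 <= L.
Hypothesis sv : frac_sobolev s M v.
Hypothesis vS : forall x, ~ S x -> v x = 0.
Hypothesis SL : S `<=` cube L.
(** The form in which the segment property enters: arbitrarily small translations carry [S] into
    [Omega] with a positive margin. *)
Hypothesis Sgood : forall delta, 0 < delta -> exists k e, [/\ `|k| < delta, 0 < e < delta &
  forall z x, S z -> `|x - (z + k)| <= e -> Omega x].

Let F (k : Rn) : R := functional g G (fun x => v (x - k)).

(** For [z] in [S] the mollifier centred at [k + z] is a test function in [Omega], so the average of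
    [F (k - h)] against the mollifier in [h] vanishes. [F] cannot then be positive on the whole
    ball. A vanishing average yields only this one-sided bound, hence the later passage to the
    opposite functional. *)
Let exists_nonpos delta : 0 < delta -> exists k, `|k| < delta /\ F k <= 0.
Proof.
move=> d0; have d2 : 0 < delta / 2 by rewrite divr_gt0.
have [mg mG Lg LG] := gG; have [mv Lv LDv] := sv.
have [k [e [kd /andP[e0 ed] Sk]]] := Sgood d2.
apply: contrapT => nex.
have Fpos h : `|h| < e -> 0 < F (k - h).
  move=> he; rewrite ltNge; apply/negP => Fh; apply: nex; exists (k - h); split => //.
  by apply: (le_lt_trans (ler_normB _ _)); lra.
have iv : leb.-integrable setT (EFin \o v).
  by apply: (bounded_support_integrable L0 mv Lv) => x nx; apply: vS => /SL.
pose H h := mollifier e 0 h * F (k - h).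
have [iH eH] : leb.-integrable setT (EFin \o H) /\
    \int[leb]_h H h = \int[leb]_z (v z * functional g G (mollifier e (k + z))).
  exact: functional_mollified.
have H0 : \int[leb]_h H h = 0.
  rewrite eH; apply: Rintegral_eq0 => z.
  have [Sz|/vS->] := pselect (S z); last by rewrite mul0r.
  have tz : test_function Omega (mollifier e (k + z)).
    by apply: (mollifier_test e0) => x; rewrite (addrC k); exact: Sk.
  by rewrite (ann tz) mulr0.
apply: (integral_pos_contra e0 iH H0) => h; last first.
  by move=> he; apply: mulr_gt0 (Fpos _ he); apply: mollifier_gt0; rewrite subr0.
have [he|he] := ltP `|h| e; first exact: mulr_ge0 (mollifier_ge0 _ _ _) (ltW (Fpos _ he)).
by rewrite /H (mollifier_eq0 e0) ?mul0r// subr0.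
Qed.

(** The translations just found tend to 0; along a subsequence the translates of [v] converge almost
    everywhere and [translation_cvg] transfers the sign. *)
Lemma local_functional_le0 : functional g G v <= 0.
Proof.
have [mg mG Lg LG] := gG; have [mv Lv LDv] := sv.
have ex (i : nat) : exists k, `|k| < i.+1%:R^-1 /\ F k <= 0.
  by apply: exists_nonpos; rewrite invr_gt0.
have [k_ kP] := choice ex.
have k1 i : `|k_ i| <= 1.
  by case: (kP i) => /ltW h _; rewrite (le_trans h)// invf_le1// ler1n.
have k0 : k_ i @[i --> \oo] --> (0 : Rn).
  apply/cvgrPdist_le => e e0; have := @near_infty_natSinv_lt R (PosNum e0); apply: filterS => i /= ie.
  by rewrite sub0r normrN (le_trans _ (ltW ie))// ltW//; case: (kP i).
have [phi _ vphi] := translation_ae_cvg k1 k0 mv.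
have c1 := cvg_leb mg Lg mv Lv vphi.
have c2 := cvg_nu mG LG mv LDv vphi.
apply: (ler_cvg_to (cvgD c1 c2) (cvg_cst 0)).
by apply: nearW => i; case: (kP (phi i)).
Qed.

End local.

(** The one-sided bound is applied to the pair and to its opposite, which annihilates the same test
    functions. *)
Lemma local_functional_eq0 g G v (S : set Rn) (L : R) : functional_data g G ->
  (forall phi, test_function Omega phi -> functional g G phi = 0) -> 0 <= L ->
  frac_sobolev s M v -> (forall x, ~ S x -> v x = 0) -> S `<=` cube L ->
  (forall delta, 0 < delta -> exists k e, [/\ `|k| < delta, 0 < e < delta &
    forall z x, S z -> `|x - (z + k)| <= e -> Omega x]) -> functional g G v = 0.
Proof.
move=> gG ann L0 sv vS SL Sg; have [eM _ _ _ _] := MN.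
apply/eqP; rewrite eq_le (local_functional_le0 gG ann L0 sv vS SL Sg)/=.
rewrite -oppr_le0 -functionalN//.
apply: (local_functional_le0 (functional_dataN gG) _ L0 sv vS SL Sg) => phi tphi.
have [cb [C C0 HC] [B B0 HB] [L' L'0 HL]] := test_function_lip tphi.
have mb := continuous_measurable_rV cb.
have [E1 E2] := lip_orliczE n0 s01 eM C0 HC HB mb L'0 HL.
have sb : frac_sobolev s M phi by split => //; exact: orliczE_L.
by rewrite functionalN// ann// oppr0.
Qed.

(** * Cutting along a finite cover *)

Section tents.

Lemma lipschitz_continuous_rV (f : Rn -> R) (C : R) : 0 < C ->
  (forall x y, `|f x - f y| <= C * `|x - y|) -> continuous f.
Proof.
move=> C0 fC x A [e /= e0 eA]; apply/nbhs_ballP; exists (e / C); first by rewrite /= divr_gt0.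
move=> y; rewrite -ball_normE /= => xy; apply: eA; rewrite /ball_/=.
by apply: (le_lt_trans (fC _ _)); rewrite mulrC -ltr_pdivlMr.
Qed.

Definition tent (z : Rn) (r : R) (x : Rn) : R := Num.max 0 (Num.min 1 (2 - 2 / r * `|x - z|)).

Lemma tent_lip z r x y : 0 < r -> `|tent z r x - tent z r y| <= 2 / r * `|x - y|.
Proof.
move=> r0; have c0 : 0 < 2 / r by rewrite divr_gt0.
apply: (@le_trans _ _ (2 / r * `| `|x - z| - `|y - z| |)); last first.
  rewrite ler_pM2l//; apply: (le_trans (ler_dist_dist _ _)).
  by rewrite opprB addrA subrK.
have mx (a b : R) : `|Num.max 0 a - Num.max 0 b| <= `|a - b|.
  rewrite ler_norml; case: (leP 0 a) => h1; case: (leP 0 b) => h2;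
    case: (ger0P (a - b)) => h3; apply/andP; split; lra.
have mn (a b : R) : `|Num.min 1 a - Num.min 1 b| <= `|a - b|.
  rewrite ler_norml; case: (leP 1 a) => h1; case: (leP 1 b) => h2;
    case: (ger0P (a - b)) => h3; apply/andP; split; lra.
rewrite -(gtr0_norm c0) -normrM mulrBr (distrC (_ * `|x - z|)).
apply: (le_trans (mx _ _)); apply: (le_trans (mn _ _)).
by rewrite (_ : 2 - _ - _ = 2 / r * `|y - z| - 2 / r * `|x - z|)//; ring.
Qed.

Lemma tent01 z r x : 0 <= tent z r x <= 1.
Proof. by rewrite /tent le_max lexx /= ge_max ler01 /= ge_min lexx. Qed.

Lemma tent_in z r x : 0 < r -> `|x - z| < r / 2 -> tent z r x = 1.
Proof.
move=> r0 xz; rewrite /tent min_l ?max_r ?ler01//.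
have : 2 / r * `|x - z| <= 2 / r * (r / 2) by rewrite ler_wpM2l ?divr_ge0 ?ltW.
rewrite (_ : 2 / r * (r / 2) = 1); last by field; rewrite gt_eqF.
lra.
Qed.

Lemma tent_out z r x : 0 < r -> r <= `|x - z| -> tent z r x = 0.
Proof.
move=> r0 xz; have : 2 / r * r <= 2 / r * `|x - z| by rewrite ler_wpM2l// divr_ge0// ltW.
rewrite divfK ?gt_eqF// => h; rewrite /tent min_r ?max_l//; lra.
Qed.

Lemma measurable_tent z r : 0 < r -> measurable_fun setT (tent z r).
Proof.
move=> r0; apply: continuous_measurable_rV.
by apply: (lipschitz_continuous_rV (C := 2 / r)) => [|x y]; [rewrite divr_gt0|exact: tent_lip].
Qed.

End tents.

(** Induction on the cover with the splitting [v = tent * v + (1 - tent) * v]. The first piece lives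
    in one ball, and the second vanishes on the ball of half radius, so the remaining balls still
    cover it. *)
Lemma cover_functional_eq0 g G (zs : seq (Rn * R)) : functional_data g G ->
  (forall z r, (z, r) \in zs -> 0 < r /\ forall v, frac_sobolev s M v ->
    (forall x, ~ (Omega x /\ `|x - z| < r) -> v x = 0) -> functional g G v = 0) ->
  forall v, frac_sobolev s M v ->
  (forall x, v x != 0 -> Omega x /\ exists z r, (z, r) \in zs /\ `|x - z| < r / 2) ->
  functional g G v = 0.
Proof.
move=> gG; elim: zs => [|[z r] zs IH] zsP v sv vS.
  have v0 x : v x = 0.
    by apply/eqP; apply: contrapT => /negP /vS[_ [? [? []]]]; rewrite in_nil.
  rewrite /functional; have -> : \int[leb]_x (g x * v x) = 0.
    by apply: Rintegral_eq0 => x; rewrite v0 mulr0.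
  rewrite add0r; apply: Rintegral_eq0 => p.
  by rewrite /fracD !v0 subrr mul0r mulr0.
have [r0 zr] := zsP z r (mem_head _ _).
have mt := measurable_tent z r0; have [eM _ _ _ _] := MN.
have c0 : 0 <= 2 / r by rewrite divr_ge0// ltW.
have mt' : measurable_fun setT (fun x => 1 - tent z r x) by exact: measurable_funB.
have s1 : frac_sobolev s M (fun x => tent z r x * v x).
  apply: (frac_sobolev_mul n0 s01 eM mt c0 (fun x y => tent_lip z x y r0) _ sv) => x.
  by case/andP: (tent01 z r x) => h1 h2; rewrite ger0_norm.
have s2 : frac_sobolev s M (fun x => (1 - tent z r x) * v x).
  apply: (frac_sobolev_mul n0 s01 eM mt' c0 _ _ sv) => [x y|x].
    rewrite (_ : _ - _ = tent z r y - tent z r x); last by ring.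
    by rewrite (distrC x); exact: tent_lip.
  by case/andP: (tent01 z r x) => h1 h2; rewrite ger0_norm; lra.
rewrite (_ : v = fun x => tent z r x * v x + (1 - tent z r x) * v x); last first.
  by apply/funext => x; ring.
rewrite functionalD// zr// => [|x nx].
  rewrite add0r IH// => [z' r' z'r'|x hx].
    by apply: zsP; rewrite in_cons z'r' orbT.
  have vx : v x != 0 by apply: contraNneq hx => ->; rewrite mulr0.
  have [Ox [z' [r' [+ xz']]]] := vS x vx; rewrite in_cons => /orP[/eqP[ez er]|z'r'].
    by exfalso; move/eqP: hx; apply; rewrite tent_in ?subrr ?mul0r// -ez -er.
  by split => //; exists z', r'.
have [/eqP ->|vx] := boolP (v x == 0); first by rewrite mulr0.
have [Ox _] := vS x vx; rewrite tent_out ?mul0r// leNgt; apply/negP => h.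
by apply: nx.
Qed.

End annihilator.

(** * Geometry of domains with the segment property *)

Section domain.
Context {R : realType} (n : nat).
Local Notation Rn := 'rV[R]_n.
Implicit Types (Omega K : set Rn).

Lemma bounded_setP (A : set Rn) : bounded_set A -> exists2 L, 0 <= L & forall x, A x -> `|x| <= L.
Proof.
move=> [L0 [_ HL]]; exists (`|L0| + 1); first by rewrite addr_ge0.
by apply: HL; rewrite ltr_pwDr// ler_norm.
Qed.

Lemma compact_open_margin Omega K (k : Rn) : compact K -> open Omega ->
  (forall z, K z -> Omega (z + k)) ->
  exists2 e, 0 < e & forall z x, K z -> `|x - (z + k)| <= e -> Omega x.
Proof.
move=> /compact_near_coveringP cK oO KO.
pose P (e : R) (z : Rn) := forall x, `|x - (z + k)| <= e -> Omega x.
have : \forall e \near 0^'+, K `<=` P e.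
  apply: cK => z Kz.
  have /nbhs_ballP[e /= e0 eO] : nbhs (z + k) Omega by apply: open_nbhs_nbhs; split => //; exact: KO.
  have e2 : 0 < e / 2 by rewrite divr_gt0.
  exists (ball z (e / 2), [set e' : R | e' < e / 2]) => /=.
    split; first exact: nbhsx_ballx.
    exact: nbhs_right_lt.
  move=> [z' e'] /= []; rewrite -ball_normE/= => zz' e'e x xe.
  apply: eO; rewrite -ball_normE/=.
  have -> : z + k - x = (z - z') - (x - (z' + k)) by apply/rowP => i; rewrite !mxE; ring.
  by apply: (le_lt_trans (ler_normB _ _)); lra.
move=> H; have [e [e0 He]] : exists e, 0 < e /\ K `<=` P e.
  have /(@filter_ex _ _ (at_right_proper_filter (0 : R)))[e [? ?]] :
      \forall e \near 0^'+, 0 < e /\ K `<=` P e.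
    by apply: filterS2 H (nbhs_right_gt 0).
  by exists e.
by exists e => // z x Kz; exact: He.
Qed.

(** At an interior point the zero translation works; at a boundary point the segment property
    provides [t *: y] for small [t]. In both cases a compact part of the closure is mapped into the
    open [Omega], and compactness gives the uniform margin [e]. *)
Lemma good_radius Omega z : bounded_set Omega -> open Omega -> segment_property Omega ->
  closure Omega z -> exists2 r, 0 < r & forall delta, 0 < delta ->
    exists k e, [/\ `|k| < delta, 0 < e < delta &
      forall z' x, Omega z' -> `|z' - z| < r -> `|x - (z' + k)| <= e -> Omega x].
Proof.
move=> bO oO segO clz.
have key (r : R) : 0 < r -> (forall delta, 0 < delta -> exists2 k, `|k| < delta &
      forall z', closure Omega z' -> `|z' - z| <= r -> Omega (z' + k)) ->
    forall delta, 0 < delta -> exists k e, [/\ `|k| < delta, 0 < e < delta &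
      forall z' x, Omega z' -> `|z' - z| < r -> `|x - (z' + k)| <= e -> Omega x].
  move=> r0 Hr delta d0; have [k kd Hk] := Hr delta d0.
  pose K := closure Omega `&` closed_ball z r.
  have KE z' : K z' <-> closure Omega z' /\ `|z' - z| <= r.
    by rewrite /K closed_ballE// /closed_ball_/= distrC.
  have cK : compact K.
    apply: bounded_closed_compact.
      exists (`|z| + r); split; first exact: num_real.
      move=> m hm x /KE[_ xr]; apply: ltW; apply: le_lt_trans hm.
      by rewrite -[x](subrK z) (le_trans (ler_normD _ _))// addrC lerD2l.
    by apply: closedI; [exact: closed_closure|exact: closed_ball_closed].
  have [|e e0 He] := compact_open_margin cK oO (k := k).
    by move=> z' /KE[? ?]; exact: Hk.
  exists k, (Num.min e (delta / 2)); split => //.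
    have d2 : 0 < delta / 2 by rewrite divr_gt0.
    by rewrite lt_min e0 d2 gt_min; apply/orP; right; lra.
  move=> z' x Oz' /ltW z'r; rewrite le_min => /andP[xe _].
  by apply: He xe; apply/KE; split => //; exact: subset_closure.
have [Oz|nOz] := pselect (Omega z).
  have /nbhs_ballP[r /= r0 rO] : nbhs z Omega by exact: open_nbhs_nbhs.
  have r2 : 0 < r / 2 by rewrite divr_gt0.
  exists (r / 2) => //; apply: key => // delta d0; exists 0; first by rewrite normr0.
  move=> z' _ z'r; rewrite addr0; apply: rO; rewrite -ball_normE/= distrC.
  by apply: (le_lt_trans z'r); lra.
have [|U [y [oU Uz y0 Uy]]] := segO z.
  by split => // /interior_subset.
have /nbhs_ballP[r /= r0 rU] : nbhs z U by exact: open_nbhs_nbhs.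
have r2 : 0 < r / 2 by rewrite divr_gt0.
exists (r / 2) => //; apply: key => // delta d0.
have ny : 0 < `|y| by rewrite normr_gt0.
(* Below 1, as the segment property requires, and small enough that [t *: y] has norm at most
   [delta / 2]. *)
pose t := Num.min (1 / 2) (delta / (2 * `|y|)).
have t0 : 0 < t by rewrite lt_min !divr_gt0// mulr_gt0.
have t1 : t < 1 by rewrite gt_min; apply/orP; left; lra.
exists (t *: y).
  rewrite normrZ (gtr0_norm t0); apply: (@le_lt_trans _ _ (delta / (2 * `|y|) * `|y|)).
    by rewrite ler_wpM2r// ge_min lexx orbT.
  rewrite (_ : _ * _ = delta / 2); first by lra.
  by field; rewrite gt_eqF.
move=> z' clz' z'r; apply: Uy => //; last by rewrite t0.
apply: rU; rewrite -ball_normE/= distrC; apply: (le_lt_trans z'r); lra.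
Qed.

End domain.

Section annihilation.
Context {R : realType} (n : nat) (s : R).
Hypothesis n0 : (0 < n)%N.
Hypothesis s01 : 0 < s < 1.
Variables M N : R -> R.
Hypothesis MN : conjugate_pair M N.
Local Notation Rn := 'rV[R]_n.
Local Notation leb := (@lebesgue_rV R n).
Local Notation nu := (@frac_measure R n).
Variable Omega : set Rn.
Hypothesis bO : bounded_set Omega.
Hypothesis oO : open Omega.
Hypothesis segO : segment_property Omega.

Lemma annihilates_frac_sobolev (g : Rn -> R) (G : Rn * Rn -> R) (v : Rn -> R) :
  functional_data N g G -> (forall phi, test_function Omega phi -> functional s g G phi = 0) ->
  frac_sobolev s M v -> (forall x, ~ Omega x -> v x = 0) -> functional s g G v = 0.
Proof.
move=> gG ann sv vO; have [L L0 HL] := bounded_setP bO.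
(* Off the closure the radius is an arbitrary 1; the centres of the finite cover all lie in the
   closure. *)
have h z : exists r, 0 < r /\ (closure Omega z -> forall delta, 0 < delta ->
    exists k e, [/\ `|k| < delta, 0 < e < delta &
      forall z' x, Omega z' -> `|z' - z| < r -> `|x - (z' + k)| <= e -> Omega x]).
  have [clz|nclz] := pselect (closure Omega z); last by exists 1.
  by have [r r0 Hr] := good_radius bO oO segO clz; exists r.
have [r rP] := choice h.
have cK : compact (closure Omega).
  apply: bounded_closed_compact; last exact: closed_closure.
  exists L; split; first exact: num_real.
  move=> m Lm x clx; have [y [Oy]] := clx _ (nbhsx_ballx x (m - L) (ltac:(by rewrite subr_gt0))).
  rewrite -ball_normE/= => xy; rewrite -[x](subrK y) (le_trans (ler_normD _ _))//.
  by have := HL y Oy; lra.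
move: cK; rewrite compact_cover => /(_ Rn (closure Omega) (fun z => ball z (r z / 2))).
move=> [|x clx|D DK cov].
- by move=> z _; apply: ball_open; rewrite divr_gt0//; case: (rP z).
- by exists x => //; apply: ballxx; rewrite divr_gt0//; case: (rP x).
have Hc := @cover_functional_eq0 R n s n0 s01 M N MN Omega g G [seq (z, r z) | z <- finmap.enum_fset D] gG.
refine (Hc _ v sv _).
  move=> z _ /mapP[z' z'D [-> ->]] {z}; have [r0 Hr] := rP z'; split => // w sw wS.
  apply: (local_functional_eq0 n0 s01 MN gG ann L0 sw wS).
    by move=> x [Ox _]; apply/cubeP => //; exact: HL.
  have clz' : closure Omega z' by have := DK z' z'D; rewrite inE.
  move=> delta d0; have [k [e [kd ed Hk]]] := Hr clz' delta d0.
  by exists k, e; split => // z x [Oz zz]; exact: Hk.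
move=> x vx; have Ox : Omega x.
  by apply: contrapT => /vO v0; move/eqP: vx.
split => //; have [z zD] := cov x (subset_closure Ox).
rewrite -ball_normE/= => zx; exists z, (r z); split; last by rewrite distrC.
exact: map_f.
Qed.

(** Pairing with a fixed element of E_N x E_N is continuous by construction of the topology, so its
    zero set is closed. *)
Lemma sigma_closure_eq0 (i : set_type (orliczEE N)) (u : Rn -> R) :
  (forall phi, test_function Omega phi -> prod_pairing (set_val i) (Ws_embed s phi) = 0) ->
  closure (Ws_embed s @` test_function Omega :
    set (sigma_topology (fun g : set_type (@orliczEE R n N) => prod_pairing (set_val g)))) (Ws_embed s u) ->
  prod_pairing (set_val i) (Ws_embed s u) = 0.
Proof.
move=> H0 clu; pose X := sigma_topology (fun g : set_type (@orliczEE R n N) => prod_pairing (set_val g)).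
pose f (U : X) : R := prod_pairing (set_val i) U.
have cf : continuous f.
  move=> U; apply: (@continuous_comp _ _ _ (fun U : X => (fun g => prod_pairing (set_val g) U) : {ptws set_type (@orliczEE R n N) -> R})
    (fun h => h i)); first exact: initial_continuous.
  exact: (@proj_continuous _ (fun=> R) i).
pose C : set X := f @^-1` [set 0].
have cC : closed C by apply: closed_comp => //; exact: closed_eq.
have : C (Ws_embed s u).
  rewrite (closure_id C).1//; apply: closureS clu => _ [phi tphi <-]; exact: H0.
by [].
Qed.

End annihilation.

Section representative.
Context {R : realType} (n : nat) (s : R).
Hypothesis n0 : (0 < n)%N.
Variable M : R -> R.
Hypothesis yM : young_function M.
Local Notation Rn := 'rV[R]_n.
Local Notation leb := (@lebesgue_rV R n).
Local Notation nu := (@frac_measure R n).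
Variable Omega : set Rn.
Hypothesis oO : open Omega.

Lemma test_function_out (phi : Rn -> R) x : test_function Omega phi -> ~ Omega x -> phi x = 0.
Proof.
move=> [_ [_ sO]] nO; apply/eqP; apply: contrapT => /negP h; apply: nO; apply: sO.
exact: subset_closure.
Qed.

(** Vanishing off [Omega] passes to the weak closure, because a bounded function with bounded
    support outside [Omega], paired with 0, lies in E_N x E_N. The representative is then cut to
    vanish everywhere off [Omega], so that translates can be controlled pointwise. *)
Lemma Ws0L_representative u : Ws0L s M Omega u -> exists v, [/\ frac_sobolev s M v,
  forall x, ~ Omega x -> v x = 0 & {ae leb, forall x, u x = v x}].
Proof.
move=> [[Lu LDu] clu]; have MN := conj_young_pair yM; have [eM eN _ _ _] := MN.
have [[w mw uw'] _] := Lu.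
have uw : {ae leb, forall x, u x = w x} by exact: uw'.
have mO : measurable Omega := open_measurable_rV oO.
have Lw : orliczL leb M w := ae_orliczL uw Lu.
(* Off [Omega], test against the sign of [w]. *)
have w0 : {ae leb, forall x, ~ Omega x -> w x = 0}.
  suff : {ae leb, forall x, forall k : nat, (cube k%:R `\` Omega) x -> w x = 0}.
    apply: filterS => x H nO; have [k xk] : exists k : nat, `|x| <= k%:R.
      by exists (Num.truncn `|x|).+1; exact/ltW/truncnS_gt.
    by apply: (H k); split => //; apply/cubeP.
  apply: ae_foralln => k; pose A : set Rn := cube k%:R `\` Omega.
  have mA : measurable A by apply: measurableD => //; exact: measurable_cube.
  pose P : set Rn := [set x | 0 <= w x].
  have mP : measurable P by apply: measurable_set_ler.
  pose g (x : Rn) : R := (2 * \1_P x - 1) * \1_A x.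
  have mg : measurable_fun setT g.
    apply: measurable_funM; last exact: measurable_indic.
    by apply: measurable_funB => //; apply: measurable_funM => //; exact: measurable_indic.
  have gA x : ~ A x -> g x = 0 by move=> nA; rewrite /g [\1_A x]indicE memNset// mulr0.
  have wg x : w x * g x = `|w x| * \1_A x.
    rewrite /g mulrA; congr (_ * _); rewrite indicE; have [wP|wP] := pselect (P x).
      by rewrite mem_set//= ger0_norm//; ring.
    rewrite memNset//= ltr0_norm; first by ring.
    by rewrite ltNge; apply/negP.
  have Eg : orliczE leb (conj_young M) g.
    apply: (bounded_support_orliczE (L := k%:R) (B := 1) eN mg) => // [x nx|x].
      by apply: gA => -[].
    rewrite /g !indicE; case: (_ \in _); case: (_ \in _) => /=; rewrite ?mulr1 ?mulr0 ?subr0 ?sub0r ?normr0 ?normrN1//.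
    by rewrite (_ : 2 - 1 = 1) ?normr1//; ring.
  have E0 : orliczE nu (conj_young M) (cst 0).
    apply: scale_orliczE => // r; rewrite /modular integral0_eq ?ltry// => p _.
    by rewrite mulr0; case: eN => ->.
  have gi : orliczEE (conj_young M) (g, cst 0 : Rn * Rn -> R) by split.
  pose i : set_type (@orliczEE R n (conj_young M)) :=
    @exist _ (fun U => U \in orliczEE (conj_young M)) (g, cst 0) (mem_set gi).
  have pE U : prod_pairing (set_val i) (Ws_embed s U) = \int[leb]_x (U x * g x).
    rewrite /prod_pairing /= [X in _ + X]Rintegral_eq0 ?addr0// => p.
    by rewrite mulr0.
  have := @sigma_closure_eq0 R n s (conj_young M) Omega i u.
  rewrite pE => H.
  have {H} : \int[leb]_x (u x * g x) = 0.
    apply: H clu => phi tphi; rewrite pE; apply: Rintegral_eq0 => x.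
    have [Ox|nO] := pselect (Omega x); last by rewrite (test_function_out tphi nO) mul0r.
    by rewrite gA ?mulr0// => -[].
  rewrite (ae_Rintegral_eq (g := fun x => `|w x| * \1_A x)); last first.
    by apply: filterS uw => x ->; exact: wg.
  have mI : measurable_fun setT (fun x : Rn => `|w x| * \1_A x).
    by apply: measurable_funM; [exact: measurableT_comp|exact: measurable_indic].
  have iI : leb.-integrable setT (EFin \o (fun x => `|w x| * \1_A x)).
    apply: (bounded_support_integrable MN (L := k%:R)) => //.
      apply: (orliczL_le eM mI mw) Lw => x; rewrite normrM normr_id ler_piMr//.
      by rewrite indicE; case: (_ \in _); rewrite /= ?normr1// normr0.
    by move=> x nx; rewrite indicE memNset ?mulr0// => -[].
  have I0 x : 0 <= `|w x| * \1_A x by rewrite mulr_ge0.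
  pose W (x : Rn) : R := `|w x| * \1_A x.
  move=> H0; have : (\int[leb]_x `|(EFin \o W) x| = 0)%E.
    rewrite (eq_integral (EFin \o W)); last by move=> x _ /=; rewrite ger0_norm// I0.
    by rewrite -(Rintegral_EFin iI) H0.
  move=> /(ae_eq_integral_abs leb measurableT (measurable_int _ iI)).
  apply: filterS => x /(_ I) [] + Ax; rewrite /W indicE mem_set// mulr1 => /eqP.
  by rewrite normr_eq0 => /eqP.
pose v (x : Rn) : R := w x * \1_Omega x.
have mv : measurable_fun setT v by apply: measurable_funM => //; exact: measurable_indic.
have uv : {ae leb, forall x, u x = v x}.
  apply: filterS2 uw w0 => x -> H; rewrite /v indicE.
  have [Ox|nO] := pselect (Omega x); first by rewrite mem_set// mulr1.
  by rewrite memNset// mulr0 H.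
exists v; split => //.
  by split => //; [exact: ae_orliczL Lu|exact: ae_orliczL (fracD_ae s uv) LDu].
by move=> x nO; rewrite /v indicE memNset// mulr0.
Qed.

End representative.

(** * Pseudomonotonicity *)

Section regular_kernel.
Context d (T : measurableType d) (R : realType) (mu : {measure set T -> \bar R}).
Variables (a : T -> R -> R) (dd : T -> R) (b : R) (H : R -> R).
Hypothesis b0 : 0 <= b.
Hypothesis H0 : forall xi, 0 <= H xi.
Hypothesis am : forall xi, ae_measurable mu (a^~ xi).
Hypothesis ac : {ae mu, forall p, continuous (a p)}.
Hypothesis aodd : {ae mu, forall p, forall xi, a p (- xi) = - a p xi}.
Hypothesis ddm : ae_measurable mu dd.
Hypothesis ag : {ae mu, forall p, forall xi, `|a p xi| <= dd p + b * H xi}.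
Hypothesis amon : {ae mu, forall p, forall xi xi', 0 <= (a p xi - a p xi') * (xi - xi')}.

(** The kernel is set to 0 on a null set containing all failures of the conditions and all
    disagreements with measurable versions at rational arguments. Composition with a measurable [w]
    is then measurable, by continuity in the last variable; oddness gives the value 0 at 0. *)
Lemma regular_kernel : exists (a' : T -> R -> R) (dd' : T -> R), [/\ forall p, continuous (a' p),
    forall p, a' p 0 = 0,
    forall p xi xi', 0 <= (a' p xi - a' p xi') * (xi - xi'),
    forall w : T -> R, measurable_fun setT w -> measurable_fun setT (fun p => a' p (w p)) &
    [/\ measurable_fun setT dd', forall p xi, `|a' p xi| <= dd' p + b * H xi,
      {ae mu, forall p, a p = a' p} & {ae mu, forall p, dd p = dd' p}]].
Proof.
have [d' md' dd'] := ddm.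
pose q (j : nat) : R := ratr (odflt 0 (unpickle j : option rat)).
have /choice[v vP] : forall j, exists v : T -> R, measurable_fun setT v /\ {ae mu, forall p, a p (q j) = v p}.
  by move=> j; have [v mv av] := am (q j); exists v.
have va : {ae mu, forall p, forall j, a p (q j) = v j p}.
  by apply: ae_foralln => j; case: (vP j).
have : {ae mu, forall p, [/\ continuous (a p), forall xi, a p (- xi) = - a p xi,
    forall xi, `|a p xi| <= dd p + b * H xi, forall xi xi', 0 <= (a p xi - a p xi') * (xi - xi') &
    (forall j, a p (q j) = v j p) /\ dd p = d' p]}.
  have and2 (P Q : T -> Prop) : {ae mu, forall p, P p} -> {ae mu, forall p, Q p} ->
    {ae mu, forall p, P p /\ Q p} by move=> h h'; apply: filterS2 h h' => p.
  have h4 := and2 _ _ (and2 _ _ ac aodd) (and2 _ _ ag amon).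
  have h3 := and2 _ _ va dd'.
  by apply: filterS2 h4 h3 => p [[? ?] [? ?]] [? ?]; split.
move=> [Z [mZ Z0 PZ]]; have mZC := measurableC mZ.
pose i (p : T) : R := \1_(~` Z) p.
have iE p : (Z p /\ i p = 0) \/ (~ Z p /\ i p = 1).
  rewrite /i indicE; have [Zp|nZ] := pselect (Z p).
    by left; split => //; rewrite memNset.
  by right; split => //; rewrite mem_set.
have good p : ~ Z p -> [/\ continuous (a p), forall xi, a p (- xi) = - a p xi,
    forall xi, `|a p xi| <= dd p + b * H xi, forall xi xi', 0 <= (a p xi - a p xi') * (xi - xi') &
    (forall j, a p (q j) = v j p) /\ dd p = d' p].
  by move=> nZ; apply: contrapT => nP; apply: nZ; exact: PZ.
have mi : measurable_fun setT i by exact: measurable_indic.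
pose a' p xi := a p xi * i p.
have a'c p : continuous (a' p).
  have [[_ i0]|[nZ i1]] := iE p; move=> x; rewrite /a'.
    rewrite (_ : (fun xi => _) = cst 0); first exact: cvg_cst.
    by apply/funext => xi; rewrite i0 mulr0.
  by apply: cvgM; [case: (good p nZ) => c _ _ _ _; exact: c|exact: cvg_cst].
exists a', (fun p => d' p * i p); split.
- exact: a'c.
- move=> p; have [[_ i0]|[nZ _]] := iE p; first by rewrite /a' i0 mulr0.
  have [_ odd _ _ _] := good p nZ; have := odd 0; rewrite oppr0 => o0.
  by rewrite /a' (_ : a p 0 = 0) ?mul0r//; lra.
- move=> p xi xi'; have [[_ i0]|[nZ i1]] := iE p; rewrite /a'.
    by rewrite i0 !mulr0 subrr mul0r.
  by rewrite i1 !mulr1; case: (good p nZ).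
- move=> w mw.
  (* [w] is rounded down to multiples of [1 / (k + 1)]: countably many rational values, each taken
     on a measurable set, within [1 / (k + 1)] of [w]. *)
  pose r (k : nat) (z : int) : rat := z%:~R / k.+1%:R.
  pose W k p := a' p (ratr (r k (Num.floor (w p * k.+1%:R)))).
  have mq (x : rat) : measurable_fun setT (fun p => a' p (ratr x)).
    rewrite (_ : (fun p => _) = (fun p => v (pickle x) p * i p)).
      by apply: measurable_funM => //; case: (vP (pickle x)).
    apply/funext => p; rewrite /a'; have [[_ ->]|[nZ ->]] := iE p; first by rewrite !mulr0.
    by have [_ _ _ _ [<- _]] := good p nZ; rewrite /q pickleK.
  have mW k : measurable_fun setT (W k).
    have mwk : measurable_fun setT (fun p => w p * k.+1%:R) by exact: measurable_funM.
    pose E (z : int) := [set p | z%:~R <= w p * k.+1%:R] `&` [set p | w p * k.+1%:R < (z + 1)%:~R].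
    have mE z : measurable (E z).
      by apply: measurableI; [exact: measurable_set_ler|exact: measurable_set_ltr].
    have EP z p : E z p <-> Num.floor (w p * k.+1%:R) = z.
      split => [[/= h1 h2]|<-]; first by apply: floor_def; rewrite h1 h2.
      by split => /=; [exact: floor_le_tmp|exact: floorD1_gt].
    move=> _ B mB; rewrite setTI.
    rewrite (_ : W k @^-1` B = \bigcup_z (E z `&` (fun p => a' p (ratr (r k z))) @^-1` B)).
      apply: countable_bigcupT_measurable => // z; apply: measurableI => //.
      by rewrite -[X in measurable X]setTI; exact: mq.
    apply/seteqP; split => [p Bp|p [z _ [/EP Ez Bz]]]; last by rewrite /= /W Ez.
    by exists (Num.floor (w p * k.+1%:R)) => //; split => //; apply/EP.
  apply: (measurable_fun_cvg (h := W)) => // p _.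
  apply: (continuous_cvg _ (a'c p _)).
  apply/cvgrPdist_le => e e0; have := @near_infty_natSinv_lt R (PosNum e0).
  apply: filterS => k /= ke; apply: le_trans (ltW ke).
  set x := w p; have k0 : 0 < k.+1%:R :> R by [].
  have -> : ratr (r k (Num.floor (x * k.+1%:R))) = (Num.floor (x * k.+1%:R))%:~R / k.+1%:R :> R.
    by rewrite /r fmorph_div/= ratr_int ratr_nat.
  have h1 : (Num.floor (x * k.+1%:R))%:~R <= x * k.+1%:R := floor_le_tmp _.
  have h2 : x * k.+1%:R < (Num.floor (x * k.+1%:R) + 1)%:~R := floorD1_gt _.
  move: h1 h2; rewrite intrD; move: (Num.floor _)%:~R => z h1 h2.
  have -> : x - z / k.+1%:R = (x * k.+1%:R - z) / k.+1%:R by field; rewrite addrC natr1 gt_eqF.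
  rewrite normrM normfV (gtr0_norm k0) ler_pdivrMr// mulVf ?gt_eqF// ger0_norm; lra.
split.
- exact: measurable_funM.
- move=> p xi; rewrite /a'; have [[_ ->]|[nZ ->]] := iE p.
    by rewrite !mulr0 normr0 add0r mulr_ge0.
  by rewrite !mulr1; have [_ _ g _ [_ <-]] := good p nZ; exact: g.
- exists Z; split => // p /= n'; have [[]//|[nZ i1]] := iE p; exfalso; apply: n'.
  by apply/funext => xi; rewrite /a' i1 mulr1.
- exists Z; split => // p /= n'; have [[]//|[nZ i1]] := iE p; exfalso; apply: n'.
  by rewrite i1 mulr1; case: (good p nZ) => _ _ _ _ [].
Qed.

End regular_kernel.

Section pairing.
Context {R : realType} (n : nat) (s : R).
Variables M : R -> R.
Hypothesis yM : young_function M.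
Local Notation Rn := 'rV[R]_n.
Local Notation leb := (@lebesgue_rV R n).
Local Notation nu := (@frac_measure R n).
Local Notation N := (conj_young M).

Lemma luxemburg0 d (T : measurableType d) (mu : {measure set T -> \bar R}) (u : T -> R) (e : R) : 0 < e ->
  (forall x, u x = 0) -> (luxemburg mu M u <= e%:E)%E.
Proof.
move=> e0 u0; have [M0 _ _] := young_even_convex yM.
apply: ereal_inf_lbound; exists e => //; split => //.
by rewrite /modular integral0_eq ?lee_fin ?ler01// => x _; rewrite u0 mul0r M0.
Qed.

Lemma test_function_Ws0E (Omega : set Rn) phi : (0 < n)%N -> 0 < s < 1 ->
  test_function Omega phi -> Ws0E s M Omega phi.
Proof.
move=> n0 s01 tphi; have eM := young_even_convex yM.
have [cb [C C0 HC] [B B0 HB] [L L0 HL]] := test_function_lip tphi.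
split; first exact: (lip_orliczE n0 s01 eM C0 HC HB (continuous_measurable_rV cb) L0 HL).
move=> e e0; exists phi => //; have e3 : 0 < e / 3 by rewrite divr_gt0.
have z x : (phi \- phi) x = 0 by rewrite /= subrr.
apply: (@le_lt_trans _ _ ((e / 3)%:E + (e / 3)%:E)%E); last by rewrite -EFinD lte_fin; lra.
by apply: leeD; apply: luxemburg0 => // p; rewrite /fracD !z subrr mul0r.
Qed.

Lemma pairing_LopE (a : Rn -> Rn -> R -> R) u w (A D : Rn * Rn -> R) :
  measurable_fun setT A -> measurable_fun setT D -> orliczL nu N A -> orliczL nu M D ->
  {ae nu, forall p, Lflux s a u p = A p} -> {ae nu, forall p, fracD s w p = D p} ->
  pairing s (Lop s a u) w = \int[nu]_p (A p * D p).
Proof.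
move=> mA mD LA LD eA eD; have MN := conj_young_pair yM.
have iAD := orliczLE_integrable (conjugate_pairC MN) mA mD LA LD.
rewrite /pairing /= Rintegral_eq0 ?sub0r; last by move=> x; rewrite mul0r.
rewrite (ae_Rintegral_eq (g := fun p => - (A p * D p))); first by rewrite RintegralN// opprK.
by apply: filterS2 eA eD => p -> ->; rewrite mulNr.
Qed.

Lemma pairingE (f : distr) w (g v : Rn -> R) (G D : Rn * Rn -> R) :
  {ae leb, forall x, f.1 x = g x} -> {ae nu, forall p, f.2 p = G p} ->
  {ae leb, forall x, w x = v x} -> {ae nu, forall p, fracD s w p = D p} ->
  pairing s f w = \int[leb]_x (g x * v x) - \int[nu]_p (G p * D p).
Proof.
move=> eg eG ev eD; rewrite /pairing; congr (_ - _).
  by apply: ae_Rintegral_eq; apply: filterS2 eg ev => x -> ->.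
by apply: ae_Rintegral_eq; apply: filterS2 eG eD => p -> ->.
Qed.

End pairing.
Theorem theorem3p4 (R : realType) (n : nat) (s : R) (Omega : set 'rV[R]_n)
    (M : R -> R) (a : 'rV[R]_n -> 'rV[R]_n -> R -> R) :
  (0 < n)%N -> 0 < s < 1 ->
  bounded_set Omega -> open Omega -> segment_property Omega ->
  young_function M -> admissible_kernel M a ->
  forall (u_ : nat -> 'rV[R]_n -> R) (u : 'rV[R]_n -> R) (f : distr),
  (forall i, Lop_dom s M Omega a (u_ i)) -> Ws0L s M Omega u -> WmL M f ->
  (forall phi : distr, WmE M phi ->
    pairing s phi (u_ i) @[i --> \oo] --> pairing s phi u) ->
  (forall v, Ws0E s M Omega v ->
    pairing s (Lop s a (u_ i)) v @[i --> \oo] --> pairing s f v) ->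
  (limn_esup (fun i => (pairing s (Lop s a (u_ i)) (u_ i))%:E)
    <= (pairing s f u)%:E)%E ->
  [/\ Lop_dom s M Omega a u,
      distr_eq s Omega (Lop s a u) f &
      pairing s (Lop s a (u_ i)) (u_ i) @[i --> \oo] --> pairing s f u].
Proof.
move=> n0 s01 bO oO segO yM [[am ac aodd apos] [[d [b [c [Ed b0 c0 ag]]]] amon]] u_ u f domu Lu Lf weak1 weak2 sup3.
pose leb := @lebesgue_rV R n; pose nu := @frac_measure R n.
pose N := conj_young M; have MN : conjugate_pair M N := conj_young_pair yM.
have [eM eN _ _ _] := MN; have N00 : conj_young M 0 = 0 by case: eN.
(* The conditions on the kernel hold almost everywhere for the product Lebesgue measure, hence for
   [nu], which has a density with respect to it. *)
have am' xi : ae_measurable nu (fun p => a p.1 p.2 xi).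
  by have [v mv av] := am xi; exists v => //; exact: frac_measure_ae2.
have H0 xi : 0 <= conj_young_inv M (M (c * xi)) by case: (conj_young_invP yM (M (c * xi))).
have [a' [d' [a'c a'0 a'mon a'm [md' a'g a'E d'E]]]] :=
  regular_kernel (mu := nu) (a := fun p => a p.1 p.2) (H := fun xi => conj_young_inv M (M (c * xi)))
    (ltW b0) H0 am' (frac_measure_ae2 ac) (frac_measure_ae2 aodd) (proj1 Ed) (frac_measure_ae2 ag)
    (frac_measure_ae2 amon).
have Ed' : orliczE nu N d' := ae_orliczE d'E Ed.
have [theta [mtheta theta01 itheta]] := sigma_finite_weight nu.
have /choice[v_ v_P] i := Ws0L_representative yM oO (proj1 (domu i)).
have [v [sv vO uv]] := Ws0L_representative yM oO Lu.
have Dv_ i := fracD_ae s (let: And3 _ _ e := v_P i in e).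
have Dv := fracD_ae s uv.
have flux_ae w z : {ae nu, forall p, fracD s w p = fracD s z p} ->
    {ae nu, forall p, Lflux s a w p = a' p (fracD s z p)}.
  by move=> wz; apply: filterS2 wz a'E => p e1 e2; rewrite /Lflux e1 e2.
pose A i p := a' p (fracD s (v_ i) p).
have mDv_ i : measurable_fun setT (fracD s (v_ i)) by case: (v_P i) => -[mv _ _] _ _; exact: measurable_fracD.
have LDv_ i : orliczL nu M (fracD s (v_ i)) by case: (v_P i) => -[].
have mA i : measurable_fun setT (A i) by exact: a'm.
have LA i : orliczL nu N (A i) := ae_orliczL (flux_ae _ _ (Dv_ i)) (proj2 (domu i)).
have [mv Lv LDv] := sv; have mDv := measurable_fracD s mv.
have [[[g mg fg] _] [[G mG fG] _]] := Lf.
have [Lf1 Lf2] := Lf.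
have Lg : orliczL leb N g := ae_orliczL fg Lf1.
have LG : orliczL nu N G := ae_orliczL fG Lf2.
have fuE : pairing s f u = \int[leb]_x (g x * v x) - \int[nu]_p (G p * fracD s v p) := pairingE fg fG uv Dv.
(* A test function lies in W^s_0 E_M, so hypothesis (2) applies to it and can be rewritten with the
   regular representatives of the fluxes. *)
have test_pairing phi : test_function Omega phi -> [/\ measurable_fun setT phi,
    measurable_fun setT (fracD s phi), orliczE nu M (fracD s phi),
    pairing s f phi = \int[leb]_x (g x * phi x) - \int[nu]_p (G p * fracD s phi p) &
    \int[nu]_p (A i p * fracD s phi p) @[i --> \oo] --> pairing s f phi].
  move=> tphi; have Ephi := test_function_Ws0E yM n0 s01 tphi.
  have [cphi _ _ _] := test_function_lip tphi.
  have mphi := continuous_measurable_rV cphi; have mDphi := measurable_fracD s mphi.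
  have [[_ EDphi] _] := Ephi.
  have ephi : {ae leb, forall x, phi x = phi x} by exact: aeW.
  have eDphi : {ae nu, forall p, fracD s phi p = fracD s phi p} by exact: aeW.
  split => //; first exact: pairingE.
  rewrite (_ : (fun i => _) = (fun i => pairing s (Lop s a (u_ i)) phi)); first exact: weak2.
  apply/funext => i; apply/esym.
  exact: (pairing_LopE yM (mA i) mDphi (LA i) (orliczE_L EDphi) (flux_ae _ _ (Dv_ i)) eDphi).
have [Lau [F [UF oF Flim]] Acvg] : [/\ orliczL nu N (fun p => a' p (fracD s v p)),
    exists F : set_system nat, [/\ UltraFilter F, \oo `<=` F &
      forall w, measurable_fun setT w -> orliczE nu M w ->
      \int[nu]_p (A i p * w p) @[i --> F] --> \int[nu]_p (a' p (fracD s v p) * w p)] &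
    \int[nu]_p (A i p * fracD s (v_ i) p) @[i --> \oo] --> pairing s f u].
  apply: (minty_limit mtheta theta01 itheta MN a'c a'0 a'mon a'm md' Ed' b0 c0
    (I := conj_young_inv M) (m0 := M 1) _ a'g mDv_ LDv_ LA mDv LDv) => [r r0|w mw Ew||F h UF oF mh Lh hlim].
  - have [h1 /(_ r0) h2] := conj_young_invP yM r; split => //; exact: conj_young_inv_le.
  - have Ew0 : WmE M (cst 0, w).
      split => //; apply: scale_orliczE => // r; rewrite /modular integral0_eq ?ltry// => x _.
      by rewrite mulr0 N00.
    have E z z' : {ae nu, forall p, fracD s z p = fracD s z' p} ->
        pairing s (cst 0, w) z = - \int[nu]_p (fracD s z' p * w p).
      move=> zz; rewrite /pairing /= Rintegral_eq0 ?sub0r; last by move=> x; rewrite mul0r.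
      by congr (- _); apply: ae_Rintegral_eq; apply: filterS zz => p ->; rewrite mulrC.
    have := weak1 _ Ew0; rewrite (E _ _ Dv) => H.
    rewrite -[X in _ --> X]opprK.
    have -> : (fun i => \int[nu]_p (fracD s (v_ i) p * w p)) = (fun i => - pairing s (cst 0, w) (u_ i)).
      by apply/funext => i; rewrite (E _ _ (Dv_ i)) opprK.
    exact: cvgN.
  - apply: le_trans sup3; rewrite le_eqVlt; apply/orP; left; apply/eqP.
    congr limn_esup; apply/funext => i; congr EFin; apply/esym.
    exact: (pairing_LopE yM (mA i) (mDv_ i) (LA i) (LDv_ i) (flux_ae _ _ (Dv_ i)) (Dv_ i)).
  - have FF : ProperFilter F by exact: ultra_proper.
    (* This pair encodes [w |-> int h * D^s w - <f, w>]; [G] enters with a plus sign because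
       [pairing] subtracts its second integral. It annihilates the test functions by hypothesis (2),
       hence also [v], which is the energy identity sought. *)
    have data : functional_data N (fun x => -1 * g x) (fun p => h p + G p).
      split => //; [exact: measurable_funM|exact: measurable_funD|exact: orliczLZ|exact: orliczLD].
    have split_functional w : frac_sobolev s M w ->
        functional s (fun x => -1 * g x) (fun p => h p + G p) w =
        \int[nu]_p (h p * fracD s w p) - (\int[leb]_x (g x * w x) - \int[nu]_p (G p * fracD s w p)).
      move=> sw; have [mw Lw LDw] := sw; have mDw := measurable_fracD s mw.
      have NM := conjugate_pairC MN.
      have i1 := orliczLE_integrable NM mg mw Lg Lw.
      have i2 := orliczLE_integrable NM mG mDw LG LDw.
      have i3 := orliczLE_integrable NM mh mDw Lh LDw.
      transitivity (\int[leb]_x (- (g x * w x)) +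
          \int[nu]_p (h p * fracD s w p + G p * fracD s w p)).
        rewrite /functional; congr (_ + _); apply: eq_Rintegral => x _; last by rewrite mulrDl.
        by rewrite mulN1r mulNr.
      by rewrite RintegralN// RintegralD//; ring.
    have ann phi : test_function Omega phi -> functional s (fun x => -1 * g x) (fun p => h p + G p) phi = 0.
      move=> tphi; have [mphi mDphi EDphi fphi lphi] := test_pairing _ tphi.
      have [[Ephi _] _] := test_function_Ws0E yM n0 s01 tphi.
      rewrite split_functional; last by split => //; exact: orliczE_L.
      rewrite -fphi; apply/eqP; rewrite subr_eq0; apply/eqP.
      rewrite -(cvg_lim _ (hlim _ mDphi EDphi))//; apply/cvg_lim => //.
      by apply: cvg_trans lphi => B; exact: oF.
    have := annihilates_frac_sobolev n0 s01 MN bO oO segO data ann sv vO.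
    by rewrite split_functional// fuE => /eqP; rewrite subr_eq0 => /eqP.
have FF : ProperFilter F by exact: ultra_proper.
have ma'v := a'm _ mDv.
split.
- split => //; apply: ae_orliczL Lau.
  by apply: filterS (flux_ae _ _ Dv) => p ->.
- move=> phi tphi; have [mphi mDphi EDphi fphi lphi] := test_pairing _ tphi.
  have eDphi : {ae nu, forall p, fracD s phi p = fracD s phi p} by exact: aeW.
  rewrite (pairing_LopE yM ma'v mDphi Lau (orliczE_L EDphi) (flux_ae _ _ Dv) eDphi).
  (* Along [F] the integrals tend both to the pairing with the flux of [v] and, by hypothesis (2),
     to the pairing of [f] with [phi]. *)
  rewrite -(cvg_lim _ (Flim _ mDphi EDphi))//; apply/cvg_lim => //.
  by apply: cvg_trans lphi => B; exact: oF.
- rewrite (_ : (fun i => _) = (fun i => \int[nu]_p (A i p * fracD s (v_ i) p)))//.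
  apply/funext => i.
  exact: (pairing_LopE yM (mA i) (mDv_ i) (LA i) (LDv_ i) (flux_ae _ _ (Dv_ i)) (Dv_ i)).
Qed.
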